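(* Let $R$ be a Hecke symmetry with birank $(r,s)$ on a finite-dimensional super vector space $V$ over $\mathbb K$, with $\operatorname{tr}(C)=-[s-r]_q$, and let $\int$ be the integral on $H_R$ normalized as in the context. Let $\mathcal K$ be an algebra, let $M$ be a $\mathcal K$-point of $E_R$ and let $N$ be a $\mathcal K$-point of $E_R'=S(E_R)$ (the subbialgebra of $H_R$ generated by the $t^i_j$). Assume that the entries of $M$ and $N$ commute and that they commute with the entries of $Z$ and $T$. Then $$\int \operatorname{tr}\bigl(D^{\otimes n}M^{\otimes n}Z^{\otimes n}\,\overline{N^{\otimes n}}\;\overline{T^{\otimes n}}\bigr)=q^{-n(r-s+1)}\sum_{\lambda\in\Omega^{r,s}_n}\frac{d_\lambda\,p_\lambda}{k_\lambda}\,S_\lambda(M)\,S_{-\lambda}(N).$$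
   Context: **Hecke symmetry.** $\mathbb K$ is a field of characteristic $0$, $V$ a super vector space over $\mathbb K$ with homogeneous basis $x_1,\dots,x_d$; $\hat i$ is the parity of $x_i$. Repeated upper and lower indices are summed. An even operator $R$ on $V\otimes V$, $R(x_i\otimes x_j)=x_k\otimes x_l R^{kl}_{ij}$, is a Hecke symmetry if: (i) $R_1R_2R_1=R_2R_1R_2$ with $R_1=R\otimes \mathrm{id}$, $R_2=\mathrm{id}\otimes R$; (ii) $(R-q)(R+1)=0$ for some $q$ which is not a root of unity; (iii) there is a matrix $P^{kl}_{ij}$ with $P^{im}_{jn}R^{nk}_{ml}=\delta^i_l\delta^k_j$. Put $C^i_j:=P^{il}_{jl}$, an operator on $V$; $\operatorname{tr}$ is the trace of matrices. $[k]_q:=(q^k-1)/(q-1)$ for $k\in\mathbb Z$. A square root $q^{1/2}$ is fixed. **Hecke algebra.** $\mathcal H_n$ is generated by $T_1,\dots,T_{n-1}$ with the braid relations and $T_i^2=(q-1)T_i+q$; it has basis $T_w$, $w\in\mathfrak S_n$; $l(w)$ is the length. It acts on $V^{\otimes n}$ by $\rho_n(T_i)=R_i:=\mathrm{id}^{\otimes (i-1)}\otimes R\otimes\mathrm{id}^{\otimes(n-i-1)}$; $R_w:=\rho_n(T_w)$. For an operator $W$ on $V^{\otimes n}$, $W(x_I)=x_JW^J_I$, where $x_I=x_{i_1}\otimes\dots\otimes x_{i_n}$. **Birank.** Let $\Lambda_n:=\operatorname{Im}\rho_n(y_n)$, $y_n=\frac1{[n]_{1/q}!}\sum_w(-q)^{-l(w)}T_w$.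 The series $\sum_n t^n\dim\Lambda_n$ is a rational function with negative roots and positive poles; the birank $(r,s)$ is (number of its roots, number of its poles). **$E_R$ and $H_R$.** $E_R$ is the superbialgebra generated by $z^i_j$ (parity $\hat i+\hat j$) with relations $$(-1)^{\hat s(\hat i+\hat p)}R^{kl}_{ps}z^p_iz^s_j=(-1)^{\hat l(\hat q+\hat k)}z^k_qz^l_nR^{qn}_{ij}.$$ $H_R$ is the Hopf superalgebra generated by $z^i_j,t^i_j$ (parity $\hat i+\hat j$) with these relations and $(-1)^{\hat k(\hat j+\hat k)}z^i_jt^j_k=(-1)^{\hat l(\hat l+\hat i)}t^i_lz^l_k=\delta^i_k$. Here $\Delta(z^i_j)=z^i_k\otimes z^k_j$, $\Delta(t^i_j)=t^k_j\otimes t^i_k$, $S(z^i_j)=(-1)^{\hat j(\hat i+\hat j)}t^i_j$, with the super sign rule throughout. The natural map $E_R\to H_R$ is injective. **The operator $D$.** $H_R$ is a coribbon Hopf (super)algebra; let $r(\cdot,\cdot)$ be the bilinear form on $H_R$ given by its coquasitriangular structure, the one underlying its coribbon structure. Put $D^i_j:=r(z^i_l,S(z^l_j))$, a $d\times d$ matrix regarded as an operator on $V$. **Matrices.** For $I=(i_1,\dots,i_n)$, $J=(j_1,\dots,j_n)$ put $|\hat I|:=\sum_k\hat i_k$ and $I':=(i_n,\dots,i_1)$. Define $\operatorname{sign}(i,j)=1$, $\operatorname{sign}(Ii,Jj)=(-1)^{\hat i(|\hat I|+|\hat J|)}\operatorname{sign}(I,J)$. $Z^{\otimes n}$ is the matrix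 with entries $Z^I_J:=\operatorname{sign}(I,J)\,z^{i_1}_{j_1}\cdots z^{i_n}_{j_n}$. The elements $T^{I'}_{J'}$ are the correspondingly signed monomials $\pm t^{i_n}_{j_n}\cdots t^{i_1}_{j_1}$, with signs such that $$S(Z^I_J)=(-1)^{|\hat J|(|\hat I|+|\hat J|)}\,T^{I'}_{J'} .$$ $\overline{T^{\otimes n}}$ is the matrix with entries $\overline{T^{\otimes n}}{}^I_J:=T^{I'}_{J'}$. In all matrices the upper index is the row index and the lower the column index. **Points.** A $\mathcal K$-point of a (super)bialgebra $B$ is an algebra homomorphism $B\to\mathcal K$. For the $\mathcal K$-point $M$ of $E_R$, $M^{\otimes n}$ is the entrywise image of $Z^{\otimes n}$; for the $\mathcal K$-point $N$ of $E_R'$, $\overline{N^{\otimes n}}$ is the entrywise image of $\overline{T^{\otimes n}}$. For elements $S_\lambda\in E_R$, $S_{-\lambda}\in E_R'$, $S_\lambda(M)$ and $S_{-\lambda}(N)$ denote their images under these points. The integral is extended $\mathcal K$-linearly to $\mathcal K\otimes H_R$. **Combinatorial data.** The content of a box in row $i$, column $j$ is $j-i$; $[\lambda]$ is the diagram of $\lambda$. In $\mathcal H_n$ let $L_1=0$, $L_m=\sum_{i=1}^{m-1}q^{-i}T_{(m-i,m)}$. For a standard tableau $t$ of shape $\lambda\vdash n$, with $c_t(m)$ the content of the box containing $m$, $$E_t:=\prod_{m=1}^n\ \prod_{|k|\le m-1,\ k\ne c_t(m)}\frac{L_m-[k]_q}{[c_t(m)]_q-[k]_q},\qquad F_\lambda:=\sum_{t\text{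 standard of shape }\lambda}E_t ;$$ the $E_t$ are primitive idempotents and $F_\lambda$ is the minimal central idempotent of $\lambda$. $d_\lambda$ is the number of standard tableaux of shape $\lambda$. $\Omega^{r,s}_n$ is the set of $\lambda\vdash n$ with $\lambda_{r+1}\le s$ whose diagram contains the rectangle $(s^r)$ ($r$ rows of length $s$). For $\lambda\in\Omega_n^{r,s}$, $$p_\lambda:=\prod_{x\in[\lambda]\setminus[(s^r)]}\frac{q^{r-s}}{[c_\lambda(x)+r-s]_q},\qquad k_\lambda:=q^{n(\lambda)}\prod_{x\in[\lambda]}[h(x)]_q^{-1},$$ with $c_\lambda(x)$ the content of $x$, $n(\lambda)=\sum_i(i-1)\lambda_i$, $h(x)$ the hook length of $x$. Put $P_n:=\sum_{\lambda\in\Omega^{r,s}_n}p_\lambda\,\rho_n(F_\lambda)$. **Integral.** An integral on $H_R$ is a nonzero even linear functional with $(\mathrm{id}\otimes\int)\Delta(a)=\int(a)\cdot 1$. Under the assumption on $\operatorname{tr}(C)$ it exists and is unique up to scalar, and $\int$ is normalized so that for index sequences of length $n$ $$\int\bigl(Z^J_I\,T^{L'}_{K'}\bigr)=(-1)^{|\hat K|(|\hat K|+|\hat L|)}\sum_{w\in\mathfrak S_n}q^{-l(w)}\,\bigl(P_nC^{\otimes n}R_{w^{-1}}\bigr)^{L}_{I}\,\bigl(R_w\bigr)^{J}_{K}$$ (which is $0$ if $n<rs$). **Characters.** For $\lambda\vdash n$ with $\lambda_{r+1}\le s$, let $E_\lambda$ be the image under $\rho_n$ of a primitive idempotent of $\mathcal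 H_n$ belonging to the block of $\lambda$ (e.g. some $E_t$, $t$ of shape $\lambda$), and let $M_\lambda=\operatorname{Im}E_\lambda$ be the corresponding simple comodule. The characters of $M_\lambda$ and of its dual $M_\lambda^*$ are $$S_\lambda:=q^{n(r-s+1)/2}\operatorname{tr}(D^{\otimes n}E_\lambda Z^{\otimes n}),\qquad S_{-\lambda}:=q^{n(r-s+1)/2}\operatorname{tr}(C^{\otimes n}E_\lambda\overline{T^{\otimes n}}).$$
   Formalization: Matrix products with a barred right factor (N-bar, T-bar) carry the super sign (-1)^{|L|(|J|+|L|)} on the (J,L) entry; with unsigned products the formula fails when V has both parities (n=1, V of dimension 1|1, M=N=counit). *)

(* Defs.v *)
From HB Require Import structures.
Set Warnings "-redundant-canonical-projection,-notation-overridden".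
Set Warnings "-ambiguous-paths,-projection-no-head-constant".
From mathcomp Require Import fingroup perm all_boot all_order all_algebra algC.
From mathcomp Require Import generic_quotient boolp.

Set Implicit Arguments.
Unset Strict Implicit.
Unset Printing Implicit Defensive.

Import Order.TTheory GRing.Theory Num.Theory.
Local Open Scope ring_scope.
Local Open Scope quotient_scope.

Section Terms.
Variables (K : fieldType) (G : Type).

(* Terms over a set of generators; eval interprets them in a K-algebra, given as
   a (possibly zero) ring A with a central ring morphism iota : K -> A. *)
Inductive term : Type :=
| Const of K
| Gen of G
| Add of term & term
| Mul of term & term.

HB.instance Definition _ := gen_eqMixin term.
HB.instance Definition _ := gen_choiceMixin term.

Definition central (A : pzRingType) (iota : K -> A) :=
  forall c x, iota c * x = x * iota c.

Fixpoint eval (A : pzRingType) (iota : K -> A) (f : G -> A) (t : term) : A :=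
  match t with
  | Const c => iota c
  | Gen g => f g
  | Add a b => eval iota f a + eval iota f b
  | Mul a b => eval iota f a * eval iota f b
  end.

Definition satisfies (rels : term -> term -> Prop) (A : pzRingType)
    (iota : K -> A) (f : G -> A) :=
  forall a b, rels a b -> eval iota f a = eval iota f b.

Variable rels : term -> term -> Prop.

(* Two terms are identified when they agree in every K-algebra in which the
   relations hold; the quotient is the K-algebra with the given generators and
   relations. *)
Definition peq (a b : term) : bool :=
  `[< forall (A : pzRingType) (iota : {rmorphism K -> A}) (f : G -> A),
        central iota -> satisfies rels iota f ->
        eval iota f a = eval iota f b >].

Lemma peqP a b : reflect
  (forall (A : pzRingType) (iota : {rmorphism K -> A}) (f : G -> A),
        central iota -> satisfies rels iota f ->
        eval iota f a = eval iota f b) (peq a b).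
Proof. exact: asboolP. Qed.

Lemma peq_refl : reflexive peq.
Proof. by move=> a; apply/peqP. Qed.
Lemma peq_sym : symmetric peq.
Proof.
by move=> a b; apply/peqP/peqP => H A io f c s; rewrite (H A io f c s).
Qed.
Lemma peq_trans : transitive peq.
Proof.
move=> b a c /peqP H1 /peqP H2; apply/peqP => A io f ce s.
by rewrite (H1 A io f ce s) (H2 A io f ce s).
Qed.

Canonical peq_equiv := EquivRel peq peq_refl peq_sym peq_trans.

Definition presented : Type := {eq_quot peq}.
HB.instance Definition _ := Choice.on presented.
HB.instance Definition _ := EqQuotient.on presented.

Definition cls (a : term) : presented := \pi_presented a.

Lemma clsP a b :
  (forall (A : pzRingType) (iota : {rmorphism K -> A}) (f : G -> A),
        central iota -> satisfies rels iota f ->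
        eval iota f a = eval iota f b) <-> cls a = cls b.
Proof.
split=> [H|/eqmodP H]; first by apply/eqmodP; apply/peqP.
exact/peqP.
Qed.

Lemma clsK x : cls (repr x) = x. Proof. exact: reprK. Qed.

Lemma eval_repr a (A : pzRingType) (iota : {rmorphism K -> A}) (f : G -> A) :
  central iota -> satisfies rels iota f ->
  eval iota f (repr (cls a)) = eval iota f a.
Proof. by apply: (clsP _ _).2; rewrite clsK. Qed.

Definition pzero : presented := cls (Const 0).
Definition pone : presented := cls (Const 1).
Definition padd (x y : presented) : presented := cls (Add (repr x) (repr y)).
Definition pmul (x y : presented) : presented := cls (Mul (repr x) (repr y)).
Definition pscale (c : K) (x : presented) : presented :=
  cls (Mul (Const c) (repr x)).
Definition popp (x : presented) : presented := pscale (-1) x.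

Ltac psolve := move=> *; apply/clsP => A io f ce s /=; rewrite ?eval_repr //=.

Fact paddA : associative padd.
Proof. by psolve; rewrite addrA. Qed.
Fact paddC : commutative padd.
Proof. by psolve; rewrite addrC. Qed.
Fact padd0 : left_id pzero padd.
Proof. move=> x; rewrite -[RHS]clsK; psolve; by rewrite rmorph0 add0r. Qed.
Fact paddN : left_inverse pzero popp padd.
Proof. by psolve; rewrite rmorphN rmorph1 rmorph0 mulN1r addNr. Qed.
Fact pmulA : associative pmul.
Proof. by psolve; rewrite mulrA. Qed.
Fact pmul1 : left_id pone pmul.
Proof. move=> x; rewrite -[RHS]clsK; psolve; by rewrite rmorph1 mul1r. Qed.
Fact pmulr1 : right_id pone pmul.
Proof. move=> x; rewrite -[RHS]clsK; psolve; by rewrite rmorph1 mulr1. Qed.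
Fact pmulDl : left_distributive pmul padd.
Proof. by psolve; rewrite mulrDl. Qed.
Fact pmulDr : right_distributive pmul padd.
Proof. by psolve; rewrite mulrDr. Qed.

HB.instance Definition _ := GRing.isPzRing.Build presented
  paddA paddC padd0 paddN pmulA pmul1 pmulr1 pmulDl pmulDr.

Fact pscaleA a b x : pscale a (pscale b x) = pscale (a * b) x.
Proof. by psolve; rewrite mulrA rmorphM. Qed.
Fact pscale1 : left_id 1 pscale.
Proof. move=> x; rewrite -[RHS]clsK; psolve; by rewrite rmorph1 mul1r. Qed.
Fact pscaleDr : right_distributive pscale +%R.
Proof. by psolve; rewrite mulrDr. Qed.
Fact pscaleDl x : {morph pscale^~ x : a b / a + b}.
Proof. by psolve; rewrite rmorphD mulrDl. Qed.

HB.instance Definition _ := GRing.Zmodule_isLmodule.Build K presented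
  pscaleA pscale1 pscaleDr pscaleDl.

Lemma pscalerAl (c : K) (x y : presented) : c *: (x * y) = (c *: x) * y.
Proof. by psolve; rewrite mulrA. Qed.
Lemma pscalerAr (c : K) (x y : presented) : c *: (x * y) = x * (c *: y).
Proof. by psolve; rewrite mulrA ce -mulrA. Qed.

Definition pgen (g : G) : presented := cls (Gen g).

Section Lift.
Variables (A : pzRingType) (iota : {rmorphism K -> A}) (f : G -> A).

(* The algebra morphism extending f. It is defined for every f, but is a morphism
   only when f satisfies the relations. *)
Definition plift (x : presented) : A := eval iota f (repr x).

Hypotheses (ce : central iota) (sat : satisfies rels iota f).

Lemma plift_cls a : plift (cls a) = eval iota f a.
Proof. exact: eval_repr. Qed.
Lemma plift_gen g : plift (pgen g) = f g.
Proof. exact: plift_cls. Qed.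
Lemma pliftD : {morph plift : x y / x + y}.
Proof. by move=> x y; rewrite plift_cls. Qed.
Lemma pliftM : {morph plift : x y / x * y}.
Proof. by move=> x y; rewrite plift_cls. Qed.
Lemma plift1 : plift 1 = 1.
Proof. by rewrite plift_cls /= rmorph1. Qed.
Lemma plift0 : plift 0 = 0.
Proof. by rewrite plift_cls /= rmorph0. Qed.
Lemma pliftZ c x : plift (c *: x) = iota c * plift x.
Proof. by rewrite plift_cls. Qed.
End Lift.

Lemma clsE a : cls a = eval (fun c => c *: (1 : presented)) pgen a.
Proof.
elim: a => //= [c|a <- b <-|a <- b <-].
- by psolve; rewrite rmorph1 mulr1.
- by psolve.
- by psolve.
Qed.

Lemma pgen_sat : satisfies rels (fun c => c *: (1 : presented)) pgen.
Proof.
by move=> a b ab; rewrite -!clsE; apply/clsP => A io f _ /(_ a b ab).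
Qed.

Lemma pind (P : presented -> Prop) :
  (forall c, P (c *: (1 : presented))) -> (forall g, P (pgen g)) ->
  (forall x y, P x -> P y -> P (x + y)) ->
  (forall x y, P x -> P y -> P (x * y)) -> forall x, P x.
Proof.
move=> Pc Pg PD PM x; rewrite -[x]clsK clsE; elim: (repr x) => //= *.
  exact: PD.
exact: PM.
Qed.

End Terms.

Arguments Const {K G} c.
Arguments Gen {K G} g.
Arguments Add {K G}.
Arguments Mul {K G}.

Lemma eval_sum (K : fieldType) G (A : pzRingType) (iota : {rmorphism K -> A})
    (f : G -> A) (I : Type) (s : seq I) (F : I -> term K G) :
  eval iota f (\big[Add/Const 0]_(i <- s) F i) =
  \sum_(i <- s) eval iota f (F i).
Proof.
elim: s => [|i s IH]; first by rewrite !big_nil /= rmorph0.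
by rewrite !big_cons /= IH.
Qed.

Section Tensor.
Variables (K : fieldType) (U V : lmodType K).

Definition bilinear_map (W : lmodType K) (f : U -> V -> W) :=
  (forall v, linear (f^~ v)) /\ (forall u, linear (f u)).

Definition fsum (W : nmodType) (f : U -> V -> W) (s : seq (U * V)) : W :=
  \sum_(p <- s) f p.1 p.2.

(* U (x) V is the set of formal sums of pairs, two of them being identified when
   every bilinear map takes the same value on both. *)
Definition teq (s s' : seq (U * V)) : bool :=
  `[< forall (W : lmodType K) (f : U -> V -> W), bilinear_map f ->
        fsum f s = fsum f s' >].

Lemma teqP s s' : reflect (forall (W : lmodType K) (f : U -> V -> W),
  bilinear_map f -> fsum f s = fsum f s') (teq s s').
Proof. exact: asboolP. Qed.

Lemma teq_refl : reflexive teq.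
Proof. by move=> a; apply/teqP. Qed.
Lemma teq_sym : symmetric teq.
Proof. by move=> a b; apply/teqP/teqP => H W f bf; rewrite (H W f bf). Qed.
Lemma teq_trans : transitive teq.
Proof.
move=> b a c /teqP H1 /teqP H2; apply/teqP => W f bf.
by rewrite (H1 W f bf) (H2 W f bf).
Qed.

Canonical teq_equiv := EquivRel teq teq_refl teq_sym teq_trans.

Definition tensor : Type := {eq_quot teq}.
HB.instance Definition _ := Choice.on tensor.
HB.instance Definition _ := EqQuotient.on tensor.

Definition tcls (s : seq (U * V)) : tensor := \pi_tensor s.

Lemma tclsP s s' : (forall (W : lmodType K) (f : U -> V -> W),
  bilinear_map f -> fsum f s = fsum f s') <-> tcls s = tcls s'.
Proof.
split=> [H|/eqmodP H]; first by apply/eqmodP; apply/teqP.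
exact/teqP.
Qed.

Lemma tclsK x : tcls (repr x) = x. Proof. exact: reprK. Qed.

Lemma fsum_repr s (W : lmodType K) (f : U -> V -> W) : bilinear_map f ->
  fsum f (repr (tcls s)) = fsum f s.
Proof. by apply: (tclsP _ _).2; rewrite tclsK. Qed.

Definition tzero : tensor := tcls [::].
Definition tadd (x y : tensor) : tensor := tcls (repr x ++ repr y).
Definition tscale (c : K) (x : tensor) : tensor :=
  tcls [seq (c *: p.1, p.2) | p <- repr x].
Definition topp (x : tensor) : tensor := tscale (-1) x.

Lemma fsum_cat (W : nmodType) (f : U -> V -> W) s s' :
  fsum f (s ++ s') = fsum f s + fsum f s'.
Proof. by rewrite /fsum big_cat. Qed.
Lemma fsum_scale (W : lmodType K) (f : U -> V -> W) c s : bilinear_map f ->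
  fsum f [seq (c *: p.1, p.2) | p <- s] = c *: fsum f s.
Proof.
move=> [bl br]; rewrite /fsum big_map scaler_sumr; apply: eq_bigr => p _ /=.
have := bl p.2 c p.1 0.
have := bl p.2 1 0 0; rewrite !scale1r !addr0 -{1}[f 0 _]addr0 => /addrI <-.
by rewrite !addr0.
Qed.

Ltac tsolve := move=> *; apply/tclsP => W f bf;
  rewrite ?(fsum_repr, fsum_cat, fsum_scale) //.

Fact taddA : associative tadd. Proof. by tsolve; rewrite addrA. Qed.
Fact taddC : commutative tadd. Proof. by tsolve; rewrite addrC. Qed.
Fact tadd0 : left_id tzero tadd.
Proof.
move=> x; rewrite -[RHS]tclsK; tsolve.
by rewrite {1}/fsum big_nil add0r.
Qed.
Fact taddN : left_inverse tzero topp tadd.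
Proof. by tsolve; rewrite scaleN1r addNr /fsum big_nil. Qed.

HB.instance Definition _ := GRing.isZmodule.Build tensor taddA taddC tadd0 taddN.

Fact tscaleA a b x : tscale a (tscale b x) = tscale (a * b) x.
Proof. by tsolve; rewrite scalerA. Qed.
Fact tscale1 : left_id 1 tscale.
Proof. by move=> x; rewrite -[RHS]tclsK; tsolve; rewrite scale1r. Qed.
Fact tscaleDr : right_distributive tscale +%R.
Proof. by tsolve; rewrite scalerDr. Qed.
Fact tscaleDl x : {morph tscale^~ x : a b / a + b}.
Proof. by tsolve; rewrite scalerDl. Qed.

HB.instance Definition _ := GRing.Zmodule_isLmodule.Build K tensor
  tscaleA tscale1 tscaleDr tscaleDl.

Definition pure (u : U) (v : V) : tensor := tcls [:: (u, v)].

Lemma fsum1 (W : nmodType) (f : U -> V -> W) u v : fsum f [:: (u, v)] = f u v.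
Proof. by rewrite /fsum big_seq1. Qed.

Lemma pure_bilinear : bilinear_map pure.
Proof.
split=> [v c u u'|u c v v']; tsolve; rewrite !fsum1.
- by case: bf => bl _; rewrite bl.
- by case: bf => _ br; rewrite br.
Qed.

(* The linear map induced by a bilinear f; meaningful only for bilinear f. *)
Definition tlift (W : lmodType K) (f : U -> V -> W) (x : tensor) : W :=
  fsum f (repr x).

Lemma tlift_pure (W : lmodType K) (f : U -> V -> W) u v : bilinear_map f ->
  tlift f (pure u v) = f u v.
Proof. by move=> bf; rewrite /tlift fsum_repr // fsum1. Qed.

Lemma tlift_linear (W : lmodType K) (f : U -> V -> W) : bilinear_map f ->
  linear (tlift f).
Proof. by move=> bf c x y; rewrite /tlift !(fsum_repr, fsum_cat, fsum_scale). Qed.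

Lemma tclsE s : tcls s = \sum_(p <- s) pure p.1 p.2.
Proof.
elim: s => [|[u v] s IH]; first by rewrite big_nil.
by rewrite big_cons -IH; tsolve; rewrite /fsum !big_cons big_nil addr0.
Qed.

Lemma tind (P : tensor -> Prop) : P 0 -> (forall u v, P (pure u v)) ->
  (forall x y, P x -> P y -> P (x + y)) -> forall x, P x.
Proof.
move=> P0 Pp PD x; rewrite -[x]tclsK tclsE.
by elim: (repr x) => [|p s IH]; rewrite ?big_nil ?big_cons //; apply: PD.
Qed.

End Tensor.

(* hc p a is the homogeneous component of a of parity p (true = odd). *)
Record superAlg (K : fieldType) := SuperAlg {
  sacar :> algType K;
  hc : bool -> sacar -> sacar;
  hc_linear : forall p, linear (hc p);
  hc_sum : forall a, hc false a + hc true a = a;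
  hc_hc : forall p q a, hc p (hc q a) = if p == q then hc q a else 0;
  hc_one : hc false 1 = 1;
  hc_mul : forall p q a b, hc (p (+) q) (hc p a * hc q b) = hc p a * hc q b
}.

HB.instance Definition _ (K : fieldType) (A : superAlg K) (p : bool) :=
  GRing.isLinear.Build K A A *:%R (hc p) (hc_linear (s:=A) p).

(* For bilinear F this is (-1)^{|a||b|} F a b on homogeneous a and b: the sign of
   exchanging the adjacent factors a and b. *)
Definition koszul (K : fieldType) (A B : superAlg K) (W : lmodType K)
    (F : A -> B -> W) (a : A) (b : B) : W :=
  \sum_(p : bool) \sum_(q : bool) (-1) ^+ (p && q) *: F (hc p a) (hc q b).

(* The tensor product carries (a (x) b)(a' (x) b') = (-1)^{|b||a'|} aa' (x) bb'. *)
Definition stensor (K : fieldType) (A B : superAlg K) : Type := tensor A B.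

Section SuperTensor.
Variables (K : fieldType) (A B : superAlg K).
Local Notation AB := (stensor A B).
HB.instance Definition _ := GRing.Lmodule.on AB.

Definition smul (x y : AB) : AB :=
  tlift (fun a b => tlift (fun a' b' =>
    koszul (fun (b1 : B) (a1 : A) => pure (a * a1) (b1 * b')) b a') y) x.

Lemma hc_homog (C : superAlg K) p q (c : C) : hc p c = c ->
  hc q c = if q == p then c else 0.
Proof. by move=> <-; exact: hc_hc. Qed.

Lemma pure_l v : linear (fun u : A => pure u v : AB).
Proof. exact: (pure_bilinear A B).1. Qed.
Lemma pure_r u : linear (fun v : B => pure u v : AB).
Proof. exact: (pure_bilinear A B).2. Qed.

Lemma koszul_bil (C D : superAlg K) (W : lmodType K) (F : C -> D -> W) :
  bilinear_map F -> bilinear_map (koszul F).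
Proof.
move=> [bl br]; split=> [v c u u'|u c v v'].
  rewrite /koszul scaler_sumr -big_split; apply: eq_bigr => p _ /=.
  rewrite scaler_sumr -big_split; apply: eq_bigr => q _ /=.
  by rewrite linearP bl scalerDr !scalerA [c * _]mulrC.
rewrite /koszul scaler_sumr -big_split; apply: eq_bigr => p _ /=.
rewrite scaler_sumr -big_split; apply: eq_bigr => q _ /=.
by rewrite linearP br scalerDr !scalerA [c * _]mulrC.
Qed.

Lemma koszul_homog (C D : superAlg K) (W : lmodType K) (F : C -> D -> W) p q c d :
  bilinear_map F -> hc p c = c -> hc q d = d ->
  koszul F c d = (-1) ^+ (p && q) *: F c d.
Proof.
move=> [bl br] hp hq.
have F0 u : F u 0 = 0.
  by have := br u (-1) 0 0; rewrite scaler0 addr0 scaleN1r addNr.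
have F0' v : F 0 v = 0.
  by have := bl v (-1) 0 0; rewrite scaler0 addr0 scaleN1r addNr.
rewrite /koszul (bigD1 p) //= [X in _ + X]big1 ?addr0; last first.
  move=> p' np; rewrite big1 // => q' _.
  by rewrite (hc_homog p' hp) (negPf np) F0' scaler0.
rewrite (bigD1 q) //= [X in _ + X]big1 ?addr0 ?hp ?hq // => q' nq.
by rewrite (hc_homog q' hq) (negPf nq) F0 scaler0.
Qed.

Lemma bil_in a b' :
  bilinear_map (fun (b1 : B) (a1 : A) => pure (a * a1) (b1 * b') : AB).
Proof.
split=> [v c u u'|u c v v'].
  by rewrite mulrDl -scalerAl pure_r.
by rewrite mulrDr -scalerAr pure_l.
Qed.

Lemma bil_mid a b : bilinear_map (fun a' b' =>
    koszul (fun (b1 : B) (a1 : A) => pure (a * a1) (b1 * b') : AB) b a').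
Proof.
split=> [v c u u'|u c v v'].
  exact: (koszul_bil (bil_in a v)).2.
rewrite /koszul scaler_sumr -big_split; apply: eq_bigr => p _ /=.
rewrite scaler_sumr -big_split; apply: eq_bigr => q _ /=.
by rewrite mulrDr -scalerAr pure_r scalerDr !scalerA [c * _]mulrC.
Qed.

Lemma fsum_linear (U V : lmodType K) (W : lmodType K) c
  (f g h : U -> V -> W) s :
  (forall u v, f u v = c *: g u v + h u v) ->
  fsum f s = c *: fsum g s + fsum h s.
Proof.
by move=> H; rewrite /fsum scaler_sumr -big_split; apply: eq_bigr.
Qed.

Lemma bil_out y : bilinear_map (fun a b => tlift (fun a' b' =>
    koszul (fun (b1 : B) (a1 : A) => pure (a * a1) (b1 * b') : AB) b a') y).
Proof.
split=> [v c u u'|u c v v']; apply: fsum_linear => a' b'.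
  rewrite /koszul scaler_sumr -big_split; apply: eq_bigr => p _ /=.
  rewrite scaler_sumr -big_split; apply: eq_bigr => q _ /=.
  by rewrite mulrDl -scalerAl pure_l scalerDr !scalerA [c * _]mulrC.
exact: (koszul_bil (bil_in u b')).1.
Qed.

Lemma smul_pure a b a' b' : smul (pure a b) (pure a' b') =
  koszul (fun (b1 : B) (a1 : A) => pure (a * a1) (b1 * b')) b a'.
Proof.
rewrite /smul (tlift_pure _ _ (bil_out _)).
by rewrite (tlift_pure _ _ (bil_mid _ _)).
Qed.

Lemma smul_homog q p (a : A) (b : B) (a' : A) (b' : B) :
  hc q b = b -> hc p a' = a' ->
  smul (pure a b) (pure a' b') = (-1) ^+ (q && p) *: pure (a * a') (b * b').
Proof. by move=> hb ha; rewrite smul_pure (koszul_homog (bil_in _ _) hb ha). Qed.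

Lemma smul_linl y : linear (smul^~ y).
Proof. exact: (tlift_linear (bil_out y)). Qed.
Lemma smul_linr x : linear (smul x).
Proof.
move=> c y y'; apply: fsum_linear => a b.
exact: (tlift_linear (bil_mid a b)).
Qed.

Lemma smulDl : left_distributive smul +%R.
Proof. by move=> x y z; have := smul_linl z 1 x y; rewrite !scale1r. Qed.
Lemma smulDr : right_distributive smul +%R.
Proof. by move=> x y z; have := smul_linr x 1 y z; rewrite !scale1r. Qed.
Lemma smul0l y : smul 0 y = 0.
Proof. by have := smul_linl y (-1) 0 0; rewrite scaler0 addr0 scaleN1r addNr. Qed.
Lemma smul0r x : smul x 0 = 0.
Proof. by have := smul_linr x (-1) 0 0; rewrite scaler0 addr0 scaleN1r addNr. Qed.
Lemma smulZl c x y : smul (c *: x) y = c *: smul x y.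
Proof. by have := smul_linl y c x 0; rewrite smul0l !addr0. Qed.
Lemma smulZr c x y : smul x (c *: y) = c *: smul x y.
Proof. by have := smul_linr x c y 0; rewrite smul0r !addr0. Qed.

Lemma stind (P : AB -> Prop) : P 0 ->
  (forall p q u v, hc p u = u -> hc q v = v -> P (pure u v)) ->
  (forall x y, P x -> P y -> P (x + y)) -> forall x, P x.
Proof.
move=> P0 Pp PD; apply: tind => // u v.
have hh (C : superAlg K) p (c : C) : hc p (hc p c) = hc p c.
  by rewrite hc_hc eqxx.
rewrite -[u]hc_sum -[v]hc_sum.
have puD u1 u2 v1 : pure (u1 + u2) v1 = pure u1 v1 + pure u2 v1 :> AB.
  by have := pure_l v1 1 u1 u2; rewrite !scale1r.
have pvD u1 v1 v2 : pure u1 (v1 + v2) = pure u1 v1 + pure u1 v2 :> AB.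
  by have := pure_r u1 1 v1 v2; rewrite !scale1r.
rewrite puD !pvD; apply: (PD); apply: (PD); apply: Pp; exact: hh.
Qed.

Lemma sign_scale (W : lmodType K) (b : bool) (b' : bool) (x : W) :
  (-1) ^+ b *: ((-1) ^+ b' *: x) = (-1) ^+ (b (+) b') *: x.
Proof. by rewrite scalerA -signr_addb. Qed.

Lemma hmul (C : superAlg K) p q (a b : C) : hc p a = a -> hc q b = b ->
  hc (p (+) q) (a * b) = a * b.
Proof. by move=> ha hb; rewrite -{1}ha -{1}hb hc_mul ha hb. Qed.

Fact smulA : associative smul.
Proof.
move=> x y z.
elim/stind: x => [|p1 q1 a1 b1 hp1 hq1|x x' IH IH'];
  rewrite ?smul0l ?smulDl ?IH ?IH' //.
elim/stind: y => [|p2 q2 a2 b2 hp2 hq2|y y' IH IH'];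
  rewrite ?(smul0l, smul0r, smulDl, smulDr) ?IH ?IH' //.
elim/stind: z => [|p3 q3 a3 b3 hp3 hq3|z z' IH IH'];
  rewrite ?(smul0l, smul0r, smulDl, smulDr) ?IH ?IH' //.
rewrite (smul_homog _ _ hq1 hp2) (smul_homog _ _ hq2 hp3) smulZl smulZr.
rewrite (smul_homog _ _ (hmul hq1 hq2) hp3).
rewrite (smul_homog _ _ hq1 (hmul hp2 hp3)).
by rewrite !sign_scale !mulrA; congr (_ *: _); case: q1 q2 p2 p3 {hp2 hp3 hq1 hq2} => [] [] [] [].
Qed.

Definition sone : AB := pure 1 1.

Fact smul1 : left_id sone smul.
Proof.
elim/stind => [|p q a b hp hq|x y IHx IHy]; rewrite ?(smul0r, smulDr) ?IHx ?IHy //.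
by rewrite (smul_homog _ _ (hc_one B) hp) /= expr0 scale1r !mul1r.
Qed.
Fact smulr1 : right_id sone smul.
Proof.
elim/stind => [|p q a b hp hq|x y IHx IHy]; rewrite ?(smul0l, smulDl) ?IHx ?IHy //.
by rewrite (smul_homog _ _ hq (hc_one A)) /= andbF expr0 scale1r !mulr1.
Qed.

HB.instance Definition _ := GRing.Zmodule_isPzRing.Build AB
  smulA smul1 smulr1 smulDl smulDr.

Lemma stscalerAl (c : K) (x y : AB) : c *: (x * y) = (c *: x) * y.
Proof. by rewrite [RHS]smulZl. Qed.
Lemma stscalerAr (c : K) (x y : AB) : c *: (x * y) = x * (c *: y).
Proof. by rewrite [RHS]smulZr. Qed.

Definition st_in (c : K) : AB := c *: (1 : AB).
Fact st_in_zmod : zmod_morphism st_in.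
Proof. by move=> x y; rewrite /st_in scalerBl. Qed.
Fact st_in_monoid : monoid_morphism st_in.
Proof.
split=> [|x y]; rewrite /st_in ?scale1r //.
by rewrite -stscalerAl -stscalerAr mulr1 scalerA.
Qed.
HB.instance Definition _ := GRing.isZmodMorphism.Build K AB st_in st_in_zmod.
HB.instance Definition _ := GRing.isMonoidMorphism.Build K AB st_in st_in_monoid.
Lemma st_in_central : central st_in.
Proof. by move=> c x; rewrite /st_in -stscalerAl -stscalerAr mulr1 mul1r. Qed.

Definition stpure (a : A) (b : B) : AB := pure a b.

Lemma stpureM q p a b a' b' : hc q b = b -> hc p a' = a' ->
  stpure a b * stpure a' b' = (-1) ^+ (q && p) *: stpure (a * a') (b * b').
Proof. exact: smul_homog. Qed.

End SuperTensor.

Section PurelyEven.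
Variables (K : fieldType) (A : algType K).
Definition hc_even (p : bool) (a : A) : A := if p then 0 else a.
Fact hc_even_linear p : linear (hc_even p).
Proof. by case: p => c x y //=; rewrite scaler0 addr0. Qed.
Fact hc_even_sum a : hc_even false a + hc_even true a = a.
Proof. exact: addr0. Qed.
Fact hc_even_hc p q a :
  hc_even p (hc_even q a) = if p == q then hc_even q a else 0.
Proof. by case: p q => [] []. Qed.
Fact hc_even_mul p q a b :
  hc_even (p (+) q) (hc_even p a * hc_even q b) = hc_even p a * hc_even q b.
Proof. by case: p q => [] [] /=; rewrite ?mul0r ?mulr0. Qed.
Definition purely_even : superAlg K :=
  SuperAlg hc_even_linear hc_even_sum hc_even_hc erefl hc_even_mul.
End PurelyEven.

Section Positions.
Variable n : nat.
Fact pos0_proof (i : 'I_n.-1) : (i < n)%N.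
Proof. exact: leq_trans (ltn_ord i) (leq_pred n). Qed.
Fact pos1_proof (i : 'I_n.-1) : (i.+1 < n)%N.
Proof. by case: n i => [[]|m] //= i; rewrite ltnS. Qed.
Definition pos0 (i : 'I_n.-1) : 'I_n := Ordinal (pos0_proof i).
Definition pos1 (i : 'I_n.-1) : 'I_n := Ordinal (pos1_proof i).
End Positions.

(* Operators on V^{(x)n} are matrices indexed by n-tuples over 'I_d through
   enum_val/enum_rank; the entry W^J_I has row index J and column index I. *)
Notation tmat A d n := 'M[A]_#|{: n.-tuple 'I_d}|.

Definition tmx (A : Type) (d n : nat)
    (f : n.-tuple 'I_d -> n.-tuple 'I_d -> A) : tmat A d n :=
  \matrix_(a, b) f (enum_val a) (enum_val b).

Definition tent (A : Type) (d n : nat) (W : tmat A d n)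
    (J I : n.-tuple 'I_d) : A := W (enum_rank J) (enum_rank I).

(* No sign occurs: only even operators A are raised to tensor powers. *)
Definition tpow (K : fieldType) (d n : nat) (A : 'M[K]_d) : tmat K d n :=
  tmx (fun J I => \prod_(k < n) A (tnth J k) (tnth I k)).

(* R k l i j stands for R^{kl}_{ij}; Rat R i is R acting on the tensor factors
   pos0 i and pos1 i = pos0 i + 1. *)
Definition Rat (K : fieldType) (d : nat)
    (R : 'I_d -> 'I_d -> 'I_d -> 'I_d -> K) (n : nat) (i : 'I_n.-1) :
    tmat K d n :=
  tmx (fun J I =>
    [forall k, (k != pos0 i) && (k != pos1 i) ==> (tnth J k == tnth I k)]%:R *
    R (tnth J (pos0 i)) (tnth J (pos1 i)) (tnth I (pos0 i)) (tnth I (pos1 i))).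

(* par i is the parity of x_i, and hsP i j k l stands for P^{ij}_{kl}, which is
   uniquely determined by R. *)
Record heckeSym (K : fieldType) (q : K) (d : nat) (par : 'I_d -> bool) :=
  HeckeSym {
  hsR :> 'I_d -> 'I_d -> 'I_d -> 'I_d -> K;
  hsP : 'I_d -> 'I_d -> 'I_d -> 'I_d -> K;
  hs_char0 : [pchar K] =i pred0;
  hs_q0 : q != 0;
  hs_q_root : forall m, (0 < m)%N -> q ^+ m != 1;
  hs_even : forall k l i j, par k (+) par l != par i (+) par j -> hsR k l i j = 0;
  hs_braid :
    let R1 := Rat hsR (n := 3) ord0 in let R2 := Rat hsR (n := 3) ord_max in
    R1 *m R2 *m R1 = R2 *m R1 *m R2;
  hs_hecke : let R1 := Rat hsR (n := 2) ord0 in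
    (R1 - q%:M) *m (R1 + 1%:M) = 0;
  hs_closed : forall i j k l, \sum_m \sum_n hsP i m j n * hsR n k m l =
    ((i == l) && (k == j))%:R
}.

Definition qint (K : fieldType) (q : K) (k : int) : K := (q ^ k - 1) / (q - 1).

Definition Cmx (K : fieldType) (q : K) d (par : 'I_d -> bool)
    (R : heckeSym q par) : 'M[K]_d := \matrix_(i, j) \sum_l hsP R i l j l.

Section Algebras.
Variables (K : fieldType) (q : K) (d : nat) (par : 'I_d -> bool).
Variable R : heckeSym q par.

Section Relations.
Variables (G : Type).
Local Notation T := (term K G).
Definition tsum (F : 'I_d -> T) : T := \big[Add/Const 0]_i F i.
Definition tscal (c : K) (t : T) : T := Mul (Const c) t.

Definition RZZ_lhs (z : 'I_d -> 'I_d -> T) i j k l : T :=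
  tsum (fun p => tsum (fun s =>
    tscal ((-1) ^+ (par s && (par i (+) par p)) * R k l p s)
      (Mul (z p i) (z s j)))).
Definition RZZ_rhs (z : 'I_d -> 'I_d -> T) i j k l : T :=
  tsum (fun m => tsum (fun n =>
    tscal ((-1) ^+ (par l && (par m (+) par k)) * R m n i j)
      (Mul (z k m) (z l n)))).
End Relations.

Definition ERgen : Type := ('I_d * 'I_d)%type.
Definition zE_t (i j : 'I_d) : term K ERgen := Gen (i, j).

Inductive ER_rels : term K ERgen -> term K ERgen -> Prop :=
| ER_RZZ i j k l : ER_rels (RZZ_lhs zE_t i j k l) (RZZ_rhs zE_t i j k l).

Inductive HRgen : Type := Zgen of 'I_d & 'I_d | Tgen of 'I_d & 'I_d.
Definition z_t (i j : 'I_d) : term K HRgen := Gen (Zgen i j).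
Definition t_t (i j : 'I_d) : term K HRgen := Gen (Tgen i j).

Inductive HR_rels : term K HRgen -> term K HRgen -> Prop :=
| HR_RZZ i j k l : HR_rels (RZZ_lhs z_t i j k l) (RZZ_rhs z_t i j k l)
| HR_ZT i k : HR_rels
    (tsum (fun j => tscal ((-1) ^+ (par k && (par j (+) par k)))
       (Mul (z_t i j) (t_t j k))))
    (Const (i == k)%:R)
| HR_TZ i k : HR_rels
    (tsum (fun l => tscal ((-1) ^+ (par l && (par l (+) par i)))
       (Mul (t_t i l) (z_t l k))))
    (Const (i == k)%:R).

Lemma eval_RZZ_lhs G (A : pzRingType) (io : {rmorphism K -> A}) (f : G -> A) z i j k l :
  eval io f (RZZ_lhs z i j k l) = \sum_p \sum_s
    io ((-1) ^+ (par s && (par i (+) par p)) * R k l p s) *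
    (eval io f (z p i) * eval io f (z s j)).
Proof. by rewrite eval_sum; apply: eq_bigr => p _; rewrite eval_sum. Qed.
Lemma eval_RZZ_rhs G (A : pzRingType) (io : {rmorphism K -> A}) (f : G -> A) z i j k l :
  eval io f (RZZ_rhs z i j k l) = \sum_m \sum_n
    io ((-1) ^+ (par l && (par m (+) par k)) * R m n i j) *
    (eval io f (z k m) * eval io f (z l n)).
Proof. by rewrite eval_sum; apply: eq_bigr => p _; rewrite eval_sum. Qed.

Definition RZZ_in (A : pzRingType) (io : K -> A) (z : 'I_d -> 'I_d -> A) :=
  forall i j k l,
  \sum_p \sum_s io ((-1) ^+ (par s && (par i (+) par p)) * R k l p s) *
    (z p i * z s j) =
  \sum_m \sum_n io ((-1) ^+ (par l && (par m (+) par k)) * R m n i j) *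
    (z k m * z l n).

Lemma ER_satP (A : pzRingType) (io : {rmorphism K -> A}) f :
  satisfies ER_rels io f <-> RZZ_in io (fun i j => f (i, j)).
Proof.
split=> [s i j k l|s a b [i j k l]].
  by have := s _ _ (ER_RZZ i j k l); rewrite eval_RZZ_lhs eval_RZZ_rhs.
by rewrite eval_RZZ_lhs eval_RZZ_rhs; exact: s.
Qed.

Lemma HR_satP (A : pzRingType) (io : {rmorphism K -> A}) (f : HRgen -> A) :
  let z i j := f (Zgen i j) in let t i j := f (Tgen i j) in
  satisfies HR_rels io f <->
  [/\ RZZ_in io z,
      forall i k, \sum_j io ((-1) ^+ (par k && (par j (+) par k))) *
                    (z i j * t j k) = io (i == k)%:R &
      forall i k, \sum_l io ((-1) ^+ (par l && (par l (+) par i))) *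
                    (t i l * z l k) = io (i == k)%:R].
Proof.
move=> z t; split=> [s|[s1 s2 s3] a b []].
- split=> [i j k l|i k|i k].
  + by have := s _ _ (HR_RZZ i j k l); rewrite eval_RZZ_lhs eval_RZZ_rhs.
  + by have := s _ _ (HR_ZT i k); rewrite eval_sum.
  + by have := s _ _ (HR_TZ i k); rewrite eval_sum.
- by move=> i j k l; rewrite eval_RZZ_lhs eval_RZZ_rhs; exact: s1.
- by move=> i k; rewrite eval_sum; exact: s2.
- by move=> i k; rewrite eval_sum; exact: s3.
Qed.

Definition ER : Type := presented ER_rels.
Definition HR : Type := presented HR_rels.

Lemma sum_delta2 (V : nmodType) (F : 'I_d -> 'I_d -> V) i j :
  (forall p s, (p, s) != (i, j) -> F p s = 0) ->
  \sum_p \sum_s F p s = F i j.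
Proof.
move=> H; rewrite pair_bigA (bigD1 (i, j)) //= big1 ?addr0 //.
by move=> [p s] /H.
Qed.

Lemma counit_RZZ : RZZ_in (idfun : K -> K) (fun i j => (i == j)%:R).
Proof.
move=> i j k l; rewrite (@sum_delta2 _ _ i j); last first.
  move=> p s; rewrite xpair_eqE negb_and => /orP[] /negPf-> ;
  by rewrite ?mul0r !mulr0.
rewrite [RHS](@sum_delta2 _ _ k l); last first.
  move=> p s; rewrite xpair_eqE negb_and ![_ == p]eq_sym ![_ == s]eq_sym.
  by move=> /orP[] /negPf-> ; rewrite ?mul0r !mulr0.
by rewrite !eqxx !addbb !andbF !mulr1.
Qed.

Definition counit_gen (g : HRgen) : K :=
  match g with Zgen i j => (i == j)%:R | Tgen i j => (i == j)%:R end.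

Lemma counit_sat : satisfies HR_rels idfun counit_gen.
Proof.
apply/HR_satP; split=> [|i k|i k] /=; first exact: counit_RZZ.
- rewrite (bigD1 k) //= big1 ?addr0 ?eqxx ?addbb ?andbF ?mul1r ?mulr1 //.
  by move=> j /negPf->; rewrite !mulr0.
- rewrite (bigD1 i) //= big1 ?addr0 ?eqxx ?addbb ?andbF ?mul1r ?mulr1 //.
  by move=> j; rewrite eq_sym => /negPf->; rewrite mul0r mulr0.
Qed.

Lemma counitE_sat : satisfies ER_rels idfun (fun g => (g.1 == g.2)%:R : K).
Proof. by apply/ER_satP; exact: counit_RZZ. Qed.

Lemma central_id : central (idfun : K -> K).
Proof. by move=> c x; rewrite mulrC. Qed.

HB.instance Definition _ := GRing.PzRing.on ER.
HB.instance Definition _ := GRing.Lmodule.on ER.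
Fact ER_nonzero : (1 : ER) != 0.
Proof.
apply/eqP => /(congr1 (plift idfun (fun g => (g.1 == g.2)%:R : K))).
rewrite (plift1 central_id counitE_sat) (plift0 central_id counitE_sat).
by apply/eqP; rewrite oner_eq0.
Qed.
HB.instance Definition _ := GRing.PzSemiRing_isNonZero.Build ER ER_nonzero.
HB.instance Definition _ := GRing.LSemiModule_isLSemiAlgebra.Build K ER
  (@pscalerAl K _ ER_rels).
HB.instance Definition _ := GRing.LSemiAlgebra_isSemiAlgebra.Build K ER
  (@pscalerAr K _ ER_rels).

HB.instance Definition _ := GRing.PzRing.on HR.
HB.instance Definition _ := GRing.Lmodule.on HR.
Fact HR_nonzero : (1 : HR) != 0.
Proof.
apply/eqP => /(congr1 (plift idfun counit_gen)).
rewrite (plift1 central_id counit_sat) (plift0 central_id counit_sat).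
by apply/eqP; rewrite oner_eq0.
Qed.
HB.instance Definition _ := GRing.PzSemiRing_isNonZero.Build HR HR_nonzero.
HB.instance Definition _ := GRing.LSemiModule_isLSemiAlgebra.Build K HR
  (@pscalerAl K _ HR_rels).
HB.instance Definition _ := GRing.LSemiAlgebra_isSemiAlgebra.Build K HR
  (@pscalerAr K _ HR_rels).

Definition zER (i j : 'I_d) : ER := pgen ER_rels (i, j).
Definition zH (i j : 'I_d) : HR := pgen HR_rels (Zgen i j).
Definition tH (i j : 'I_d) : HR := pgen HR_rels (Tgen i j).
Local Notation z := zH.
Local Notation t := tH.

Lemma central_in_alg (A : algType K) : central (in_alg A).
Proof. by move=> c x; rewrite /= -scalerAl -scalerAr mul1r mulr1. Qed.

Lemma HR_relations :
  [/\ RZZ_in (in_alg HR) z,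
      forall i k, \sum_j ((-1) ^+ (par k && (par j (+) par k)) : K) *:
                    (z i j * t j k) = (i == k)%:R *: 1 &
      forall i k, \sum_l ((-1) ^+ (par l && (par l (+) par i)) : K) *:
                    (t i l * z l k) = (i == k)%:R *: 1].
Proof.
have /HR_satP[? H2 H3] : satisfies HR_rels (in_alg HR) (pgen HR_rels).
  exact: pgen_sat.
split=> // i k; [have /= <- := H2 i k|have /= <- := H3 i k];
  by apply: eq_bigr => j _; rewrite -scalerAl mul1r.
Qed.

Definition counit : HR -> K := plift idfun counit_gen.

(* The parity automorphism z^i_j |-> (-1)^{i+j} z^i_j, whose eigenspaces give the
   grading of H_R (characteristic 0). *)
Definition parity_gen (g : HRgen) : HR :=
  match g with
  | Zgen i j => ((-1) ^+ (par i (+) par j) : K) *: z i j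
  | Tgen i j => ((-1) ^+ (par i (+) par j) : K) *: t i j
  end.

Lemma RZZ_algE (A : algType K) (zz : 'I_d -> 'I_d -> A) :
  RZZ_in (in_alg A) zz <-> (forall i j k l,
  \sum_p \sum_s ((-1) ^+ (par s && (par i (+) par p)) * R k l p s) *:
    (zz p i * zz s j) =
  \sum_m \sum_n ((-1) ^+ (par l && (par m (+) par k)) * R m n i j) *:
    (zz k m * zz l n)).
Proof.
have e (c : K) (x : A) : in_alg A c * x = c *: x by exact: mulr_algl.
have e2 (F : 'I_d -> 'I_d -> K) (G : 'I_d -> 'I_d -> A) :
    \sum_p \sum_s in_alg A (F p s) * G p s = \sum_p \sum_s F p s *: G p s.
  by apply: eq_bigr => p _; apply: eq_bigr => s _; rewrite e.
by split=> H i j k l; have := H i j k l; rewrite !e2.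
Qed.

Lemma parity_sat : satisfies HR_rels (in_alg HR) parity_gen.
Proof.
have [/RZZ_algE h1 h2 h3] := HR_relations.
apply/HR_satP; split=> [|i k|i k] /=.
- apply/RZZ_algE => i j k l.
  have e (c : K) (b b' b'' : bool) (u v : HR) :
    (c != 0 -> b (+) b' = b'') ->
    c *: (((-1) ^+ b : K) *: u * (((-1) ^+ b' : K) *: v)) = (-1) ^+ b'' *: (c *: (u * v)).
    move=> H; have [->|/H <-] := eqVneq c 0; first by rewrite !scale0r scaler0.
    rewrite -scalerAl -scalerAr !scalerA; congr (_ *: _).
    by rewrite signr_addb [_ * c]mulrC !mulrA.
  pose b := par k (+) par l (+) par i (+) par j.
  rewrite (eq_bigr (fun p => ((-1) ^+ b : K) *: \sum_s ((-1) ^+ (par s && (par i (+) par p)) * R k l p s) *: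
    (z p i * z s j))); last first.
    move=> p _; rewrite scaler_sumr; apply: eq_bigr => s _.
    apply: e => H.
    have : par k (+) par l == par p (+) par s.
      by apply: contraNT H => /hs_even->; rewrite mulr0.
    rewrite /b => /eqP ->.
    by case: (par p) (par s) (par i) (par j) => [] [] [] [].
  rewrite -scaler_sumr h1 scaler_sumr; apply: eq_bigr => m _.
  rewrite scaler_sumr; apply: eq_bigr => n _.
  apply/esym; apply: e => H.
  have : par m (+) par n == par i (+) par j.
    by apply: contraNT H => /hs_even->; rewrite mulr0.
  move/eqP; rewrite /b.
  by case: (par m) (par n) (par i) (par j) (par k) (par l) => [] [] [] [] [] [].
- rewrite -h2; have [<-|ik] := eqVneq i k.
    apply: eq_bigr => j _; rewrite -!scalerAl -!scalerAr mul1r !scalerA.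
    congr (_ *: _); rewrite -!signr_addb; congr (_ ^+ _).
    by case: (par i) (par j) => [] [].
  have e j : (-1) ^+ (par k && (par j (+) par k)) *: 1 *
   (((-1) ^+ (par i (+) par j) : K) *: z i j * (((-1) ^+ (par j (+) par k) : K) *: t j k)) =
   (-1) ^+ (par i (+) par k) *: ((-1) ^+ (par k && (par j (+) par k)) *: (z i j * t j k)).
    rewrite -!scalerAl -!scalerAr mul1r !scalerA.
    congr (_ *: _); rewrite -!signr_addb; congr (_ ^+ _).
    by case: (par i) (par j) (par k) => [] [] [].
  under eq_bigr => j _ do rewrite e.
  by rewrite -scaler_sumr h2 (negPf ik) scale0r scaler0.
- rewrite -h3; have [<-|ik] := eqVneq i k.
    apply: eq_bigr => j _; rewrite -!scalerAl -!scalerAr mul1r !scalerA.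
    congr (_ *: _); rewrite -!signr_addb; congr (_ ^+ _).
    by case: (par i) (par j) => [] [].
  have e j : (-1) ^+ (par j && (par j (+) par i)) *: 1 *
   (((-1) ^+ (par i (+) par j) : K) *: t i j * (((-1) ^+ (par j (+) par k) : K) *: z j k)) =
   (-1) ^+ (par i (+) par k) *: ((-1) ^+ (par j && (par j (+) par i)) *: (t i j * z j k)).
    rewrite -!scalerAl -!scalerAr mul1r !scalerA.
    congr (_ *: _); rewrite -!signr_addb; congr (_ ^+ _).
    by case: (par i) (par j) (par k) => [] [] [].
  under eq_bigr => j _ do rewrite e.
  by rewrite -scaler_sumr h3 (negPf ik) scale0r scaler0.
Qed.

Definition parity : HR -> HR := plift (in_alg HR) parity_gen.

Lemma parD : {morph parity : x y / x + y}.
Proof. exact: pliftD (@central_in_alg _) parity_sat. Qed.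
Lemma parM : {morph parity : x y / x * y}.
Proof. exact: pliftM (@central_in_alg _) parity_sat. Qed.
Lemma par1 : parity 1 = 1.
Proof. exact: plift1 (@central_in_alg _) parity_sat. Qed.
Lemma parity_z i j : parity (z i j) = (-1) ^+ (par i (+) par j) *: z i j.
Proof. exact: (plift_gen (@central_in_alg _) parity_sat). Qed.
Lemma parity_t i j : parity (t i j) = (-1) ^+ (par i (+) par j) *: t i j.
Proof. exact: (plift_gen (@central_in_alg _) parity_sat). Qed.

Lemma parityZ c x : parity (c *: x) = c *: parity x.
Proof.
by rewrite /parity (pliftZ (@central_in_alg _) parity_sat) mulr_algl.
Qed.
Lemma parityK : involutive parity.
Proof.
move=> x; elim/pind: x => [c|g|x y IHx IHy|x y IHx IHy].
- by rewrite !parityZ !par1.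
- case: g => i j.
    change (parity (parity (z i j)) = z i j).
    by rewrite parity_z parityZ parity_z scalerA -signr_addb addbb scale1r.
  change (parity (parity (t i j)) = t i j).
  by rewrite parity_t parityZ parity_t scalerA -signr_addb addbb scale1r.
- by rewrite !parD IHx IHy.
- by rewrite !parM IHx IHy.
Qed.

Definition HRhc (p : bool) (x : HR) : HR :=
  (2%:R^-1 : K) *: (x + ((-1) ^+ p : K) *: parity x).

Lemma two_neq0 : (2%:R : K) != 0.
Proof. by apply/negP => h; have := hs_char0 R 2; rewrite !inE /= h. Qed.

Lemma HRhc_linear p : linear (HRhc p).
Proof.
move=> c x y; rewrite /HRhc parD parityZ (scalerDr ((-1) ^+ p)) addrACA.
have -> : c *: x + (-1) ^+ p *: (c *: parity x) =
          c *: (x + (-1) ^+ p *: parity x).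
  by rewrite scalerDr !scalerA mulrC.
by rewrite scalerDr !scalerA mulrC.
Qed.
Lemma HRhc_sum x : HRhc false x + HRhc true x = x.
Proof.
rewrite /HRhc -scalerDr expr0 expr1 scale1r scaleN1r addrACA subrr addr0.
by rewrite -mulr2n -scaler_nat scalerA mulVf ?two_neq0 // scale1r.
Qed.
Lemma parity_hc (p : bool) x : parity (HRhc p x) = (-1) ^+ p *: HRhc p x.
Proof.
rewrite /HRhc parityZ parD parityZ parityK !scalerA mulrC -scalerA.
congr (_ *: _); rewrite scalerDr scalerA -signr_addb addbb scale1r.
by rewrite addrC.
Qed.
Lemma hc_of_parity (p : bool) x : parity x = (-1) ^+ p *: x -> HRhc p x = x.
Proof.
move=> e; rewrite /HRhc e scalerA -signr_addb addbb scale1r.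
by rewrite -mulr2n -scaler_nat scalerA mulVf ?two_neq0 // scale1r.
Qed.
Lemma HRhc_hc p q' x : HRhc p (HRhc q' x) = if p == q' then HRhc q' x else 0.
Proof.
have [->|npq] := eqVneq p q'; first by apply: hc_of_parity; rewrite parity_hc.
rewrite {1}/HRhc parity_hc scalerA -signr_addb.
have -> : p (+) q' = true by case: p q' npq => [] [].
by rewrite expr1 scaleN1r subrr scaler0.
Qed.
Lemma HRhc_one : HRhc false 1 = 1.
Proof. by apply: hc_of_parity; rewrite expr0 scale1r par1. Qed.
Lemma HRhc_mul p q' x y :
  HRhc (p (+) q') (HRhc p x * HRhc q' y) = HRhc p x * HRhc q' y.
Proof.
apply: hc_of_parity; rewrite parM !parity_hc -scalerAl -scalerAr scalerA.
by rewrite signr_addb.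
Qed.

Definition HRs : superAlg K :=
  SuperAlg HRhc_linear HRhc_sum HRhc_hc HRhc_one HRhc_mul.

Lemma hc_z i j : hc (s := HRs) (par i (+) par j) (z i j) = z i j.
Proof.
exact/hc_of_parity/parity_z.
Qed.
Lemma hc_t i j : hc (s := HRs) (par i (+) par j) (t i j) = t i j.
Proof.
exact/hc_of_parity/parity_t.
Qed.

End Algebras.

Section PureSums.
Variables (K : fieldType) (A B : superAlg K).
Lemma stpureZl c (a : A) (b : B) : stpure (c *: a) b = c *: stpure a b.
Proof.
have h := @pure_l _ A B b; have := h c a 0; rewrite addr0 /stpure => ->.
by have := h (-1) 0 0; rewrite scaler0 addr0 scaleN1r addNr => ->; rewrite addr0.
Qed.
Lemma stpureZr c (a : A) (b : B) : stpure a (c *: b) = c *: stpure a b.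
Proof.
have h := @pure_r _ A B a; have := h c b 0; rewrite addr0 /stpure => ->.
by have := h (-1) 0 0; rewrite scaler0 addr0 scaleN1r addNr => ->; rewrite addr0.
Qed.
Lemma stpure_suml I (r : seq I) (F : I -> A) (b : B) :
  stpure (\sum_(i <- r) F i) b = \sum_(i <- r) stpure (F i) b.
Proof.
have h := @pure_l _ A B b.
apply: (big_morph (fun a => stpure a b)) => [x y|].
  by have := h 1 x y; rewrite !scale1r.
by have := stpureZl 0 0 b; rewrite !scale0r.
Qed.
Lemma stpure_sumr I (r : seq I) (F : I -> B) (a : A) :
  stpure a (\sum_(i <- r) F i) = \sum_(i <- r) stpure a (F i).
Proof.
have h := @pure_r _ A B a.
apply: (big_morph (fun b => stpure a b)) => [x y|].
  by have := h 1 x y; rewrite !scale1r.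
by have := stpureZr 0 a 0; rewrite !scale0r.
Qed.
Lemma st_inE c (x : stensor A B) : st_in A B c * x = c *: x.
Proof. by rewrite /st_in -stscalerAl mul1r. Qed.
End PureSums.

Section Hopf.
Variables (K : fieldType) (q : K) (d : nat) (par : 'I_d -> bool).
Variable R : heckeSym q par.
Local Notation H := (HRs R).
Local Notation z := (zH R).
Local Notation t := (tH R).
Local Notation HH := (stensor H H).

Definition Delta_gen (g : HRgen d) : HH :=
  match g with
  | Zgen i j => \sum_k stpure (z i k : H) (z k j : H)
  | Tgen i j => \sum_k stpure (t k j : H) (t i k : H)
  end.

(* Delta_gen respects the relations of H_R: see Delta_sat. *)
Definition Delta : H -> HH := plift (st_in H H) Delta_gen.

Lemma sgn_merge (W : lmodType K) (b1 b2 b3 b4 : bool) (r : K) (w : W) :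
  b1 (+) b2 = b3 (+) b4 ->
  ((-1) ^+ b1 * r) *: ((-1) ^+ b2 *: w) = ((-1) ^+ b3 * r) *: ((-1) ^+ b4 *: w).
Proof.
move=> e; rewrite !scalerA ![_ * r]mulrC -!mulrA -!signr_addb e.
done.
Qed.

Lemma Delta_mulZZ p i s j :
  Delta_gen (Zgen p i) * Delta_gen (Zgen s j) = \sum_a \sum_b
   ((-1) ^+ ((par a (+) par i) && (par s (+) par b)) : K) *:
     stpure (z p a * z s b : H) (z a i * z b j : H).
Proof.
rewrite /= mulr_suml; apply: eq_bigr => a _; rewrite mulr_sumr.
by apply: eq_bigr => b _; apply: stpureM; exact: hc_z.
Qed.

Lemma Delta_mulZT i j k :
  Delta_gen (Zgen i j) * Delta_gen (Tgen j k) = \sum_a \sum_m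
   ((-1) ^+ ((par a (+) par j) && (par m (+) par k)) : K) *:
     stpure (z i a * t m k : H) (z a j * t j m : H).
Proof.
rewrite /= mulr_suml; apply: eq_bigr => a _; rewrite mulr_sumr.
by apply: eq_bigr => m _; apply: stpureM; [exact: hc_z|exact: hc_t].
Qed.

Lemma Delta_mulTZ i l k :
  Delta_gen (Tgen i l) * Delta_gen (Zgen l k) = \sum_m \sum_n
   ((-1) ^+ ((par i (+) par m) && (par l (+) par n)) : K) *:
     stpure (t m l * z l n : H) (t i m * z n k : H).
Proof.
rewrite /= mulr_suml; apply: eq_bigr => m _; rewrite mulr_sumr.
by apply: eq_bigr => n _; apply: stpureM; [exact: hc_t|exact: hc_z].
Qed.

Lemma exch3 (V : nmodType) (F : 'I_d -> 'I_d -> 'I_d -> V) :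
  \sum_p \sum_a \sum_b F p a b = \sum_a \sum_b \sum_p F p a b.
Proof.
by rewrite exchange_big; apply: eq_bigr => a _; rewrite exchange_big.
Qed.

Lemma exch4 (V : nmodType) (F : 'I_d -> 'I_d -> 'I_d -> 'I_d -> V) :
  \sum_p \sum_s \sum_a \sum_b F p s a b = \sum_a \sum_b \sum_p \sum_s F p s a b.
Proof.
under eq_bigr => p _ do rewrite exchange_big.
rewrite exchange_big; apply: eq_bigr => a _.
under eq_bigr => p _ do rewrite exchange_big.
by rewrite exchange_big.
Qed.

Lemma Delta_sat : satisfies (HR_rels R) (st_in H H) Delta_gen.
Proof.
have [/RZZ_algE h1 h2 h3] := HR_relations R.
apply/HR_satP; split=> [i j k l|i k|i k].
- pose F a b i' j' k' l' : H :=
    ((-1) ^+ (par b && (par i' (+) par a)) * R k' l' a b) *: (z a i' * z b j').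
  pose E m n i' j' k' l' : H :=
    ((-1) ^+ (par l' && (par m (+) par k')) * R m n i' j') *: (z k' m * z l' n).
  have h1' a b k' l' : \sum_p \sum_s F p s a b k' l' = \sum_m \sum_n E m n a b k' l'.
    exact: h1.
  transitivity (\sum_a \sum_b ((-1) ^+ (par b && (par i (+) par a)) : K) *:
     stpure (\sum_p \sum_s F p s a b k l) (z a i * z b j : H)).
    under eq_bigr => p _ do under eq_bigr => s _ do
      rewrite st_inE Delta_mulZZ scaler_sumr.
    under eq_bigr => p _ do under eq_bigr => s _ do under eq_bigr => a _ do
      rewrite scaler_sumr.
    rewrite exch4; apply: eq_bigr => a _; apply: eq_bigr => b _.
    rewrite stpure_suml scaler_sumr; apply: eq_bigr => p _.
    rewrite stpure_suml scaler_sumr; apply: eq_bigr => s _.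
    rewrite /F stpureZl !scalerA; congr (_ *: _).
    rewrite mulrAC mulrA -!signr_addb; congr ((_ ^+ _) * _).
    by case: (par s) (par i) (par p) (par a) (par b) => [] [] [] [] [].
  transitivity (\sum_m \sum_n ((-1) ^+ (par l && (par m (+) par k)) : K) *:
     stpure (z k m * z l n : H) (\sum_a \sum_b F a b i j m n)).
    under eq_bigr => a _ do under eq_bigr => b _ do
      rewrite h1' stpure_suml scaler_sumr.
    under eq_bigr => a _ do under eq_bigr => b _ do under eq_bigr => m _ do
      rewrite stpure_suml scaler_sumr.
    rewrite exch4; apply: eq_bigr => m _; apply: eq_bigr => n _.
    rewrite stpure_sumr scaler_sumr; apply: eq_bigr => a _.
    rewrite stpure_sumr scaler_sumr; apply: eq_bigr => b _.
    rewrite /F /E stpureZl stpureZr !scalerA; congr (_ *: _).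
    by rewrite mulrCA.
  under eq_bigr => m _ do under eq_bigr => n _ do
      rewrite h1' stpure_sumr scaler_sumr.
  under eq_bigr => m _ do under eq_bigr => n _ do under eq_bigr => m' _ do
      rewrite stpure_sumr scaler_sumr.
  rewrite exch4; apply: eq_bigr => m' _; apply: eq_bigr => n' _.
  rewrite st_inE Delta_mulZZ scaler_sumr; apply: eq_bigr => m _.
  rewrite scaler_sumr; apply: eq_bigr => n _.
  rewrite /E stpureZr !scalerA; congr (_ *: _).
  rewrite mulrAC mulrA -!signr_addb; congr ((_ ^+ _) * _).
  by case: (par l) (par n) (par m) (par m') (par k) => [] [] [] [] [].
- transitivity (\sum_a \sum_m ((-1) ^+ (par k (+) (par a && par m)
      (+) (par a && par k) (+) par m) : K) *: stpure (z i a * t m k : H)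
     (\sum_j ((-1) ^+ (par m && (par j (+) par m)) : K) *: (z a j * t j m) : H)).
    under eq_bigr => j _ do rewrite st_inE Delta_mulZT scaler_sumr.
    under eq_bigr => j _ do under eq_bigr => a _ do rewrite scaler_sumr.
    rewrite exch3; apply: eq_bigr => a _; apply: eq_bigr => m _.
    rewrite stpure_sumr scaler_sumr; apply: eq_bigr => j _.
    rewrite stpureZr !scalerA -!signr_addb; congr ((_ ^+ _) *: _).
    by case: (par k) (par j) (par m) (par a) => [] [] [] [].
  transitivity (stpure (\sum_a ((-1) ^+ (par k && (par a (+) par k)) : K) *:
     (z i a * t a k) : H) (1 : H)); last by rewrite h2 stpureZl.
  rewrite stpure_suml; apply: eq_bigr => a _.
  rewrite (bigD1 a) //= [X in _ + X]big1 ?addr0 => [|m na].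
    rewrite h2 eqxx scale1r stpureZl; congr ((_ ^+ _) *: _).
    by case: (par k) (par a) => [] [].
  by rewrite h2 eq_sym (negPf na) stpureZr scale0r scaler0.
- transitivity (\sum_m \sum_n ((-1) ^+ (par n && (par i (+) par m)) : K) *:
     stpure (\sum_l ((-1) ^+ (par l && (par l (+) par m)) : K) *:
       (t m l * z l n) : H) (t i m * z n k : H)).
    under eq_bigr => j _ do rewrite st_inE Delta_mulTZ scaler_sumr.
    under eq_bigr => j _ do under eq_bigr => a _ do rewrite scaler_sumr.
    rewrite exch3; apply: eq_bigr => m _; apply: eq_bigr => n _.
    rewrite stpure_suml scaler_sumr; apply: eq_bigr => l _.
    rewrite stpureZl !scalerA -!signr_addb; congr ((_ ^+ _) *: _).
    by case: (par i) (par l) (par m) (par n) => [] [] [] [].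
  transitivity (stpure (1 : H) (\sum_m ((-1) ^+ (par m && (par m (+) par i)) : K)
     *: (t i m * z m k) : H)); last by rewrite h3 stpureZr.
  rewrite stpure_sumr; apply: eq_bigr => m _.
  rewrite (bigD1 m) //= [X in _ + X]big1 ?addr0 => [|n nm].
    rewrite h3 eqxx scale1r stpureZr; congr ((_ ^+ _) *: _).
    by case: (par i) (par m) => [] [].
  by rewrite h3 eq_sym (negPf nm) stpureZl scale0r scaler0.
Qed.

End Hopf.

Section HopfNotions.
Variables (K : fieldType) (q : K) (d : nat) (par : 'I_d -> bool).
Variable R : heckeSym q par.
Local Notation H := (HRs R).
Local Notation z := (zH R).
Local Notation t := (tH R).
Local Notation Delta := (@Delta K q d par R).
Local Notation counit := (@counit K q d par R).

Definition is_antipode (S : H -> H) : Prop :=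
  (forall a, tlift (fun a1 a2 => S a1 * a2) (Delta a) = counit a *: 1) /\
  (forall a, tlift (fun a1 a2 => a1 * S a2) (Delta a) = counit a *: 1).

(* The convolution product on the dual of H_R (x) H_R:
   (-1)^{|a2||b1|} r(a1,b1) r'(a2,b2). *)
Definition convol (r r' : H -> H -> K) (a b : H) : K^o :=
  tlift (fun a1 a2 => tlift (fun b1 b2 =>
    koszul (fun a2 b1 => r a1 b1 * r' a2 b2 : K^o) a2 b1) (Delta b)) (Delta a).

(* All conditions are the usual ones with the super sign rule: every exchange of
   two factors is accounted for by koszul (in cq_mulr the signs cancel since r is
   even). cq_braiding says that the braiding
     v (x) w |-> (-1)^{|w0||v|} w0 (x) v0 r(v1, w1)
   of right comodules is R on V (x) V, where x_i |-> x_j (x) z^j_i; it determines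
   r among the coquasitriangular structures. *)
Record coquasitriangular (r : H -> H -> K) : Prop := {
  cq_bilinear : bilinear_map (r : H -> H -> K^o);
  cq_even : forall p p' a b, p != p' -> r (hc p a) (hc p' b) = 0;
  cq_inv : exists r' : H -> H -> K,
    [/\ bilinear_map (r' : H -> H -> K^o),
        forall a b, convol r r' a b = counit a * counit b &
        forall a b, convol r' r a b = counit a * counit b];
  cq_comm : forall a b,
    tlift (fun a1 a2 => tlift (fun b1 b2 =>
      koszul (fun a2 b1 => r a1 b1 *: (a2 * b2)) a2 b1) (Delta b)) (Delta a) =
    tlift (fun a1 a2 => tlift (fun b1 b2 =>
      koszul (fun a2 b1 => koszul (fun a1 b1 => r a2 b2 *: (b1 * a1)) a1 b1)
        a2 b1) (Delta b)) (Delta a);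
  cq_mull : forall a b c, r (a * b) c =
    tlift (fun c1 c2 =>
      koszul (fun b c1 => r a c1 * r b c2 : K^o) b c1) (Delta c);
  cq_mulr : forall a b c, r a (b * c) =
    tlift (fun a1 a2 => r a1 c * r a2 b : K^o) (Delta a);
  cq_braiding : forall i j k l,
    R k l i j = (-1) ^+ (par k && par i) * r (z l i) (z k j)
}.

Definition Dmx (S : H -> H) (r : H -> H -> K) : 'M[K]_d :=
  \matrix_(i, j) \sum_l r (z i l) (S (z l j)).

Definition is_integral (int : H -> K) : Prop :=
  [/\ exists a, int a != 0,
      forall a, int (hc true a) = 0 &
      forall a, tlift (fun a1 a2 => int a2 *: a1) (Delta a) = int a *: 1].

(* The subalgebra of H_R generated by the t^i_j. *)
Definition in_ERp : {pred HR R} := fun x =>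
  `[< forall P : {pred HR R}, GRing.subalg_closed P ->
        (forall i j, t i j \in P) -> x \in P >].

Lemma in_ERpP x : reflect (forall P : {pred HR R}, GRing.subalg_closed P ->
        (forall i j, t i j \in P) -> x \in P) (x \in in_ERp).
Proof. exact: asboolP. Qed.

Lemma in_ERp_closed : GRing.subalg_closed in_ERp.
Proof.
split=> [|c x y /in_ERpP hx /in_ERpP hy|x y /in_ERpP hx /in_ERpP hy];
  apply/in_ERpP => P cP tP; have [P1 PZ PM] := cP => //.
- by apply: PZ; [apply: hx|apply: hy].
- by apply: PM; [apply: hx|apply: hy].
Qed.

Fact in_ERp_semi : GRing.subsemialg_closed in_ERp.
Proof. exact: GRing.subalg_closed_semi in_ERp_closed. Qed.

Record ERp : Type := MkERp { ERp_val : HR R; _ : ERp_val \in in_ERp }.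
HB.instance Definition _ := [isSub for ERp_val].
HB.instance Definition _ := [Choice of ERp by <:].
HB.instance Definition _ :=
  GRing.SubChoice_isSubAlgebra.Build K (HR R) in_ERp ERp in_ERp_semi.

Fact t_in_ERp i j : t i j \in in_ERp.
Proof. by apply/in_ERpP => P _; apply. Qed.
Definition tERp (i j : 'I_d) : ERp := MkERp (t_in_ERp i j).

End HopfNotions.

Section Monomials.
Variables (K : fieldType) (d : nat) (par : 'I_d -> bool) (n : nat).
Implicit Types I J : n.-tuple 'I_d.

Definition deg I : nat := (\sum_(k < n) par (tnth I k))%N.

(* sgnZ and sgnT are exponents of signs. sgnZ solves the recursion
     sign(Ii, Jj) = (-1)^{i(|I|+|J|)} sign(I, J),
   and sgnT is such that S(Z^I_J) = (-1)^{|J|(|I|+|J|)} T^{I'}_{J'}: see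
   antipode_Zmon. *)
Definition sgnZ I J : nat :=
  (\sum_(b < n) \sum_(a < n | a < b)
     par (tnth I b) * (par (tnth I a) + par (tnth J a)))%N.
Definition sgnT I J : nat :=
  (\sum_(b < n) \sum_(a < n | a < b)
     par (tnth J a) * (par (tnth I b) + par (tnth J b)))%N.

Definition Zmon (A : algType K) (z : 'I_d -> 'I_d -> A) I J : A :=
  ((-1) ^+ sgnZ I J : K) *: \prod_(k < n) z (tnth I k) (tnth J k).

(* Tmon t I J is T^{I'}_{J'}; the product is t^{i_n}_{j_n} ... t^{i_1}_{j_1}. *)
Definition Tmon (A : algType K) (t : 'I_d -> 'I_d -> A) I J : A :=
  ((-1) ^+ sgnT I J : K) *:
    \prod_(k < n) t (tnth I (rev_ord k)) (tnth J (rev_ord k)).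

Definition Zmx (A : algType K) (z : 'I_d -> 'I_d -> A) : tmat A d n :=
  tmx (Zmon z).
Definition Tbar (A : algType K) (t : 'I_d -> 'I_d -> A) : tmat A d n :=
  tmx (Tmon t).

(* Product of matrices whose right factor is a barred one. The entries T^{I'}_{J'}
   are coefficients of the dual comodule, and the super sign rule gives their
   product with Z the sign it has in the relation
     (-1)^{k(j+k)} z^i_j t^j_k = delta^i_k  of H_R,
   so that the right factor acts as S(Z^{(x)n}), the inverse of Z^{(x)n}: see
   mulbar_antipode. *)
Definition mulbar (A : pzRingType) (X Y : tmat A d n) : tmat A d n :=
  tmx (fun I L => \sum_J (-1) ^+ (deg L * (deg J + deg L))%N *
                    (tent X I J * tent Y J L)).
End Monomials.

Lemma lt_pred m n : (m.+1 < n)%N -> (m < n.-1)%N.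
Proof. by case: n. Qed.

Section HeckeAlgebra.
Variables (K : fieldType) (q : K) (n : nat).

(* The generator T_{i+1} of H_n is indexed by i : 'I_n.-1 and corresponds to the
   transposition of the positions pos0 i and pos1 i. *)
Inductive hecke_rels : term K 'I_n.-1 -> term K 'I_n.-1 -> Prop :=
| Hbraid (i j : 'I_n.-1) : j = i.+1 :> nat ->
    hecke_rels (Mul (Mul (Gen i) (Gen j)) (Gen i))
               (Mul (Mul (Gen j) (Gen i)) (Gen j))
| Hcomm (i j : 'I_n.-1) : (i.+1 < j)%N ->
    hecke_rels (Mul (Gen i) (Gen j)) (Mul (Gen j) (Gen i))
| Hquad (i : 'I_n.-1) :
    hecke_rels (Mul (Gen i) (Gen i))
               (Add (Mul (Const (q - 1)) (Gen i)) (Const q)).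

Definition hecke : Type := presented hecke_rels.
HB.instance Definition _ := GRing.PzRing.on hecke.
HB.instance Definition _ := GRing.Lmodule.on hecke.

Lemma hecke_index_sat : satisfies hecke_rels (idfun : K -> K) (fun=> q).
Proof. by move=> a b [] //= i; rewrite mulrBl mul1r subrK. Qed.
Fact hecke_nonzero : (1 : hecke) != 0.
Proof.
apply/eqP => /(congr1 (plift idfun (fun=> q))).
rewrite (plift1 (@central_id K) hecke_index_sat).
rewrite (plift0 (@central_id K) hecke_index_sat).
by apply/eqP; rewrite oner_eq0.
Qed.
HB.instance Definition _ := GRing.PzSemiRing_isNonZero.Build hecke hecke_nonzero.
HB.instance Definition _ := GRing.LSemiModule_isLSemiAlgebra.Build K hecke
  (@pscalerAl K _ hecke_rels).
HB.instance Definition _ := GRing.LSemiAlgebra_isSemiAlgebra.Build K hecke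
  (@pscalerAr K _ hecke_rels).

Definition Tgn (i : 'I_n.-1) : hecke := pgen hecke_rels i.

Definition word_perm (s : seq 'I_n.-1) : 'S_n :=
  (\prod_(i <- s) tperm (pos0 i) (pos1 i))%g.
Definition has_word (w : 'S_n) (m : nat) : bool :=
  [exists s : m.-tuple 'I_n.-1, word_perm s == w].

Lemma word_permP (w : 'S_n) : exists s, word_perm s = w.
Proof.
have wM s s' : (word_perm s * word_perm s')%g = word_perm (s ++ s').
  by rewrite /word_perm big_cat.
have wa (i : 'I_n.-1) : tperm (pos0 i) (pos1 i) = word_perm [:: i].
  by rewrite /word_perm big_seq1.
have wlt m (x y : 'I_n) : y = (x + m).+1 :> nat -> exists s, word_perm s = tperm x y.
  elim: m x y => [|m IH] x y e.
    have hx : (x < n.-1)%N by apply: lt_pred; move: (ltn_ord y); rewrite e addn0.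
    exists [:: Ordinal hx]; rewrite -wa; congr (tperm _ _); apply: val_inj => //=.
    by rewrite e addn0.
  have hi : (x + m.+1 < n.-1)%N by apply: lt_pred; move: (ltn_ord y); rewrite e.
  pose i := Ordinal hi.
  have ey : y = pos1 i by apply: val_inj; rewrite /= e.
  have [|s es] := IH x (pos0 i); first by rewrite /= addnS.
  exists ([:: i] ++ s ++ [:: i]); rewrite -!wM -wa es.
  rewrite -{1}[tperm (pos0 i) _]tpermV -/(conjg _ _) tpermJ ey tpermL.
  rewrite tpermD //; apply/eqP => /(congr1 val) /= /eqP.
    by rewrite -{2}[val x]addn0 eqn_add2l.
  by rewrite -{2}[val x]addn0 -addnS eqn_add2l.
have wt (x y : 'I_n) : exists s, word_perm s = tperm x y.
  case: (ltngtP x y) => [lt|lt|/val_inj->].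
  - by apply: (wlt (y - x).-1); rewrite -addnS prednK ?subn_gt0 // subnKC // ltnW.
  - rewrite tpermC; apply: (wlt (x - y).-1).
    by rewrite -addnS prednK ?subn_gt0 // subnKC // ltnW.
  - by exists [::]; rewrite tperm1 /word_perm big_nil.
have [ts -> _] := prod_tpermP w; elim: ts => [|p ts [s es]].
  by exists [::]; rewrite /word_perm !big_nil.
by have [s' es'] := wt p.1 p.2; exists (s' ++ s); rewrite -wM es es' big_cons.
Qed.

Lemma has_word_ex w : exists m, has_word w m.
Proof.
by have [s <-] := word_permP w; exists (size s); apply/existsP; exists (in_tuple s).
Qed.

(* The smallest number of simple transpositions with product w; Tw w is taken
   along a chosen word of that length. *)
Definition plength (w : 'S_n) : nat := ex_minn (has_word_ex w).

Lemma redword_ex w : exists s : (plength w).-tuple 'I_n.-1, word_perm s == w.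
Proof. by apply/existsP; rewrite /plength; case: ex_minnP. Qed.

Definition redword (w : 'S_n) : seq 'I_n.-1 := xchoose (redword_ex w).
Definition Tw (w : 'S_n) : hecke := \prod_(i <- redword w) Tgn i.

Definition qfact (m : nat) : K := \prod_(1 <= k < m.+1) qint q^-1 k.
Definition yn : hecke :=
  (qfact n)^-1 *: \sum_(w : 'S_n) (- q) ^- plength w *: Tw w.

(* Rows, columns and entries are numbered from 0. A partition of n is an n-tuple
   padded with zeros, and a standard tableau t is given by the box t m of each
   entry m. *)
Local Notation box := ('I_n * 'I_n)%type.
Implicit Types l : n.-tuple 'I_n.+1.

Definition part l (i : nat) : nat := nth ord0 l i.
Definition is_partition l : bool :=
  (\sum_(i < n) part l i == n)%N &&
  [forall i : 'I_n, part l i.+1 <= part l i]%N.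
Definition content (b : box) : int := b.2%:Z - b.1%:Z.
Definition diag l : {set box} := [set b : box | b.2 < part l b.1]%N.
Definition colen l (j : nat) : nat := #|[set i : 'I_n | j < part l i]%N|.
Definition hook l (b : box) : nat :=
  ((part l b.1 - b.2.+1) + (colen l b.2 - b.1.+1)).+1%N.
Definition nlam l : nat := (\sum_(i < n) i * part l i)%N.

Definition std l (t : {ffun 'I_n -> box}) : bool :=
  [&& injectiveb t, [set t m | m : 'I_n] == diag l &
   [forall m : 'I_n, forall m' : 'I_n,
     (((t m).1 == (t m').1) && ((t m).2 < (t m').2) ||
      ((t m).2 == (t m').2) && ((t m).1 < (t m').1))%N ==> (m < m')%N]].
Definition dlam l : nat := #|[set t : {ffun 'I_n -> box} | std l t]|.

(* JM m is L_{m+1}; accordingly k%:Z - m%:Z runs over -m, ..., m in Et. *)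
Definition JM (m : 'I_n) : hecke :=
  \sum_(j < n | (j < m)%N) q ^- (m - j) *: Tw (tperm j m).
Definition Et (t : {ffun 'I_n -> box}) : hecke :=
  \prod_(m < n) \prod_(k < (m.*2).+1 | k%:Z - m%:Z != content (t m))
    ((qint q (content (t m)) - qint q (k%:Z - m%:Z))^-1 *:
     (JM m - qint q (k%:Z - m%:Z) *: 1)).
Definition Flam l : hecke := \sum_(t : {ffun 'I_n -> box} | std l t) Et t.

Definition primitive_idempotent (e : hecke) : Prop :=
  [/\ e != 0, e * e = e &
   forall f g : hecke, f * f = f -> g * g = g -> f * g = 0 -> g * f = 0 ->
     e = f + g -> f = 0 \/ g = 0].
Definition in_block l (e : hecke) : Prop := e * Flam l = e.

Definition Omega (r s : nat) l : bool :=
  [&& is_partition l, (part l r <= s)%N & all (fun i => (s <= part l i)%N) (iota 0 r)].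
Definition plam (r s : nat) l : K :=
  \prod_(b in diag l | ~~ ((b.1 < r) && (b.2 < s))%N)
    (q ^ (r%:Z - s%:Z) / qint q (content b + r%:Z - s%:Z)).
Definition klam l : K := q ^+ nlam l * \prod_(b in diag l) (qint q (hook l b))^-1.
End HeckeAlgebra.

Section Action.
Variables (K : fieldType) (q : K) (d : nat) (par : 'I_d -> bool).
Variable R : heckeSym q par.

Definition rho (n : nat) : hecke q n -> tmat K d n :=
  plift (@scalar_mx K #|{: n.-tuple 'I_d}|) (Rat R (n := n)).
Definition Rw (n : nat) (w : 'S_n) : tmat K d n := rho (Tw q w).
Definition dimLambda (n : nat) : nat := \rank (rho (yn q n)).

(* The roots xs and the poles ys are counted with multiplicity; num and den have
   no common root since their roots have opposite signs. *)
Definition birank (r s : nat) : Prop :=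
  exists (num den : {poly algC}) (xs ys : seq algC),
  [/\ den != 0,
      forall m, \sum_(k < m.+1) (dimLambda k)%:R * den`_(m - k) = num`_m,
      num = lead_coef num *: \prod_(x <- xs) ('X - x%:P) /\
      den = lead_coef den *: \prod_(y <- ys) ('X - y%:P),
      all (fun x => x < 0) xs /\ all (fun y => 0 < y) ys &
      size xs = r /\ size ys = s].

Definition Pn (r s n : nat) : tmat K d n :=
  \sum_(l | Omega r s l) plam q r s l *: rho (Flam q l).

Definition normalized (r s : nat) (int : HRs R -> K) : Prop :=
  forall (n : nat) (I J Ks L : n.-tuple 'I_d),
  int (Zmon par (zH R) J I * Tmon par (tH R) L Ks) =
  (-1) ^+ (deg par Ks * (deg par Ks + deg par L))%N *
  \sum_(w : 'S_n) q ^- plength w *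
     (tent (Pn r s n *m tpow n (Cmx R) *m Rw w^-1%g) L I * tent (Rw w) J Ks).

(* h is the chosen square root of q, and hexp is q^{n(r-s+1)/2}. *)
Definition hexp (h : K) (r s n : nat) : K := h ^ (n%:Z * (r%:Z - s%:Z + 1)).

(* S_lambda and S_{-lambda}, for e a primitive idempotent of the block of lambda. *)
Definition Schar (h : K) (r s n : nat) (D : 'M[K]_d) (e : hecke q n) : ER R :=
  hexp h r s n *: \tr (map_mx (in_alg (ER R)) (tpow n D *m rho e) *m
                      Zmx par n (@zER K q d par R)).
Definition Schar' (h : K) (r s n : nat) (e : hecke q n) : ERp R :=
  hexp h r s n *: \tr (mulbar par (map_mx (in_alg (ERp R)) (tpow n (Cmx R) *m rho e))
                      (Tbar par n (@tERp K q d par R))).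
(* The KK-linear extension of int to KK (x) H_R; KK is purely even, so this is the
   ordinary tensor product of algebras. *)
Definition int_ext (KK : algType K) (int : HRs R -> K)
    (x : stensor (purely_even KK) (HRs R)) : KK :=
  tlift (fun k a => int a *: k) x.
End Action.

Section AntipodeMonomial.
Variables (K : fieldType) (q : K) (d : nat) (par : 'I_d -> bool).
Variable R : heckeSym q par.
Local Notation H := (HRs R).

Lemma sum_pairs n (F : 'I_n -> 'I_n -> nat) :
  (\sum_b \sum_a F a b =
   \sum_b F b b + \sum_(b < n) \sum_(a < n | (a < b)%N) (F a b + F b a))%N.
Proof.
have -> : (\sum_(b < n) \sum_(a < n | (a < b)%N) (F a b + F b a) =
   \sum_(b < n) \sum_(a < n | (a < b)%N) F a b +
   \sum_(b < n) \sum_(a < n | (b < a)%N) F a b)%N.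
  rewrite [X in _ = (_ + X)%N](exchange_big_dep xpredT) //= -big_split /=.
  by apply: eq_bigr => b _; rewrite big_split.
rewrite addnA -!big_split /=.
apply: eq_bigr => b _; rewrite (bigD1 b) //= (bigID (fun a : 'I_n => (a < b)%N)) /=.
rewrite addnA; congr (_ + _ + _)%N; apply: eq_bigl => a;
  by rewrite -val_eqE /=; case: ltngtP.
Qed.

Variable S : {linear H -> H}.
Hypothesis S1 : S 1 = 1.
Hypothesis SM : forall a b : H, S (a * b) = koszul (fun a b => S b * S a) a b.
Hypothesis Sz : forall i j,
  S (zH R i j) = ((-1) ^+ (par j && (par i (+) par j)) : K) *: tH R i j.

Lemma hc_prodz n (u v : 'I_n -> 'I_d) :
  hc (odd (\sum_(k < n) (par (u k) + par (v k))))%N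
     (\prod_(k < n) zH R (u k) (v k) : H) = \prod_(k < n) zH R (u k) (v k).
Proof.
elim: n u v => [|n IH] u v; first by rewrite !big_ord0 hc_one.
rewrite !big_ord_recr /= oddD; apply: (@hmul K H); first exact: IH.
by rewrite oddD !oddb; exact: hc_z.
Qed.

Lemma S_prodz n (u v : 'I_n -> 'I_d) :
  S (\prod_(k < n) zH R (u k) (v k)) =
  ((-1) ^+ (\sum_(b < n) (par (v b) * (par (u b) + par (v b)) +
     \sum_(a < n | a < b) (par (u a) + par (v a)) *
                          (par (u b) + par (v b))))%N : K) *:
  \prod_(k < n) tH R (u (rev_ord k)) (v (rev_ord k)).
Proof.
elim: n u v => [|n IH] u v; first by rewrite !big_ord0 S1 expr0 scale1r.
rewrite big_ord_recr SM.
have bil : bilinear_map (fun a b : H => S b * S a).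
  by split=> [b c a a'|a c b b']; rewrite linearP ?mulrDr ?mulrDl
    -?scalerAr -?scalerAl.
have h1 := hc_prodz (fun k => u (widen_ord (leqnSn n) k))
                    (fun k => v (widen_ord (leqnSn n) k)).
rewrite (koszul_homog bil h1 (hc_z R (u ord_max) (v ord_max))).
rewrite Sz IH -scalerAl -scalerAr !scalerA [X in _ = _ *: X]big_ord_recl.
have -> : rev_ord (ord0 : 'I_n.+1) = ord_max.
  by apply: val_inj; rewrite /= subn1.
have -> : \prod_(i < n) tH R (u (rev_ord (lift ord0 i))) (v (rev_ord (lift ord0 i)))
  = \prod_(k < n) tH R (u (widen_ord (leqnSn n) (rev_ord k)))
                      (v (widen_ord (leqnSn n) (rev_ord k))).
  by apply: eq_bigr => k _; congr (tH R (u _) (v _)); apply: val_inj;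
    rewrite /= /bump leq0n add1n subSS.
congr (_ *: _); rewrite big_ord_recr /=.
set D0 := odd (\sum_(k < n) _)%N.
set E := (\sum_(b < n) _)%N; set E' := (\sum_(i < n) _)%N.
have <- : E = E'.
  rewrite /E /E'; apply: eq_bigr => b _.
  rewrite [X in _ = (_ + X)%N]big_mkcond big_ord_recr /= ltnNge ltnW ?ltn_ord //= addn0.
  by rewrite -(big_mkcond (fun i : 'I_n => (i < b)%N)).
set X := (\sum_(a < n.+1 | _) _)%N.
have -> : X = ((\sum_(k < n) (par (u (widen_ord (leqnSn n) k)) +
   par (v (widen_ord (leqnSn n) k)))) * (par (u ord_max) + par (v ord_max)))%N.
  rewrite /X big_mkcond big_ord_recr /= ltnn /= addn0 big_distrl /=.
  by apply: eq_bigr => a _; rewrite ltn_ord.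
rewrite {}/D0 -!exprD -signr_odd -[RHS]signr_odd; congr (_ ^+ (nat_of_bool _)).
rewrite !(oddD, oddM, oddb); case: (odd E); case: (odd _);
  by case: (par (u _)); case: (par (v _)).
Qed.

Lemma antipode_Zmon n (I J : n.-tuple 'I_d) :
  S (Zmon par (zH R) I J) =
  ((-1) ^+ (deg par J * (deg par I + deg par J))%N : K) *: Tmon par (tH R) I J.
Proof.
rewrite /Zmon /Tmon linearZ /= S_prodz !scalerA; congr (_ *: _).
rewrite -!exprD -signr_odd -[RHS]signr_odd; congr (_ ^+ (nat_of_bool _)).
have -> : (deg par J * (deg par I + deg par J) =
  \sum_b \sum_a par (tnth J a) * (par (tnth I b) + par (tnth J b)))%N.
  rewrite /deg -big_split big_distrr; apply: eq_bigr => b _.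
  by rewrite big_distrl.
rewrite sum_pairs /sgnZ /sgnT big_split /= -!addnA addnCA !oddD; congr (_ (+) _).
rewrite -!oddD -!big_split /= !(big_morph odd oddD (erefl _)).
apply: eq_bigr => b _; rewrite -!big_split /= !(big_morph odd oddD (erefl _)).
apply: eq_bigr => a _; rewrite !(oddD, oddM, oddb).
by case: (par _) (par _) (par _) (par _) => [] [] [] [].
Qed.

Lemma mulbar_antipode n (X : tmat H d n) :
  mulbar par X (Tbar par n (tH R)) = X *m map_mx S (Zmx par n (zH R)).
Proof.
apply/matrixP => a b; rewrite !mxE (reindex_onto enum_val enum_rank) /=; last first.
  by move=> J _; rewrite enum_rankK.
apply: eq_big => [c|c _]; first by rewrite enum_valK eqxx.
rewrite /tent !mxE !enum_rankK !enum_valK antipode_Zmon.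
have sE m (x : H) : (-1) ^+ m * x = ((-1) ^+ m : K) *: x.
  rewrite -signr_odd -[X in X *: _]signr_odd; case: (odd m).
    by rewrite !expr1 mulN1r scaleN1r.
  by rewrite !expr0 mul1r scale1r.
by rewrite sE -[RHS]scalerAr.
Qed.

End AntipodeMonomial.

Section DeltaTheory.
Variables (K : fieldType) (q : K) (d : nat) (par : 'I_d -> bool).
Variable R : heckeSym q par.
Local Notation H := (HRs R).
Local Notation z := (zH R).
Local Notation t := (tH R).
Local Notation Delta := (@Delta K q d par R).

Lemma Delta_z i j : Delta (z i j) = \sum_k stpure (z i k : H) (z k j : H).
Proof. exact: (plift_gen (@st_in_central K H H) (@Delta_sat _ _ _ _ R)). Qed.
Lemma Delta_t i j : Delta (t i j) = \sum_k stpure (t k j : H) (t i k : H).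
Proof. exact: (plift_gen (@st_in_central K H H) (@Delta_sat _ _ _ _ R)). Qed.
Lemma DeltaM : {morph Delta : x y / x * y}.
Proof. exact: (pliftM (@st_in_central K H H) (@Delta_sat _ _ _ _ R)). Qed.
Lemma Delta1 : Delta 1 = 1.
Proof. exact: (plift1 (@st_in_central K H H) (@Delta_sat _ _ _ _ R)). Qed.
Lemma Delta_linear : linear Delta.
Proof.
move=> c x y; rewrite /Delta (pliftD (@st_in_central K H H) (@Delta_sat _ _ _ _ R)).
by rewrite (pliftZ (@st_in_central K H H) (@Delta_sat _ _ _ _ R)) st_inE.
Qed.

Lemma tlift_sum (A B : superAlg K) (W : lmodType K) (f : A -> B -> W) I (s : seq I) F G :
  bilinear_map f ->
  tlift f (\sum_(i <- s) stpure (F i) (G i)) = \sum_(i <- s) f (F i) (G i).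
Proof.
move=> bf; have lf := tlift_linear bf; rewrite (big_morph (tlift f) (id1 := 0) (op1 := +%R)).
- by apply: eq_bigr => i _; exact: tlift_pure.
- by move=> x y; have := lf 1 x y; rewrite !scale1r.
- by have := lf (-1) 0 0; rewrite scaler0 addr0 scaleN1r addNr.
Qed.

Lemma antipode_z (S : {linear H -> H}) : is_antipode S -> forall i j,
  S (z i j) = ((-1) ^+ (par j && (par i (+) par j)) : K) *: t i j.
Proof.
move=> [hS _] i j.
have bS : bilinear_map (fun a1 a2 : H => S a1 * a2).
  by split=> [v c x y|u c x y]; rewrite ?linearP ?mulrDl ?mulrDr -?scalerAl -?scalerAr.
have hz k : \sum_l S (z i l) * z l k = (i == k)%:R *: (1 : H).
  have := hS (z i k); rewrite Delta_z tlift_sum // => ->.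
  by rewrite /counit (plift_gen (@central_id K) (@counit_sat _ _ _ _ R)).
have [_ h2 _] := HR_relations R.
transitivity (\sum_k \sum_l S (z i l) *
  (((-1) ^+ (par j && (par k (+) par j)) : K) *: (z l k * t k j))).
  rewrite exchange_big (bigD1 j) //= -mulr_sumr h2 eqxx scale1r mulr1.
  rewrite big1 ?addr0 // => l nl.
  by rewrite -mulr_sumr h2 (negPf nl) scale0r mulr0.
rewrite (bigD1 i) //= [X in _ + X]big1 ?addr0 => [|k nk].
  under eq_bigr => l _ do rewrite -scalerAr mulrA.
  by rewrite -scaler_sumr -mulr_suml hz eqxx scale1r mul1r.
under eq_bigr => l _ do rewrite -scalerAr mulrA.
by rewrite -scaler_sumr -mulr_suml hz eq_sym (negPf nk) scale0r mul0r scaler0.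
Qed.
End DeltaTheory.

(* Main.v *)
(* The functions phi x = M(tr(D^n rho(x) Z^n)) and psi x = N(tr(C^n rho(x) S(Z^n))) on
   the Hecke algebra satisfy phi(xy) = phi(yx) and psi(xy) = psi(yx): the matrices Z^n and
   S(Z^n) commute with the R_i by the relations of H_R, and so do C^n and D^n by the braid
   relation contracted with P. The normalization of the integral therefore turns the left
   hand side into sum_w q^{-l(w)} phi(T_w) psi(p T_{w^-1}) with p = sum_l p_l F_l.
   The bases T_w and q^{-l(w)} T_{w^-1} are dual for the trace form tau, the coefficient
   of T_1. In Young's seminormal form tau is a weighted sum of the diagonal entries, the
   weight of a standard tableau of shape l being k_l; hence E_t x E_t is a multiple of E_t
   and the sum over w collapses to sum_t phi(E_t) psi(E_t) / k_l over the standard tableaux t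
   of shape l, where E_t may be replaced by any primitive idempotent of the block. *)
From HB Require Import structures.
Require Import Defs.
From mathcomp Require Import fingroup perm all_boot all_order all_algebra algC.
From mathcomp Require Import generic_quotient boolp.
From mathcomp Require Import ring zify.
Set Implicit Arguments.
Unset Strict Implicit.
Unset Printing Implicit Defensive.
Import Order.TTheory GRing.Theory Num.Theory.
Local Open Scope ring_scope.

(** * Local representations of the Hecke algebra *)

(** Why the weights k_l give tau: let a standard tableau grow box by box, the next box entering row
    i with the formal probability [rowwt]. Lagrange interpolation at the nodes q^(lam_i + n - 1 - i)
    shows that these probabilities sum to 1 and that the diagonal coefficient of T_i has mean 0 over
    the position of the later of its two entries. Hence the weighted trace kills h T_i for every h
    built from earlier generators. So does tau, and for trace functions with value 1 at 1 this
    property fixes the values on a spanning set of words. The product of the probabilities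
    telescopes to the hook formula for k_l. No dimension count for the blocks enters: n! normal form
    words bound H_n from above, the regular representation bounds it from below, and the seminormal
    form is faithful because tau is nondegenerate. Identities in H_n can thus be checked on
    matrices, where E_t is a diagonal matrix unit. On the Hopf side r is known only through its
    axioms. The values r(z, S(z)) are recovered as the partial inverse of R up to sign, which makes
    D the operator C of the flipped symmetry. *)

Lemma mulmx_enum (A : pzSemiRingType) (X : finType) p1 p2
    (U : 'M[A]_(p1, #|X|)) (W : 'M[A]_(#|X|, p2)) i j :
  (U *m W) i j = \sum_x U i (enum_rank x) * W (enum_rank x) j.
Proof.
rewrite mxE (reindex_onto enum_rank enum_val) /=; last first.
  by move=> x _; exact: enum_valK.
by apply: eq_bigl => x; rewrite enum_rankK eqxx.
Qed.

Lemma enum_mxP (A : Type) (X Y : finType) (U W : 'M[A]_(#|X|, #|Y|)) :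
  (forall x y, U (enum_rank x) (enum_rank y) = W (enum_rank x) (enum_rank y)) ->
  U = W.
Proof.
by move=> e; apply/matrixP => i j; rewrite -[i]enum_valK -[j]enum_valK.
Qed.

Section LocalRepresentation.
Variables (K : fieldType) (q : K) (n : nat) (X : finType) (V : eqType).
Variables (c : X -> {ffun 'I_n -> V}) (a b : V -> V -> K).

Definition swapf (U : Type) (i : 'I_n.-1) (f : {ffun 'I_n -> U}) : {ffun 'I_n -> U} :=
  [ffun k => f (tperm (pos0 i) (pos1 i) k)].

Lemma pos0_neq_pos1 (i : 'I_n.-1) : pos0 i != pos1 i.
Proof. by apply/eqP => /(congr1 val) /= /eqP; rewrite -{1}[val i]addn0 -addn1 eqn_add2l. Qed.

Lemma swapf0 U (i : 'I_n.-1) (f : {ffun 'I_n -> U}) :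
  swapf i f (pos0 i) = f (pos1 i).
Proof. by rewrite ffunE tpermL. Qed.
Lemma swapf1 U (i : 'I_n.-1) (f : {ffun 'I_n -> U}) :
  swapf i f (pos1 i) = f (pos0 i).
Proof. by rewrite ffunE tpermR. Qed.
Lemma swapfD U (i : 'I_n.-1) (f : {ffun 'I_n -> U}) k :
  k != pos0 i -> k != pos1 i -> swapf i f k = f k.
Proof. by move=> h0 h1; rewrite ffunE tpermD // eq_sym. Qed.
Lemma swapfK U (i : 'I_n.-1) : involutive (@swapf U i).
Proof. by move=> f; apply/ffunP => k; rewrite !ffunE tpermK. Qed.

(* The basis vector of the element whose values are f, or 0 if there is none. *)
Definition lvec (f : {ffun 'I_n -> V}) : 'cV[K]_#|X| :=
  \col_k (c (enum_val k) == f)%:R.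
(** One form of action, with coefficients depending on two adjacent values, covers both the regular
    representation and Young's seminormal form. The Hecke relations reduce to identities for [a] and
    [b] in two or three distinct values. A swap may leave the image of [c], but by [c_swap] only
    where [b] vanishes. *)
Definition lmat (i : 'I_n.-1) : 'M[K]_#|X| :=
  \matrix_(k, l) let f := c (enum_val l) in
     a (f (pos0 i)) (f (pos1 i)) * (k == l)%:R +
     b (f (pos0 i)) (f (pos1 i)) * (c (enum_val k) == swapf i f)%:R.

Hypothesis c_inj : injective c.
Hypothesis c_swap : forall x (i : 'I_n.-1),
  b (c x (pos0 i)) (c x (pos1 i)) != 0 -> exists x', c x' = swapf i (c x).
Hypothesis c_dist1 : forall x (i : 'I_n.-1), c x (pos0 i) != c x (pos1 i).
Hypothesis c_dist2 : forall x (i j : 'I_n.-1), j = i.+1 :> nat ->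
  c x (pos0 i) != c x (pos1 j).
Hypothesis a_quad : forall u v, u != v ->
  a u v * a u v + b u v * b v u = (q - 1) * a u v + q.
Hypothesis b_quad : forall u v, u != v -> b u v * (a u v + a v u) = (q - 1) * b u v.
Hypothesis a_braid : forall u v w, u != v -> v != w -> u != w ->
  a u v * a v w + a u w * a v u = a v w * a u w.
Hypothesis a_braid' : forall u v w, u != v -> v != w -> u != w ->
  a v w * a u v + a u w * a w v = a u v * a u w.
Hypothesis ab_braid : forall u v w, u != v -> v != w -> u != w ->
  a u v * a v w * a u v + b u v * b v u * a u w =
  a v w * a u v * a v w + b v w * b w v * a u w.

Lemma lvecE x : lvec (c x) = delta_mx (enum_rank x) 0.
Proof.
apply/matrixP => k j; rewrite !mxE ord1 eqxx andbT (inj_eq c_inj).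
by rewrite -[k in RHS]enum_valK (inj_eq enum_rank_inj).
Qed.

Lemma lmat_lvec f i : (exists x, c x = f) -> lmat i *m lvec f =
  a (f (pos0 i)) (f (pos1 i)) *: lvec f +
  b (f (pos0 i)) (f (pos1 i)) *: lvec (swapf i f).
Proof.
case=> x <-; rewrite [in LHS]lvecE -colE; apply/matrixP => k j.
rewrite lvecE !mxE !enum_rankK ord1 eqxx andbT.
by [].
Qed.

(** A swapped function may have no preimage under [c], and then [lmat_lvec] does not apply to it. In
    the computations below such a vector always carries a coefficient that is 0 in this case. *)
Lemma lmat_lvec_scaled (s : K) f i : (s != 0 -> exists x, c x = f) ->
  s *: (lmat i *m lvec f) =
  s *: (a (f (pos0 i)) (f (pos1 i)) *: lvec f +
  b (f (pos0 i)) (f (pos1 i)) *: lvec (swapf i f)).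
Proof.
have [-> _|_ /(_ isT)] := eqVneq s 0; first by rewrite !scale0r.
by move=> /lmat_lvec->.
Qed.

Lemma c_swap_good f i : (exists x, c x = f) ->
  b (f (pos0 i)) (f (pos1 i)) != 0 -> exists x, c x = swapf i f.
Proof. by case=> x <-; exact: c_swap. Qed.

Lemma lmatP (U W : 'M[K]_#|X|) : (forall x, U *m lvec (c x) = W *m lvec (c x)) -> U = W.
Proof.
move=> e; apply/matrixP => k l; have := e (enum_val l).
by rewrite lvecE enum_valK -!colE => /matrixP/(_ k 0); rewrite !mxE.
Qed.

Lemma lmat_quad i : lmat i *m lmat i = (q - 1) *: lmat i + q%:M.
Proof.
apply: lmatP => x; have gx : exists x', c x' = c x by exists x.
rewrite mulmxDl -scalemxAl mul_scalar_mx -mulmxA (lmat_lvec _ gx).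
rewrite mulmxDr -!scalemxAr (lmat_lvec _ gx) (lmat_lvec_scaled (s := b _ _)); last first.
  by move/(c_swap_good gx).
rewrite swapf0 swapf1 swapfK; have d := c_dist1 x i.
move: (a_quad d) (b_quad d).
set u := c x _; set v := c x _; set E1 := lvec _; set E2 := lvec _ => h1 h2.
apply/matrixP => k l; rewrite !mxE.
move: (c _ == c x)%:R (c _ == swapf i _)%:R => e1 e2.
transitivity ((a u v * a u v + b u v * b v u) * e1 + b u v * (a u v + a v u) * e2).
  ring.
rewrite h1 h2; ring.
Qed.

Lemma pos_next (i j : 'I_n.-1) : j = i.+1 :> nat -> pos0 j = pos1 i.
Proof. by move=> e; apply: val_inj. Qed.

Lemma swapf_braid U (i j : 'I_n.-1) (f : {ffun 'I_n -> U}) : j = i.+1 :> nat ->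
  swapf i (swapf j (swapf i f)) = swapf j (swapf i (swapf j f)).
Proof.
move=> e; have ej := pos_next e; apply/ffunP => k; rewrite !ffunE -!permM.
congr (f _); congr (fun_of_perm _ k).
have n01 := pos0_neq_pos1 i; have n12 := pos0_neq_pos1 j; rewrite ej in n12 *.
have n02 : pos0 i != pos1 j.
  by apply/eqP => /(congr1 val) /= h; move: e; lia.
set x := pos0 i in n01 n02 *; set y := pos1 i in n01 n12 *; set z := pos1 j in n12 n02 *.
have -> : (tperm x y * (tperm y z * tperm x y))%g = tperm x z.
  rewrite -{1}[tperm x y]tpermV -/(conjg _ _) tpermJ tpermR tpermD //.
have -> : (tperm y z * (tperm x y * tperm y z))%g = tperm x z.
  rewrite -{1}[tperm y z]tpermV -/(conjg _ _) tpermJ tpermL tpermD //;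
    by rewrite eq_sym.
by [].
Qed.

Lemma lmat_braid (i j : 'I_n.-1) : j = i.+1 :> nat ->
  lmat i *m lmat j *m lmat i = lmat j *m lmat i *m lmat j.
Proof.
move=> e; apply: lmatP => x; have gx : exists x', c x' = c x by exists x.
have ej := pos_next e.
have n01 := pos0_neq_pos1 i; have n12 := pos0_neq_pos1 j.
have n02 : pos0 i != pos1 j by apply/eqP => /(congr1 val) /= h; move: e; lia.
have d2 := c_dist2 x e; have d1 := c_dist1 x i; have d3 := c_dist1 x j.
rewrite -!mulmxA.
have i2 f : swapf i f (pos1 j) = f (pos1 j) :> V by rewrite swapfD // ?(eq_sym (pos1 j)) -?ej.
have j0 f : swapf j f (pos0 i) = f (pos0 i) :> V by rewrite swapfD // ej.
have i0 f : swapf i f (pos0 i) = f (pos1 i) :> V by rewrite swapf0.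
have i1 f : swapf i f (pos1 i) = f (pos0 i) :> V by rewrite swapf1.
have j1 f : swapf j f (pos1 i) = f (pos1 j) :> V by rewrite -ej swapf0.
have j2 f : swapf j f (pos1 j) = f (pos1 i) :> V by rewrite swapf1 ej.
rewrite ?ej in n12 n02 d1 d2 d3 *.
have gi := fun f => @c_swap_good f i; have gj := fun f => @c_swap_good f j.
rewrite ej in gj.
have Li s f := @lmat_lvec_scaled s f i; have Lj s f := @lmat_lvec_scaled s f j.
rewrite ej in Lj.
set f := c x in gx d1 d2 d3 *.
set u := f (pos0 i) in d1 d2 *; set v := f (pos1 i) in d1 d3 *; set w := f (pos1 j) in d2 d3 *.
have g1 : b u v != 0 -> exists x', c x' = swapf i f by exact: gi.
have g2 : b v w != 0 -> exists x', c x' = swapf j f by exact: gj.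
have g12 : b u v * b u w != 0 -> exists x', c x' = swapf j (swapf i f).
  by rewrite mulf_eq0 negb_or => /andP[/g1 h1 h2]; apply: gj => //; rewrite i1 i2.
have g21 : b v w * b u w != 0 -> exists x', c x' = swapf i (swapf j f).
  by rewrite mulf_eq0 negb_or => /andP[/g2 h1 h2]; apply: gi => //; rewrite j0 j1.
have S1 : lmat j *m (lmat i *m lvec f) = a u v *: (a v w *: lvec f + b v w *: lvec (swapf j f))
    + b u v *: (a u w *: lvec (swapf i f) + b u w *: lvec (swapf j (swapf i f))).
  by rewrite (lmat_lvec i gx) mulmxDr -!scalemxAr (lmat_lvec j gx) (Lj (b u v)) // i1 i2 ej.
have S2 : lmat i *m (lmat j *m lvec f) = a v w *: (a u v *: lvec f + b u v *: lvec (swapf i f))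
    + b v w *: (a u w *: lvec (swapf j f) + b u w *: lvec (swapf i (swapf j f))).
  by rewrite (lmat_lvec j gx) ej mulmxDr -!scalemxAr (lmat_lvec i gx) (Li (b v w)) // j0 j1.
rewrite S1 S2 !(mulmxDr, =^~ scalemxAr, scalerDr, scalerA) !(lmat_lvec i gx) !(lmat_lvec j gx).
rewrite ej -/u -/v -/w.
rewrite (Li (b u v * a u w)); last by rewrite mulf_eq0 negb_or => /andP[/g1].
rewrite (Lj (b v w * a u w)); last by rewrite mulf_eq0 negb_or => /andP[/g2].
rewrite (Li (b u v * b u w)) // (Lj (b v w * b u w)) //.
rewrite (Li (a u v * b v w)); last by rewrite mulf_eq0 negb_or => /andP[_ /g2].
rewrite (Lj (a v w * b u v)); last by rewrite mulf_eq0 negb_or => /andP[_ /g1].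
rewrite (swapf_braid _ e) !swapfK !(i0, i1, i2, j0, j1, j2) -/u -/v -/w.
have hA := a_braid d1 d3 d2.
have hB := a_braid' d1 d3 d2.
have hC := ab_braid d1 d3 d2.
apply/matrixP => k l; rewrite !mxE.
move: (_ == f)%:R (_ == swapf i f)%:R (_ == swapf j f)%:R (_ == swapf j (swapf i f))%:R
  (_ == swapf i (swapf j f))%:R (_ == swapf j (swapf i (swapf j f)))%:R => e1 e2 e3 e4 e5 e6.
(* [e1], ..., [e6] belong to the six rearrangements of u, v, w. The coefficients of [e1], [e2], [e3]
   need the three braid hypotheses; the other three are the same products in a different order. *)
transitivity ((a u v * a v w * a u v + b u v * b v u * a u w) * e1
  + b u v * (a u v * a v w + a u w * a v u) * e2 + b v w * (a u v * a u w) * e3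
  + b u v * b u w * a v w * e4 + a u v * b v w * b u w * e5 + b u v * b u w * b v w * e6).
  ring.
rewrite hA hC -hB; ring.
Qed.

Lemma lmat_comm (i j : 'I_n.-1) : (i.+1 < j)%N -> lmat i *m lmat j = lmat j *m lmat i.
Proof.
move=> lt; apply: lmatP => x; have gx : exists x', c x' = c x by exists x.
have h00 : pos0 i != pos0 j by apply/eqP => /(congr1 val) /= h; move: lt h; lia.
have h01 : pos0 i != pos1 j by apply/eqP => /(congr1 val) /= h; move: lt h; lia.
have h10 : pos1 i != pos0 j by apply/eqP => /(congr1 val) /= h; move: lt h; lia.
have h11 : pos1 i != pos1 j by apply/eqP => /(congr1 val) /= h; move: lt h; lia.
rewrite -!mulmxA (lmat_lvec i gx) (lmat_lvec j gx) !(mulmxDr, =^~ scalemxAr).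
rewrite !(lmat_lvec i gx) !(lmat_lvec j gx).
rewrite (lmat_lvec_scaled j (s := b (c x (pos0 i)) _)); last exact: c_swap_good.
rewrite (lmat_lvec_scaled i (s := b (c x (pos0 j)) _)); last exact: c_swap_good.
have e1 f : swapf j f (pos0 i) = f (pos0 i) :> V by exact: swapfD.
have e2 f : swapf j f (pos1 i) = f (pos1 i) :> V by exact: swapfD.
have e3 f : swapf i f (pos0 j) = f (pos0 j) :> V by apply: swapfD; rewrite eq_sym.
have e4 f : swapf i f (pos1 j) = f (pos1 j) :> V by apply: swapfD; rewrite eq_sym.
rewrite e1 e2 e3 e4.
have -> : swapf j (swapf i (c x)) = swapf i (swapf j (c x)).
  apply/ffunP => k; rewrite !ffunE -!permM; congr (c x (fun_of_perm _ k)).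
  by rewrite conjgC tpermJ !tpermD // eq_sym.
apply/matrixP => k l; rewrite !mxE; ring.
Qed.

Lemma lmat_sat : satisfies (@hecke_rels K q n) (@scalar_mx K #|X|) lmat.
Proof.
move=> _ _ [i j /lmat_braid|i j /lmat_comm|i] /=.
- by rewrite !mulmxE.
- by rewrite !mulmxE.
- by rewrite -!mulmxE mul_scalar_mx lmat_quad.
Qed.

End LocalRepresentation.

(** * Reduced words and the basis T_w *)

Section Inversions.
Variable n : nat.
Implicit Types w : 'S_n.
Local Notation s_ i := (tperm (pos0 i) (pos1 i) : 'S_n).

Definition inv w : nat :=
  (\sum_(p : 'I_n * 'I_n) ((p.1 < p.2) && (w p.2 < w p.1)))%N.

Lemma stperm_val (i : 'I_n.-1) (k : 'I_n) : (s_ i k : nat) =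
  if k == i :> nat then i.+1 else if k == i.+1 :> nat then i : nat else k.
Proof.
have [->|n0] := eqVneq k (pos0 i); first by rewrite tpermL /= eqxx.
have [->|n1] := eqVneq k (pos1 i).
  by rewrite tpermR /= eqxx; case: eqP => // h; lia.
rewrite tpermD; [|by rewrite eq_sym|by rewrite eq_sym].
have -> : (k == i :> nat) = false by apply/negbTE; exact: n0.
by have -> : (k == i.+1 :> nat) = false by apply/negbTE; exact: n1.
Qed.

(** Composing with s_i only permutes the pairs of positions, and the single pair whose order it
    reverses is ([pos0 i], [pos1 i]). *)
Lemma inv_asc (i : 'I_n.-1) w : (w (pos0 i) < w (pos1 i))%N ->
  inv (s_ i * w)%g = (inv w).+1.
Proof.
move=> asc; rewrite /inv.
rewrite (reindex_onto (fun p => (s_ i p.1, s_ i p.2)) (fun p => (s_ i p.1, s_ i p.2))) /=;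
  last by move=> [a b] _; rewrite !tpermK.
rewrite (eq_bigl xpredT); last by move=> [a b]; rewrite !tpermK eqxx.
under eq_bigr => p _ do rewrite !permM !tpermK.
rewrite (bigD1 (pos1 i, pos0 i)) //= [in RHS](bigD1 (pos1 i, pos0 i)) //=.
rewrite !stperm_val /= !eqxx asc.
have -> : (i.+1 == i :> nat) = false by lia.
rewrite ltnSn [in RHS]ltnNge leqnSn /= add0n add1n; congr _.+1.
apply: eq_bigr => -[a b]; rewrite xpair_eqE /= => nab.
have [h|/negbTE h] := boolP ((a == pos0 i) && (b == pos1 i)).
  by case/andP: h => /eqP-> /eqP->; rewrite [(w _ < w (pos0 i))%N]ltnNge (ltnW asc) !andbF.
congr (nat_of_bool (_ && _)); rewrite !stperm_val.
move: h nab; rewrite -!val_eqE /=; move: (nat_of_ord a) (nat_of_ord b) (nat_of_ord i) => x y z h nab.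
by case: (x =P z) => ?; case: (x =P z.+1) => ?; case: (y =P z) => ?;
  case: (y =P z.+1) => ?; lia.
Qed.

Lemma inv_desc (i : 'I_n.-1) w : (w (pos1 i) < w (pos0 i))%N ->
  inv w = (inv (s_ i * w)%g).+1.
Proof.
move=> desc; rewrite -(@inv_asc i (s_ i * w)%g); first by rewrite mulgA -{2}[s_ i]tpermV mulgV mul1g.
by rewrite !permM tpermL tpermR.
Qed.

Lemma inv1 : inv 1%g = 0%N.
Proof. by rewrite /inv big1 // => -[a b] _; rewrite !perm1 /=; case: ltngtP. Qed.

Lemma perm_asc_neq (i : 'I_n.-1) w : ~~ (w (pos0 i) < w (pos1 i))%N ->
  (w (pos1 i) < w (pos0 i))%N.
Proof.
rewrite -leqNgt leq_eqVlt => /orP[/eqP/val_inj/perm_inj/eqP|//].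
by rewrite eq_sym (negPf (pos0_neq_pos1 i)).
Qed.

(** Without descents k <= w k holds for all k; both sides have the same sum over k, so equality
    holds everywhere. *)
Lemma no_desc w : (forall i : 'I_n.-1, (w (pos0 i) < w (pos1 i))%N) -> w = 1%g.
Proof.
move=> asc; have le (k : 'I_n) : (k <= w k)%N.
  case: k => k; elim: k => [|k IH] hk //.
  have hk' := lt_pred hk; apply: (leq_ltn_trans (IH (ltnW hk))).
  have := asc (Ordinal hk').
  have -> : pos0 (Ordinal hk') = Ordinal (ltnW hk) by exact: val_inj.
  by have -> : pos1 (Ordinal hk') = Ordinal hk by exact: val_inj.
have [_] := leqif_sum (P := xpredT) (fun k _ => leqif_eq (le k)).
rewrite [X in _ == X](reindex_inj (@perm_inj _ w^-1%g)) /=.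
under [X in _ == X]eq_bigr => k _ do rewrite permKV.
rewrite eqxx => /esym/forallP h.
by apply/perm.permP => k; rewrite perm1; apply: val_inj; apply/esym/eqP/(h k).
Qed.

Lemma word_perm_cons i (s : seq 'I_n.-1) :
  word_perm (i :: s) = (s_ i * word_perm s)%g.
Proof. by rewrite /word_perm big_cons. Qed.

Lemma word_perm_cat (s s' : seq 'I_n.-1) :
  word_perm (s ++ s') = (word_perm s * word_perm s')%g.
Proof. by rewrite /word_perm big_cat. Qed.

Lemma word_perm_rev (s : seq 'I_n.-1) : word_perm (rev s) = (word_perm s)^-1%g.
Proof.
elim: s => [|i s IH]; first by rewrite /word_perm big_nil invg1.
rewrite rev_cons -cats1 word_perm_cat IH [in RHS]word_perm_cons invMg tpermV.
by congr (_ * _)%g; rewrite /word_perm big_seq1.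
Qed.

Lemma inv_word_le (s : seq 'I_n.-1) : (inv (word_perm s) <= size s)%N.
Proof.
elim: s => [|i s IH]; first by rewrite /word_perm big_nil inv1.
rewrite word_perm_cons /=; set w := word_perm s in IH *.
have [/inv_asc->|/perm_asc_neq/inv_desc h] := boolP (w (pos0 i) < w (pos1 i))%N => //.
by rewrite -(leq_add2r 1) !addn1 -h ltnW // ltnS ltnW // ltnS.
Qed.

Lemma inv_word w : exists2 s : seq 'I_n.-1, size s = inv w & word_perm s = w.
Proof.
have [m] := ubnP (inv w); elim: m w => // m IH w lt.
have [/existsP[i desc]|] := boolP [exists i : 'I_n.-1, (w (pos1 i) < w (pos0 i))%N].
  have e := inv_desc desc; have [|s hs ws] := IH (s_ i * w)%g; first by rewrite -ltnS -e.
  exists (i :: s); first by rewrite /= hs e.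
  by rewrite word_perm_cons ws mulgA -{2}[s_ i]tpermV mulgV mul1g.
rewrite negb_exists => /forallP nd; have -> : w = 1%g.
  by apply: no_desc => i; apply: contraNT (nd i) => /perm_asc_neq.
by exists [::]; rewrite ?inv1 // /word_perm big_nil.
Qed.

Lemma plength_inv w : plength w = inv w.
Proof.
rewrite /plength; case: ex_minnP => m /existsP[s /eqP ws] min.
apply/eqP; rewrite eqn_leq -{2}ws -{3}(size_tuple s) inv_word_le andbT.
have [t ht wt] := inv_word w; rewrite -ht; apply: min; apply/existsP.
by exists (in_tuple t); rewrite wt.
Qed.

Lemma redwordP w : word_perm (redword w) = w /\ size (redword w) = inv w.
Proof.
rewrite /redword; have := xchooseP (redword_ex w).
by move=> /eqP e; split=> //; rewrite size_tuple plength_inv.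
Qed.

Lemma reduced_cons i (s : seq 'I_n.-1) : inv (word_perm (i :: s)) = size (i :: s) ->
  inv (word_perm s) = size s /\ (word_perm s (pos0 i) < word_perm s (pos1 i))%N.
Proof.
rewrite word_perm_cons /=; have le := inv_word_le s.
have [asc|/perm_asc_neq/inv_desc h] := boolP (_ < _)%N.
  by rewrite inv_asc // => -[].
by move=> e; move: le; rewrite h e ltnNge leqnSn.
Qed.

Lemma invV w : inv w^-1%g = inv w.
Proof.
have le v : (inv v^-1%g <= inv v)%N.
  have [s <- <-] := inv_word v; rewrite -word_perm_rev -size_rev.
  exact: inv_word_le.
by apply/eqP; rewrite eqn_leq le -{1}[w]invgK le.
Qed.

End Inversions.

Section MatrixRep.
Variables (K : fieldType) (q : K) (n N : nat) (T : 'I_n.-1 -> 'M[K]_N).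
Hypothesis satT : satisfies (@hecke_rels K q n) (@scalar_mx K N) T.
Local Notation H := (hecke q n).

Definition mxrep (x : H) : 'M[K]_N := plift (@scalar_mx K N) T x.

Lemma scalar_mx_central : central (@scalar_mx K N).
Proof. by move=> c x; rewrite -!mulmxE scalar_mxC. Qed.

Lemma mxrepM x y : mxrep (x * y) = mxrep x *m mxrep y.
Proof. by rewrite /mxrep (pliftM scalar_mx_central satT) mulmxE. Qed.
Lemma mxrep1 : mxrep 1 = 1%:M.
Proof. exact: plift1 scalar_mx_central satT. Qed.
Lemma mxrep_gen i : mxrep (Tgn q i) = T i.
Proof. exact: (plift_gen scalar_mx_central satT). Qed.
Lemma mxrep_is_linear : linear mxrep.
Proof.
move=> c x y; rewrite /mxrep (pliftD scalar_mx_central satT).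
by rewrite (pliftZ scalar_mx_central satT) -mulmxE mul_scalar_mx.
Qed.
HB.instance Definition _ :=
  GRing.isLinear.Build K H 'M[K]_N *:%R mxrep mxrep_is_linear.

End MatrixRep.

Lemma hecke_ind (K : fieldType) (q : K) n (P : hecke q n -> Prop) :
  (forall c, P (c *: 1)) -> (forall i, P (Tgn q i)) ->
  (forall x y, P x -> P y -> P (x + y)) ->
  (forall x y, P x -> P y -> P (x * y)) -> forall x, P x.
Proof. exact: pind. Qed.

Section HeckeRelations.
Variables (K : fieldType) (q : K) (n : nat).
Local Notation H := (hecke q n).
Local Notation T := (@Tgn K q n).

Lemma Tgn_quad i : T i * T i = (q - 1) *: T i + q *: 1.
Proof.
have := pgen_sat (Hquad q i); rewrite /= => ->.
by congr (_ + _); rewrite -pscalerAl mul1r.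
Qed.
Lemma Tgn_braid (i j : 'I_n.-1) : j = i.+1 :> nat -> T i * T j * T i = T j * T i * T j.
Proof. by move=> e; exact: (pgen_sat (Hbraid q e)). Qed.
Lemma Tgn_comm (i j : 'I_n.-1) : (i.+1 < j)%N -> T i * T j = T j * T i.
Proof. by move=> e; exact: (pgen_sat (Hcomm q e)). Qed.
End HeckeRelations.

(** * The regular representation and the trace form *)

Section RegularRep.
Variables (K : fieldType) (q : K) (n : nat).
Local Notation H := (hecke q n).
Local Notation T := (@Tgn K q n).
Local Notation s_ i := (tperm (pos0 i) (pos1 i) : 'S_n).

(** Left multiplication on the basis T_w: T_i T_w is T_(s_i w) at an ascent and (q-1) T_w + q T_(s_i
    w) at a descent, and the two cases are told apart by comparing adjacent values of w. *)
Definition reg_a (u v : 'I_n) : K := if (u < v)%N then 0 else q - 1.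
Definition reg_b (u v : 'I_n) : K := if (u < v)%N then 1 else q.
Definition reg_c (w : 'S_n) : {ffun 'I_n -> 'I_n} := [ffun k => w k].

Lemma reg_c_inj : injective reg_c.
Proof. by move=> u v /ffunP e; apply/perm.permP => k; have := e k; rewrite !ffunE. Qed.

Lemma reg_c_s (i : 'I_n.-1) w : reg_c (s_ i * w)%g = swapf i (reg_c w).
Proof. by apply/ffunP => k; rewrite !ffunE permM. Qed.

Definition regmat := @lmat K n 'S_n 'I_n reg_c reg_a reg_b.


Lemma reg_sat : satisfies (@hecke_rels K q n) (@scalar_mx K _) regmat.
Proof.
have cn (w : 'S_n) (x y : 'I_n) : x != y -> reg_c w x != reg_c w y.
  by move=> xy; rewrite !ffunE (inj_eq perm_inj).
apply: lmat_sat => [|w i _|w i|w i j e|u v d|u v d|u v w d1 d2 d3|u v w d1 d2 d3|u v w d1 d2 d3].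
- exact: reg_c_inj.
- by exists (s_ i * w)%g; exact: reg_c_s.
- exact/cn/pos0_neq_pos1.
- by apply: cn; apply/eqP => /(congr1 val) /= h; move: e; lia.
all: move: d || move: d1 d2 d3; rewrite -!val_eqE /reg_a /reg_b /=.
- by case: (ltngtP u v) => //= _ _; ring.
- by case: (ltngtP u v) => //= _ _; ring.
- by case: (ltngtP u v) => //= ?; case: (ltngtP v w) => //= ?; case: (ltngtP u w) => //= ? _ _ _; try lia; ring.
- by case: (ltngtP u v) => //= ?; case: (ltngtP v w) => //= ?; case: (ltngtP u w) => //= ? _ _ _; try lia; ring.
- by case: (ltngtP u v) => //= ?; case: (ltngtP v w) => //= ?; case: (ltngtP u w) => //= ? _ _ _; try lia; ring.
Qed.

Definition reg : H -> 'M[K]_#|{: 'S_n}| := mxrep regmat.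
HB.instance Definition _ := GRing.isLinear.Build K H _ *:%R reg (mxrep_is_linear reg_sat).
Lemma regM x y : reg (x * y) = reg x *m reg y. Proof. exact: (mxrepM reg_sat). Qed.
Lemma reg1 : reg 1 = 1%:M. Proof. exact: (mxrep1 reg_sat). Qed.

Definition evec (w : 'S_n) : 'cV[K]_#|{: 'S_n}| := delta_mx (enum_rank w) 0.

Lemma reg_T_evec i w : reg (T i) *m evec w =
  (if (w (pos0 i) < w (pos1 i))%N then 0 else q - 1) *: evec w +
  (if (w (pos0 i) < w (pos1 i))%N then 1 else q) *: evec (s_ i * w)%g.
Proof.
rewrite /reg (mxrep_gen reg_sat) /evec -!(lvecE K reg_c_inj) (lmat_lvec _ _ reg_c_inj).
  by rewrite -reg_c_s /reg_a /reg_b !ffunE.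
by exists w.
Qed.

Definition wT (s : seq 'I_n.-1) : H := \prod_(i <- s) T i.
Lemma wT_cons i s : wT (i :: s) = T i * wT s.
Proof. by rewrite /wT big_cons. Qed.
Lemma wT_cat s s' : wT (s ++ s') = wT s * wT s'.
Proof. by rewrite /wT big_cat. Qed.

Lemma reg_reduced (s : seq 'I_n.-1) : inv (word_perm s) = size s ->
  reg (wT s) *m evec 1 = evec (word_perm s).
Proof.
elim: s => [_|i s IH red].
  by rewrite /wT /word_perm !big_nil reg1 mul1mx.
have [red' asc] := reduced_cons red.
rewrite wT_cons regM -mulmxA IH // reg_T_evec asc scale0r add0r scale1r.
by rewrite word_perm_cons.
Qed.

Lemma reg_Tw w : reg (Tw q w) *m evec 1 = evec w.
Proof. by have [e1 e2] := redwordP w; rewrite -[in RHS]e1; apply: (@reg_reduced (redword w)); rewrite e1 e2. Qed.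

(* The form <v, w> = delta_{vw} q^{l(w)} makes every T_i self-adjoint. *)
Lemma reg_adjoint i :
  let Q : 'M[K]_#|{: 'S_n}| := diag_mx (\row_k q ^+ inv (enum_val k : 'S_n)) in
  (reg (T i))^T *m Q = Q *m reg (T i).
Proof.
move=> Q; have en (v w : 'S_n) : reg (T i) (enum_rank v) (enum_rank w) =
    (if (w (pos0 i) < w (pos1 i))%N then 0 else q - 1) * (v == w)%:R +
    (if (w (pos0 i) < w (pos1 i))%N then 1 else q) * (v == s_ i * w)%g%:R.
  have /matrixP/(_ (enum_rank v) 0) := reg_T_evec i w.
  by rewrite /evec -colE !mxE eqxx !andbT !(inj_eq enum_rank_inj).
apply: enum_mxP => v w; rewrite mul_mx_diag mul_diag_mx !mxE !enum_rankK !en.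
have [<-|nvw] := eqVneq w v; first by rewrite mulrC.
rewrite !mulr0 !add0r.
have [e|ne] := eqVneq w (s_ i * v)%g; last first.
  rewrite (_ : v == _ = false) ?mulr0 ?mul0r //; apply: contraNF ne => /eqP->.
  by rewrite mulgA -{1}[s_ i]tpermV mulVg mul1g.
have -> : v = (s_ i * w)%g by rewrite e mulgA -{1}[s_ i]tpermV mulVg mul1g.
rewrite eqxx !mulr1 !permM tpermL tpermR.
have [asc|desc] := boolP (w (pos0 i) < w (pos1 i))%N.
  rewrite ltnNge ltnW //= (inv_asc asc). by rewrite mulr1 exprS.
have {}desc := perm_asc_neq desc.
by rewrite desc (inv_desc desc) mul1r exprSr.
Qed.

Lemma reg_word_adjoint s :
  let Q : 'M[K]_#|{: 'S_n}| := diag_mx (\row_k q ^+ inv (enum_val k : 'S_n)) in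
  (reg (wT s))^T *m Q = Q *m reg (wT (rev s)).
Proof.
move=> Q; elim: s => [|i s IH]; first by rewrite /wT big_nil reg1 trmx1 mul1mx mulmx1.
rewrite wT_cons rev_cons -cats1 wT_cat !regM trmx_mul -mulmxA reg_adjoint mulmxA IH.
by rewrite -mulmxA /wT big_seq1.
Qed.

Definition tau (x : H) : K := reg x (enum_rank 1%g) (enum_rank 1%g).
Lemma tau_is_linear : linear (tau : H -> K^o).
Proof. by move=> c x y; rewrite /tau linearP !mxE. Qed.
HB.instance Definition _ := GRing.isLinear.Build K H K^o *%R tau tau_is_linear.

Lemma tauZ c x : tau (c *: x) = c * tau x.
Proof. by rewrite linearZ. Qed.
Lemma tau_sum I (s : seq I) P (F : I -> H) :
  tau (\sum_(i <- s | P i) F i) = \sum_(i <- s | P i) tau (F i).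
Proof. exact: (linear_sum (tau : {scalar H})). Qed.


(** Adjointness moves T_v to the other side as T_(v^-1), so that the trace of the product pairs the
    basis vectors of w and v^-1. *)
Lemma tau_TwTw v w : tau (Tw q v * Tw q w) = (w == v^-1)%g%:R * q ^+ inv v.
Proof.
have [e1 e2] := redwordP v; set s := redword v in e1 e2.
have red : inv (word_perm (rev s)) = size (rev s) by rewrite word_perm_rev size_rev e1 invV e2.
have h := reg_reduced red.
have /matrixP/(_ (enum_rank 1%g) (enum_rank w)) := reg_word_adjoint (rev s).
rewrite mul_mx_diag mul_diag_mx !mxE revK !enum_rankK inv1 expr0 mul1r.
move: h; rewrite {1}/evec -colE => /matrixP/(_ (enum_rank w) 0); rewrite !mxE => ->.
rewrite eqxx andbT (inj_eq enum_rank_inj) word_perm_rev e1 => h'.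
rewrite /tau regM.
have -> : (reg (Tw q v) *m reg (Tw q w)) (enum_rank 1%g) (enum_rank 1%g) =
    (reg (Tw q v) *m (reg (Tw q w) *m evec 1)) (enum_rank 1%g) 0.
  by rewrite mulmxA /evec -colE [RHS]mxE.
rewrite reg_Tw /evec -colE mxE -h'.
by have [->|//] := eqVneq w v^-1%g; rewrite ?invV ?mul0r.
Qed.

End RegularRep.

(** * Normal form words span the Hecke algebra *)

Section Span.
Variables (K : fieldType) (A : lmodType K).
Definition in_span (L : seq A) (x : A) : Prop :=
  exists c : nat -> K, x = \sum_(k < size L) c k *: L`_k.

Lemma in_span_mem L x : x \in L -> in_span L x.
Proof.
move=> xL; have lt : (index x L < size L)%N by rewrite index_mem.
exists (fun k => (k == index x L)%:R); rewrite (bigD1 (Ordinal lt)) //= eqxx scale1r.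
rewrite nth_index // big1 ?addr0 // => k; rewrite -val_eqE /= => /negPf->.
by rewrite scale0r.
Qed.
Lemma in_span0 L : in_span L 0.
Proof. by exists (fun=> 0); rewrite big1 // => k _; rewrite scale0r. Qed.
Lemma in_spanP L a x y : in_span L x -> in_span L y -> in_span L (a *: x + y).
Proof.
move=> [c ->] [d ->]; exists (fun k => a * c k + d k).
by rewrite scaler_sumr -big_split; apply: eq_bigr => k _; rewrite scalerDl scalerA.
Qed.
Lemma in_spanZ L a x : in_span L x -> in_span L (a *: x).
Proof. by move=> h; rewrite -[_ *: _]addr0; apply: in_spanP => //; exact: in_span0. Qed.
Lemma in_spanD L x y : in_span L x -> in_span L y -> in_span L (x + y).
Proof. by move=> h h'; rewrite -[x]scale1r; apply: in_spanP. Qed.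
End Span.

Lemma in_span_linear (K : fieldType) (A B : lmodType K) (L : seq A) (L' : seq B) (f : A -> B) x : linear f ->
  (forall y, y \in L -> in_span L' (f y)) -> in_span L x -> in_span L' (f x).
Proof.
move=> lf h [c ->]; pose g : {linear A -> B} := HB.pack f (GRing.isLinear.Build K A B _ f lf).
rewrite -[f _]/(g _) linear_sum; apply: (big_ind (in_span L')).
- exact: in_span0.
- by move=> *; exact: in_spanD.
- by move=> k _; rewrite linearZ; apply/in_spanZ/h/mem_nth.
Qed.

Section NormalForms.
Variables (K : fieldType) (q : K) (n : nat).
Local Notation H := (hecke q n).
Local Notation T := (@Tgn K q n).

(** An index out of range gives 1, so that words with letters in [nat] can be shifted and cut
    without carrying bounds. *)
Definition gT (i : nat) : H := oapp T 1 (insub i).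
Lemma gT_ord (i : 'I_n.-1) : gT i = T i.
Proof. by rewrite /gT valK. Qed.
Lemma gT_lt i (lt : (i < n.-1)%N) : gT i = T (Ordinal lt).
Proof. by rewrite -gT_ord. Qed.
Lemma gT_quad i : (i < n.-1)%N -> gT i * gT i = (q - 1) *: gT i + q *: 1.
Proof. by move=> lt; rewrite (gT_lt lt) Tgn_quad. Qed.
Lemma gT_braid i : (i.+1 < n.-1)%N ->
  gT i * gT i.+1 * gT i = gT i.+1 * gT i * gT i.+1.
Proof. by move=> lt; rewrite (gT_lt lt) (gT_lt (ltnW lt)) Tgn_braid. Qed.
Lemma gT_comm i j : (i.+1 < j)%N -> gT i * gT j = gT j * gT i.
Proof.
move=> ij; have [lt|ge] := ltnP j n.-1; last first.
  by rewrite {2 3}/gT insubF ?mul1r ?mulr1 // ltnNge ge.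
by rewrite (gT_lt lt) (gT_lt (ltn_trans (ltnW ij) lt)) Tgn_comm.
Qed.

Definition wN (s : seq nat) : H := \prod_(i <- s) gT i.
Lemma wN_cat s s' : wN (s ++ s') = wN s * wN s'.
Proof. by rewrite /wN big_cat. Qed.
Lemma wN_rcons s i : wN (rcons s i) = wN s * gT i.
Proof. by rewrite -cats1 wN_cat {2}/wN big_seq1. Qed.

(** The descending word m-1, m-2, ..., m-l. For l = 0, ..., m these are minimal representatives of
    the cosets of S_m in S_(m+1), which is why [Nw] has m! elements. *)
Fixpoint dw (m l : nat) : seq nat :=
  if l is l'.+1 then rcons (dw m l') (m - l'.+1)%N else [::].

Lemma dw_comm m l i : (l <= m)%N -> (i.+1 < m - l)%N ->
  wN (dw m l) * gT i = gT i * wN (dw m l).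
Proof.
elim: l => [|l IH] lm lt; first by rewrite /wN big_nil mul1r mulr1.
rewrite /= wN_rcons -mulrA -gT_comm // !mulrA IH //; lia.
Qed.

(** The letter i passes to the left up to the factor i, i-1. The braid relation turns i, i-1, i into
    i-1, i, i-1, and the first i-1 commutes with all larger letters in front of it. *)
Lemma dw_comm' m l i : (l <= m)%N -> (m - l < i)%N -> (i < m)%N -> (m <= n.-1)%N ->
  wN (dw m l) * gT i = gT i.-1 * wN (dw m l).
Proof.
elim: l => [|l IH] lm lt im mn; first by lia.
rewrite /= wN_rcons; have [e|ne] := eqVneq (m - l)%N i; last first.
  by rewrite -mulrA gT_comm ?mulrA ?IH //; lia.
case: l lm lt e IH => [|l] lm lt e _; first by lia.
have -> : (m - l.+2 = i.-1)%N by lia.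
rewrite /= wN_rcons e -{1 3}(prednK (n := i)); last by lia.
rewrite -!mulrA [gT _ * (gT i.-1 * _)]mulrA -gT_braid ?prednK //; try lia.
rewrite !mulrA dw_comm //; lia.
Qed.

Fixpoint Nw (m : nat) : seq (seq nat) :=
  if m is m'.+1 then [seq s ++ dw m' l | s <- Nw m', l <- iota 0 m'.+1] else [:: [::]].

Lemma size_Nw m : size (Nw m) = m`!.
Proof. elim: m => // m IH; rewrite factS mulnC -IH -[X in (_ * X)%N](size_iota 0 m.+1).
exact: (size_allpairs (fun s l => s ++ dw m l)). Qed.

(** The last letter m-l of the descending factor decides: i < m-l-1 passes through it unchanged, i =
    m-l-1 lengthens it, i = m-l calls for the quadratic relation, and i > m-l passes through as i-1.
    A letter that has passed through is absorbed by the induction hypothesis. *)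
Lemma span_mulr m i x : (m <= n)%N -> (i.+1 < m)%N ->
  in_span (map wN (Nw m)) x -> in_span (map wN (Nw m)) (x * gT i).
Proof.
elim: m i x => // m IH i x mn im.
apply: (in_span_linear (f := fun y => y * gT i)) => [c u v|y].
  by rewrite mulrDl scalerAl.
case/mapP => _ /allpairsP[[s l] /= [sN + ->]] ->.
rewrite -[0%N :: _]/(iota 0 m.+1) mem_iota add0n /= ltnS => lm.
have big l' t : t \in Nw m -> (l' <= m)%N -> in_span (map wN (Nw m.+1)) (wN t * wN (dw m l')).
  move=> tN l'm; rewrite -wN_cat; apply/in_span_mem/map_f/allpairsP.
  by exists (t, l'); rewrite mem_iota.
have left l' j : (j.+1 < m)%N -> (l' <= m)%N ->
    in_span (map wN (Nw m.+1)) (wN s * gT j * wN (dw m l')).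
  move=> jm l'm; apply: (in_span_linear (f := fun y => y * wN (dw m l'))) (IH j _ _ jm _).
  - by move=> c u v; rewrite mulrDl scalerAl.
  - by move=> _ /mapP[t tN ->]; exact: big.
  - exact: ltnW.
  - by apply/in_span_mem/map_f.
rewrite wN_cat -mulrA.
have [lt|] := ltnP i.+1 (m - l)%N.
  by rewrite dw_comm // mulrA; apply: left => //; lia.
rewrite leq_eqVlt => /orP[/eqP e|].
  have -> : i = (m - l.+1)%N by lia.
  by rewrite -wN_rcons -[rcons _ _]/(dw m l.+1); apply: big => //; lia.
rewrite ltnS leq_eqVlt => /orP[/eqP e|lt].
  case: l lm e => [|l] lm e; first by lia.
  rewrite /= e wN_rcons -mulrA gT_quad; last by lia.
  rewrite mulrDr -!scalerAr mulr1 -wN_rcons -e -[rcons _ _]/(dw m l.+1).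
  rewrite mulrDr -!scalerAr.
  by apply: in_spanD; apply: in_spanZ; apply: big => //; lia.
rewrite dw_comm' //; try lia.
by rewrite mulrA; apply: left => //; lia.
Qed.

Lemma hecke_span (x : H) : in_span (map wN (Nw n)) x.
Proof.
suff h : forall y, in_span (map wN (Nw n)) y -> in_span (map wN (Nw n)) (y * x).
  rewrite -[x]mul1r; apply: h; apply: in_span_mem.
  have -> : 1 = wN [::] by rewrite /wN big_nil.
  apply: map_f; elim: (n) => [|m IH] //.
  by apply/allpairsP; exists ([::], 0%N); rewrite mem_iota.
elim/hecke_ind: x => [c|i|x x' IH IH'|x x' IH IH'] y hy.
- by rewrite -scalerAr mulr1; exact: in_spanZ.
- by rewrite -gT_ord; apply: span_mulr => //; have := ltn_ord i; lia.
- by rewrite mulrDr; apply: in_spanD; [exact: IH|exact: IH'].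
- by rewrite mulrA; apply/IH'/IH.
Qed.

End NormalForms.

(** * The basis T_w and its dual basis *)

Section TwBasis.
Variables (K : fieldType) (q : K) (n : nat).
Hypothesis q0 : q != 0.
Local Notation H := (hecke q n).
Local Notation T := (@Tgn K q n).
Local Notation reg := (@reg K q n).
Local Notation tau := (@tau K q n).
Local Notation evec := (@evec K n).

(** There are n! normal form words, and applied to the vector of 1 they span a space containing the
    vectors of all T_w, hence of dimension n!. So their images are independent, and the coefficients
    of x in these words vanish. *)
Lemma reg_inj (x : H) : reg x *m evec 1 = 0 -> x = 0.
Proof.
pose L := map (@wN K q n) (Nw n).
pose F : 'M[K]_(size L, #|{: 'S_n}|) := \matrix_k (reg L`_k *m evec 1)^T.
have Fx (c : nat -> K) : (\row_(k < size L) c k) *m F =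
    (reg (\sum_(k < size L) c k *: L`_k) *m evec 1)^T.
  rewrite linear_sum mulmx_suml linear_sum; apply/rowP => j; rewrite [LHS]mxE summxE.
  apply: eq_bigr => k _; rewrite linearZ /= -scalemxAl linearZ /= [RHS]mxE.
  by congr (_ * _); rewrite mxE.
have [cw hw] := choice (fun w : 'S_n => hecke_span (Tw q w)).
have full : row_full F.
  apply/row_fullP; exists (\matrix_k \row_j cw (enum_val k) j).
  apply/row_matrixP => k; rewrite row_mul rowK Fx -hw reg_Tw // rowE mulmx1.
  by rewrite /evec trmx_delta enum_valK.
have free : row_free F.
  have e : size L = #|{: 'S_n}| by rewrite size_map size_Nw card_Sn.
  by apply/eqP; rewrite (eqP full) e.
have [c ->] := hecke_span x => h.
have : (\row_(k < size L) c k) *m F = 0 by rewrite Fx h trmx0.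
move/eqP; rewrite mulmx_free_eq0 // => /eqP/rowP c0.
by rewrite big1 // => k _; have := c0 k; rewrite !mxE => ->; rewrite scale0r.
Qed.

Lemma reg_inj2 (x y : H) : reg x *m evec 1 = reg y *m evec 1 -> x = y.
Proof.
by move=> e; apply/eqP; rewrite -subr_eq0; apply/eqP/reg_inj;
  rewrite linearB mulmxBl e subrr.
Qed.

Lemma Tw_expand (x : H) : x = \sum_w (reg x *m evec 1) (enum_rank w) 0 *: Tw q w.
Proof.
apply: reg_inj2; rewrite linear_sum mulmx_suml; apply/colP => k.
rewrite -[k]enum_valK summxE (bigD1 (enum_val k)) //= [X in _ + X]big1 => [|w nw].
  rewrite addr0 linearZ -scalemxAl reg_Tw //.
  by rewrite [RHS]mxE [X in _ * X]mxE !eqxx mulr1.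
rewrite linearZ -scalemxAl reg_Tw // [LHS]mxE [X in _ * X]mxE eqxx andbT.
by rewrite (inj_eq enum_rank_inj) eq_sym (negPf nw) mulr0.
Qed.

Lemma wT_reduced (s : seq 'I_n.-1) : inv (word_perm s) = size s ->
  @wT K q n s = Tw q (word_perm s).
Proof. by move=> red; apply: reg_inj2; rewrite reg_reduced // reg_Tw. Qed.

Lemma tau_reg (x : H) w :
  (reg x *m evec 1) (enum_rank w) 0 = q ^- inv w * tau (x * Tw q w^-1%g).
Proof.
rewrite [X in tau (X * _)]Tw_expand mulr_suml.
rewrite tau_sum (bigD1 w) //= big1 => [|v nv].
  rewrite addr0 -scalerAl tauZ tau_TwTw // eqxx mul1r mulrCA mulVf ?mulr1 //.
  exact: expf_neq0.
by rewrite -scalerAl tauZ tau_TwTw // (inj_eq invg_inj) eq_sym (negPf nv) mul0r mulr0.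
Qed.

Lemma tau_dual (x : H) : x = \sum_w (q ^- inv w * tau (x * Tw q w^-1%g)) *: Tw q w.
Proof. by rewrite {1}[x]Tw_expand; apply: eq_bigr => w _; rewrite tau_reg. Qed.

Lemma tau_nondeg (x : H) : (forall y, tau (x * y) = 0) -> x = 0.
Proof.
by move=> h; rewrite [x]tau_dual big1 // => w _; rewrite h mulr0 scale0r.
Qed.

Lemma tauM (x y : H) : tau (x * y) = \sum_w q ^+ inv w *
  ((reg x *m evec 1) (enum_rank w^-1%g) 0 * (reg y *m evec 1) (enum_rank w) 0).
Proof.
rewrite [X in tau (_ * X)]Tw_expand mulr_sumr tau_sum; apply: eq_bigr => w _.
rewrite -scalerAr tauZ (tau_reg x w^-1%g) invgK invV !mulrA mulfV ?mul1r 1?mulrC //.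
exact: expf_neq0.
Qed.

(** In the formula of [tauM], exchanging x and y amounts to replacing w by its inverse, which has
    the same length. *)
Lemma tauC (x y : H) : tau (x * y) = tau (y * x).
Proof.
rewrite !tauM (reindex_inj invg_inj); apply: eq_bigr => w _.
by rewrite invV invgK; congr (_ * _); rewrite mulrC.
Qed.

End TwBasis.

(** * Lattice words and q-Plancherel weights *)

Section LatticeWords.
Variable n : nat.
Implicit Types (y : {ffun 'I_n -> 'I_n}) (i : 'I_n.-1).

(* A standard tableau is encoded by its lattice word: y k is the row of the entry k. *)
Definition cnt y (m r : nat) : nat := (\sum_(k < n) ((k < m) && (y k == r :> nat)))%N.
Definition lattice y : bool :=
  [forall m : 'I_n.+1, forall r : 'I_n, cnt y m r.+1 <= cnt y m r]%N.
Definition cont y : {ffun 'I_n -> int} := [ffun k : 'I_n => (cnt y k (y k))%:Z - (y k)%:Z].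

Lemma cnt0 y r : cnt y 0 r = 0%N.
Proof. by rewrite /cnt big1. Qed.
Lemma cntS y (k : 'I_n) r : cnt y k.+1 r = (cnt y k r + (y k == r :> nat))%N.
Proof.
rewrite /cnt (bigD1 k) //= ltnSn [X in _ = (X + _)%N](bigD1 k) //= ltnn add0n addnC.
congr (_ + _)%N; apply: eq_bigr => j; rewrite -val_eqE /= => nj.
by rewrite ltnS leq_eqVlt (negPf nj).
Qed.
Lemma cnt_ge y m r : (n <= m)%N -> cnt y m r = cnt y n r.
Proof.
move=> le; apply: eq_bigr => k _; rewrite ltn_ord.
by rewrite (leq_trans (ltn_ord k)).
Qed.
Lemma cnt_row_ge y m r : (n <= r)%N -> cnt y m r = 0%N.
Proof.
move=> le; apply: big1 => k _; rewrite [_ == r]negbTE ?andbF //.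
by rewrite neq_ltn (leq_trans (ltn_ord _)).
Qed.

Lemma latticeP y : reflect (forall m r, cnt y m r.+1 <= cnt y m r)%N (lattice y).
Proof.
apply: (iffP forallP) => [h m r|h m]; last by apply/forallP => r.
have [rn|rn] := ltnP r n; last by rewrite cnt_row_ge // ltnW.
have [mn|mn] := ltnP m n.+1; first by have /forallP/(_ (Ordinal rn)) := h (Ordinal mn).
rewrite !(@cnt_ge _ m) ?(ltnW mn) //.
by have /forallP/(_ (Ordinal rn)) := h ord_max.
Qed.

Lemma cnt_anti y m r r' : (forall s, cnt y m s.+1 <= cnt y m s)%N ->
  (r <= r')%N -> (cnt y m r' <= cnt y m r)%N.
Proof.
move=> lat; elim: r' => [|r' IH]; first by case: r.
rewrite leq_eqVlt => /orP[/eqP->//|]; rewrite ltnS => /IH.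
exact: leq_trans.
Qed.

Lemma cnt_swap y i m r : m != i.+1 -> cnt (swapf i y) m r = cnt y m r.
Proof.
move=> ne; rewrite /cnt (reindex_inj (@perm_inj _ (tperm (pos0 i) (pos1 i)))) /=.
apply: eq_bigr => k _; rewrite ffunE tpermK; congr (nat_of_bool (_ && _)).
rewrite stperm_val; move: ne (nat_of_ord k) => ne x.
by case: (x =P i) => ?; case: (x =P i.+1) => ?; lia.
Qed.

Section AtPosition.
Variables (y : {ffun 'I_n -> 'I_n}) (i : 'I_n.-1).
Local Notation a := (nat_of_ord (y (pos0 i))).
Local Notation b := (nat_of_ord (y (pos1 i))).
Local Notation mu := (cnt y i).

Lemma cnt_pos1 r : cnt y i.+1 r = (mu r + (a == r))%N.
Proof. exact: (cntS y (pos0 i)). Qed.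
Lemma cnt_pos2 r : cnt y i.+2 r = (mu r + (a == r) + (b == r))%N.
Proof. by rewrite -cnt_pos1; exact: (cntS y (pos1 i)). Qed.
Lemma cont_pos0 : cont y (pos0 i) = (mu a)%:Z - a%:Z.
Proof. by rewrite ffunE. Qed.
Lemma cont_pos1 : cont y (pos1 i) = (mu b + (a == b))%N%:Z - b%:Z.
Proof. by rewrite ffunE -cnt_pos1. Qed.

Lemma cont_swap : a != b -> cont (swapf i y) = swapf i (cont y).
Proof.
move=> ab; apply/ffunP => k; have [->|k0] := eqVneq k (pos0 i).
  rewrite swapf0 cont_pos1 ffunE swapf0 cnt_swap ?(negPf ab) ?addn0 //=.
  by rewrite neq_ltn ltnSn.
have [->|k1] := eqVneq k (pos1 i).
  rewrite swapf1 cont_pos0 ffunE swapf1 /= -[i.+1]/(pos0 i).+1 cntS swapf0.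
  by rewrite cnt_swap /= ?neq_ltn ?ltnSn // eq_sym (negPf ab) addn0.
by rewrite [RHS]swapfD // /cont [LHS]ffunE [RHS]ffunE swapfD // cnt_swap.
Qed.

Hypothesis lat : lattice y.

Lemma cont_dist1 : cont y (pos0 i) != cont y (pos1 i).
Proof.
rewrite cont_pos0 cont_pos1; apply/eqP => e.
have [ab|ab|ab] := ltngtP a b; last by rewrite ab eqxx in e; lia.
- by have := cnt_anti (latticeP _ lat i) (ltnW ab); rewrite ltn_eqF // in e; lia.
- by have := cnt_anti (latticeP _ lat i) (ltnW ab); rewrite gtn_eqF // in e; lia.
Qed.

Lemma nonadj_neq : `|cont y (pos0 i) - cont y (pos1 i)|%N != 1%N -> a != b.
Proof.
rewrite cont_pos0 cont_pos1; apply: contraNneq => e; rewrite e eqxx; lia.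
Qed.

Lemma lattice_swap : `|cont y (pos0 i) - cont y (pos1 i)|%N != 1%N ->
  lattice (swapf i y).
Proof.
move=> nadj; have ab := nonadj_neq nadj.
apply/latticeP => m r; have [->|ne] := eqVneq m i.+1; last first.
  by rewrite !cnt_swap //; exact/latticeP.
rewrite -[i.+1]/(pos0 i).+1 !cntS swapf0 !cnt_swap /= ?neq_ltn ?ltnSn //.
have h0 := (latticeP _ lat) i r; have h2 := (latticeP _ lat) i.+2 r.
rewrite !cnt_pos2 in h2; move: nadj; rewrite cont_pos0 cont_pos1 (negPf ab) addn0.
have [e1|n1] := eqVneq b r.+1; last by rewrite addn0; lia.
have rr : (r.+1 == r) = false by lia.
rewrite e1 rr eqxx in h2 *.
case: (a =P r) h2 => [ar|_] /= h2; last by lia.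
rewrite ar; lia.
Qed.

(** An entry in a higher row than its predecessor lies to the right of it. If the rows are
    neighbours, the lattice condition after the entry [pos0 i] excludes the box directly above, so
    the gap between the contents is at least 2 in every case. *)
Lemma desc_nonadj : (b < a)%N -> cont y (pos0 i) - cont y (pos1 i) < -1.
Proof.
move=> ba; rewrite cont_pos0 cont_pos1 gtn_eqF // addn0.
have h0 := cnt_anti (latticeP _ lat i) (ltnW ba).
have [h|h] := ltnP (b.+1) a; first by lia.
have e : a = b.+1 by lia.
have := (latticeP _ lat) i.+1 b; rewrite !cnt_pos1 -e eqxx gtn_eqF // addn0; lia.
Qed.
End AtPosition.

(** The next box on the diagonal of (r, c) is (r+1, c+1), and both (r, c+1) and (r+1, c) have to be
    filled before it; one entry in between is not enough. *)
Lemma cont_dist2 y (i j : 'I_n.-1) : lattice y -> j = i.+1 :> nat ->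
  cont y (pos0 i) != cont y (pos1 j).
Proof.
move=> lat e; have ej := pos_next e.
rewrite cont_pos0 cont_pos1 e cnt_pos1 ej.
set a := nat_of_ord (y (pos0 i)); set b := nat_of_ord (y (pos1 i)).
set d := nat_of_ord (y (pos1 j)); apply/eqP => h.
have h3 r := (latticeP _ lat) j.+2 r.
have c3 r : cnt y j.+2 r = (cnt y i r + (a == r) + (b == r) + (d == r))%N.
  by rewrite cnt_pos2 e cnt_pos1 ej.
have [ad|da|ad] := ltngtP a d.
- have := cnt_anti (latticeP _ lat i) (ltnW ad); rewrite (ltn_eqF ad) in h => le.
  have bd : b = d by apply/eqP; apply: contraTT isT => /negPf nb; rewrite nb in h; lia.
  have ead : d = a.+1 by rewrite bd eqxx in h; lia.
  by have := h3 a; rewrite !c3 -ead bd !eqxx (ltn_eqF ad) (gtn_eqF ad); lia.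
- have := cnt_anti (latticeP _ lat i) (ltnW da); rewrite (gtn_eqF da) in h; lia.
- rewrite ad eqxx in h; lia.
Qed.

(** The boxes that can be added to a given shape lie on different diagonals, so the contents
    determine the rows one entry after the other. *)
Lemma cont_inj y y' : lattice y -> lattice y' -> cont y = cont y' -> y = y'.
Proof.
move=> lat lat' /ffunP e.
have main m : (m <= n)%N -> forall k : 'I_n, (k < m)%N -> y k = y' k.
  elim: m => [|m IH] // mn k; rewrite ltnS leq_eqVlt => /orP[/eqP km|]; last first.
    by apply: IH; exact: ltnW.
  have ec r : cnt y k r = cnt y' k r.
    apply: eq_bigr => j _; case: ltnP => //= jk; rewrite IH ?(ltnW mn) // -km.
    exact: jk.
  apply: val_inj => /=; have := e k; rewrite !ffunE ec.
  have [lt|gt|//] := ltngtP (y k) (y' k) => h.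
    by have := cnt_anti (latticeP _ lat' k) (ltnW lt); lia.
  by have := cnt_anti (latticeP _ lat' k) (ltnW gt); lia.
by apply/ffunP => k; exact: (main n).
Qed.

Lemma sum_cnt y m : (m <= n)%N -> (\sum_(r < n) cnt y m r)%N = m.
Proof.
move=> mn; rewrite exchange_big /=.
under eq_bigr => k _.
  rewrite (bigD1 (y k)) //= eqxx andbT big1 ?addn0; last first.
    by move=> r nr; rewrite (_ : (y k == r :> nat) = false) ?andbF //; apply/negbTE; rewrite eq_sym.
  over.
rewrite -[RHS](card_ord m) -sum1_card [RHS](big_ord_widen n (fun=> 1%N) mn) [RHS]big_mkcond.
by apply: eq_bigr => k _; case: ltnP.
Qed.

Lemma cnt_pos_row y m r : (forall s, cnt y m s.+1 <= cnt y m s)%N -> (m <= n)%N ->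
  (0 < cnt y m r)%N -> (r < m)%N.
Proof.
move=> lat mn pos; have rn : (r < n)%N.
  by rewrite ltnNge; apply: contraTN pos => /cnt_row_ge->.
rewrite -[X in (_ < X)%N](sum_cnt y mn) -[r.+1]card_ord -sum1_card.
rewrite (big_ord_widen n (fun=> 1%N) rn) [leqRHS](bigID (fun k : 'I_n => (k < r.+1)%N)) /=.
apply: leq_trans (leq_addr _ _); apply: leq_sum => k; rewrite ltnS => kr.
exact: leq_trans (cnt_anti lat kr).
Qed.

(** This guarantees that the range of k in the product defining E_t meets the content of every other
    tableau, so that some factor separates the two. *)
Lemma cont_bound y (k : 'I_n) : lattice y -> - k%:Z <= cont y k <= k%:Z.
Proof.
move=> lat; rewrite ffunE; have kn := ltnW (ltn_ord k).
have h1 : (cnt y k (y k) <= k)%N.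
  by rewrite -[leqRHS](sum_cnt y kn) (bigD1 (y k)) //= leq_addr.
have h2 : (y k < k.+1)%N.
  by apply: (cnt_pos_row (latticeP _ lat k.+1)) => //; rewrite cntS eqxx addn1.
lia.
Qed.

End LatticeWords.

(** The sum is the coefficient of X^(N-1) in the interpolation polynomial of p at the N nodes, and
    that polynomial is p itself. *)
Lemma sum_lagrange (F : fieldType) N (x : 'I_N -> F) (p : {poly F}) :
  injective x -> (size p < N)%N ->
  \sum_i p.[x i] / \prod_(j | j != i) (x i - x j) = 0.
Proof.
move=> xi; case: N x xi => // N x xi; rewrite ltnS => sp.
pose L i := \prod_(j < N.+1 | j != i) ('X - (x j)%:P).
pose P := \sum_i (p.[x i] / \prod_(j | j != i) (x i - x j)) *: L i.
have sL i : size (L i) = N.+1.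
  rewrite /L -big_filter size_prod_XsubC size_filter; congr _.+1.
  by have := cardC1 i; rewrite card_ord -sum1_card sum1_count.
have cL i : (L i)`_N = 1.
  have : L i \is monic by exact: monic_prod_XsubC.
  by rewrite monicE lead_coefE sL => /eqP.
have PE : P = p.
  apply/eqP; rewrite -subr_eq0; apply/eqP.
  apply: (@roots_geq_poly_eq0 _ _ (map x (enum 'I_N.+1))).
  - apply/allP => _ /mapP[k _ ->]; rewrite rootE hornerD hornerN horner_sum (bigD1 k) //=.
    rewrite [X in _ + X - _]big1 => [|i ik]; last first.
      by rewrite hornerZ /L horner_prod [X in _ * X](bigD1 k) 1?eq_sym //= hornerXsubC subrr mul0r mulr0.
    rewrite addr0 hornerZ /L horner_prod.
    under [X in _ * X]eq_bigr => j _ do rewrite hornerXsubC.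
    rewrite mulfVK ?subrr //; apply/prodf_neq0 => j jk.
    by rewrite subr_eq0 (inj_eq xi) eq_sym.
  - by rewrite map_inj_uniq // enum_uniq.
  - rewrite size_map -cardE card_ord; apply: leq_trans (size_polyD _ _) _.
    rewrite geq_max size_polyN (leq_trans sp) // andbT.
    apply: leq_trans (size_sum _ _ _) _; apply/bigmax_leqP => i _.
    by apply: leq_trans (size_scale_leq _ _) _; rewrite sL.
have : P`_N = 0 by rewrite PE nth_default.
rewrite coef_sum => h0; rewrite -[RHS]h0; apply: eq_bigr => i _.
by rewrite coefZ cL mulr1.
Qed.

(** * Interpolation identities for the transition probabilities *)

Section RowWeights.
Variables (K : fieldType) (q : K) (n : nat).
Hypothesis q1 : q != 1.

(** The transition probability of q-Plancherel growth: for x_i = q^(lam_i + n - 1 - i) it is the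
    quotient of the hook weights of lam with a box added in row i and of lam, see [kap_addbox]. *)
Definition rowwt N (x : 'I_N -> K) (i : 'I_N) : K :=
  \prod_(j | j != i) ((q * x i - x j) / (x i - x j)) * ((q - 1) / (q * x i - 1)).

Variable x : 'I_n.+1 -> K.
Hypotheses (x_inj : injective x) (x0 : forall i, x i != 0) (x_max : x ord_max = 1).
Hypothesis qx1 : forall i, q * x i != 1.

Definition rowpoly (P : pred 'I_n.+1) : {poly K} :=
  \prod_(j | P j) (q *: 'X - (x j)%:P).
Lemma rowpolyE P y : (rowpoly P).[y] = \prod_(j | P j) (q * y - x j).
Proof. by rewrite horner_prod; apply: eq_bigr => j _; rewrite !hornerE. Qed.
Lemma size_rowpoly P : (size (rowpoly P) <= #|P|.+1)%N.
Proof.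
rewrite /rowpoly -sum1_card; elim/big_rec2: _ => [|j p m _ IH].
  by rewrite size_poly1.
have h : (size (q *: 'X - (x j)%:P)%R <= 2)%N.
  apply: leq_trans (size_polyD _ _) _.
  rewrite geq_max size_polyN (leq_trans (size_polyC_leq1 _)) // andbT.
  by apply: leq_trans (size_scale_leq _ _) _; rewrite size_polyX.
by apply: leq_trans (size_polyMleq _ _) _; lia.
Qed.

Lemma diff_neq0 i : \prod_(j | j != i) (x i - x j) != 0.
Proof. by apply/prodf_neq0 => j ji; rewrite subr_eq0 (inj_eq x_inj) eq_sym. Qed.

(** The factor (q-1) x_i completes the numerator to a product over all j. There the factor of
    [ord_max], whose node is 1, cancels q x_i - 1. *)
Lemma rowwt_E i : rowwt x i * x i =
  (rowpoly (fun j => j != ord_max)).[x i] / \prod_(j | j != i) (x i - x j).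
Proof.
rewrite /rowwt prodf_div -!mulrA; set A := \prod_(j | _) _; set B := \prod_(j | _) _.
have h : A * ((q - 1) * x i) = (q * x i - 1) * (rowpoly (fun j => j != ord_max)).[x i].
  transitivity (\prod_j (q * x i - x j)).
    by rewrite [RHS](bigD1 i) //= mulrC; congr (_ * _); ring.
  by rewrite (bigD1 ord_max) //= x_max rowpolyE.
have d1 : q * x i - 1 != 0 by rewrite subr_eq0.
have d2 := diff_neq0 i; rewrite -/B in d2.
apply: (mulfI d1); rewrite [in RHS]mulrA -h; field.
by rewrite d1 d2.
Qed.

(** An extra node at 0 supplies the factor 1/x_i that [rowwt_E] lacks, and its own term in
    [sum_lagrange] is -1. *)
Lemma sum_rowwt : \sum_i rowwt x i = 1.
Proof.
pose y (i : 'I_n.+2) := if unlift ord0 i is Some j then x j else 0.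
have y0 : y ord0 = 0 by rewrite /y unlift_none.
have yl j : y (lift ord0 j) = x j by rewrite /y liftK.
have y_inj : injective y.
  move=> i j; case: (unliftP ord0 i) => [i'|] ->; case: (unliftP ord0 j) => [j'|] ->;
    rewrite ?y0 ?yl //; first by move/x_inj->.
    by move/eqP; rewrite (negPf (x0 _)).
  by move/eqP; rewrite eq_sym (negPf (x0 _)).
have sz : (size (rowpoly (fun j => j != ord_max)) < n.+2)%N.
  apply: leq_ltn_trans (size_rowpoly _) _; rewrite !ltnS.
  have := cardC1 (ord_max : 'I_n.+1); rewrite card_ord /= => e.
  by rewrite -[leqRHS]e; apply/eq_leq/eq_card => j.
have := sum_lagrange y_inj sz; rewrite big_ord_recl.
have -> : \prod_(j | j != ord0) (y ord0 - y j) = \prod_j (- x j).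
  rewrite big_mkcond big_ord_recl eqxx /= mul1r; apply: eq_bigr => j _.
  by rewrite y0 yl sub0r.
have dl i : \prod_(j | j != lift ord0 i) (y (lift ord0 i) - y j) =
            x i * \prod_(j | j != i) (x i - x j).
  rewrite big_mkcond big_ord_recl /= y0 yl subr0; congr (_ * _).
  rewrite [RHS]big_mkcond; apply: eq_bigr => j _.
  by rewrite (inj_eq lift_inj) yl.
rewrite y0 rowpolyE.
under eq_bigr => j _ do rewrite mulr0 sub0r.
rewrite [X in _ / X](bigD1 ord_max) //= x_max.
set g0 := \prod_(j | _) _.
have g00 : g0 != 0 by apply/prodf_neq0 => j _; rewrite oppr_eq0.
have -> : g0 / (-1 * g0) = -1 by rewrite mulN1r invrN mulrN mulfV.
move/eqP; rewrite addrC subr_eq0 => /eqP <-; apply: eq_bigr => i _.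
apply: (mulIf (x0 i)); rewrite rowwt_E dl yl; field.
by rewrite x0 diff_neq0.
Qed.

(** The denominator q x_i - x_r cancels one more factor of the numerator, whose degree then is small
    enough for the n + 1 nodes alone. *)
Lemma sum_rowwt_alpha r : r != ord_max -> (forall i, q * x i != x r) ->
  \sum_i rowwt x i * (q * x i / (q * x i - x r)) = 0.
Proof.
move=> rmax qxr.
have sz : (size (rowpoly (fun j => (j != ord_max) && (j != r))) < n.+1)%N.
  apply: leq_ltn_trans (size_rowpoly _) _; rewrite ltnS.
  have := cardC1 (ord_max : 'I_n.+1); rewrite card_ord (cardD1 r) inE /= rmax add1n => e.
  by rewrite -[leqRHS]e ltnS; apply/eq_leq/eq_card => j; rewrite !inE andbC.
have h := sum_lagrange x_inj sz; rewrite -[RHS](mulr0 q) -[in RHS]h mulr_sumr.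
apply: eq_bigr => i _.
have d : q * x i - x r != 0 by rewrite subr_eq0.
transitivity (rowwt x i * x i * (q / (q * x i - x r))); first by field.
rewrite rowwt_E !rowpolyE (bigD1 r) //=; field.
by rewrite d diff_neq0.
Qed.
End RowWeights.

(** * Hook lengths and the weight of a shape *)

Section HookWeights.
Variables (K : fieldType) (q : K) (n : nat).
Hypothesis q0 : q != 0.
Hypothesis qr : forall m, (0 < m)%N -> q ^+ m != 1.

Definition qn (m : nat) : K := (q ^+ m - 1) / (q - 1).
Definition qf (m : nat) : K := \prod_(k < m) qn k.+1.

Lemma q_neq1 : q != 1. Proof. by have := @qr 1 isT; rewrite expr1. Qed.
Lemma qn_neq0 m : (0 < m)%N -> qn m != 0.
Proof.
by move=> m0; rewrite /qn mulf_neq0 // ?invr_eq0 subr_eq0 ?qr // q_neq1.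
Qed.
Lemma qf_neq0 m : qf m != 0.
Proof. by apply/prodf_neq0 => k _; exact: qn_neq0. Qed.
Lemma qfS m : qf m.+1 = qf m * qn m.+1.
Proof. by rewrite /qf big_ord_recr. Qed.

Implicit Types lam : nat -> nat.
Definition shifted lam (i : nat) : nat := (lam i + (n - i.+1))%N.
(** One row of Frobenius' form of the hook product, in terms of the shifted parts lam_a + n - 1 - a.
    Unlike the product over hooks, it changes in few and explicit factors when a box is added. *)
Definition rowh lam (a : nat) : K := q ^+ (a * lam a) *
  (\prod_(j < n | (a < j)%N) qn (shifted lam a - shifted lam j)) / qf (shifted lam a).
Definition kap lam : K := \prod_(a < n) rowh lam a.

Definition is_part lam : Prop := (forall r, lam r.+1 <= lam r)%N /\ lam n = 0%N.
Definition addbox lam (i r : nat) : nat := (lam r + (i == r))%N.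
Definition rowx lam (i : 'I_n) : K := q ^+ shifted lam i.

Lemma part_anti lam r r' : is_part lam -> (r <= r')%N -> (lam r' <= lam r)%N.
Proof.
move=> [h _]; elim: r' => [|r' IH]; first by case: r.
rewrite leq_eqVlt => /orP[/eqP->//|]; rewrite ltnS => /IH; exact: leq_trans.
Qed.

Lemma shifted_lt lam (a b : nat) : is_part lam -> (a < b)%N -> (b < n)%N ->
  (shifted lam b < shifted lam a)%N.
Proof. by move=> p ab bn; have := part_anti p (ltnW ab); rewrite /shifted; lia. Qed.

Lemma qexp_inj : injective (fun m : nat => q ^+ m).
Proof.
have h (a b : nat) : (a < b)%N -> q ^+ a <> q ^+ b.
  move=> ab e; have /eqP[] := @qr (b - a)%N (ltac:(lia)).
  apply: (mulfI (expf_neq0 a q0)); rewrite mulr1 -exprD subnKC //.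
  exact: ltnW.
move=> a b /= e; case: (ltngtP a b) => // [/h|/h] //.
by move/esym: e.
Qed.

Lemma rowx_inj lam : is_part lam -> injective (rowx lam).
Proof.
move=> p a b /qexp_inj e; apply: val_inj => /=; case: (ltngtP a b) => // ab.
  by have := shifted_lt p ab (ltn_ord b); rewrite e ltnn.
by have := shifted_lt p ab (ltn_ord a); rewrite e ltnn.
Qed.

Lemma qnB (a b : nat) : (b <= a)%N -> qn (a - b) = (q ^+ a - q ^+ b) / (q ^+ b * (q - 1)).
Proof.
move=> ba; rewrite /qn invfM mulrA; congr (_ / _).
rewrite -{2}(subnK ba) exprD -{2}[q ^+ b]mul1r -mulrBl mulfK //.
exact: expf_neq0.
Qed.

(** Only the factors involving the shifted part of row i change. Each of the i rows above
    contributes an additional q^-1, and together these cancel the q^i gained by the power q^(i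
    lam_i). *)
Lemma kap_addbox lam (i : 'I_n) : is_part lam -> is_part (addbox lam i) ->
  kap (addbox lam i) = kap lam * rowwt q (rowx lam) i.
Proof.
move=> p p'; pose x := rowx lam.
have q1 : q - 1 != 0 by rewrite subr_eq0 q_neq1.
have xE a : x a = q ^+ shifted lam a by [].
have x0 a : x a != 0 by rewrite expf_neq0.
have sh (a : 'I_n) : a != i -> shifted (addbox lam i) a = shifted lam a.
  by move=> ai; rewrite /shifted /addbox (_ : (i == a :> nat) = false) ?addn0 //;
    apply/negbTE; rewrite eq_sym.
have shi : shifted (addbox lam i) i = (shifted lam i).+1.
  by rewrite /shifted /addbox eqxx addn1.
have lamne (a : 'I_n) : a != i -> addbox lam i a = lam a.
  by move=> ai; rewrite /addbox (_ : (i == a :> nat) = false) ?addn0 //;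
    apply/negbTE; rewrite eq_sym.
have d (j : 'I_n) : j != i -> x i - x j != 0.
  by move=> ji; rewrite subr_eq0 (inj_eq (rowx_inj p)) eq_sym.
pose rho (a : 'I_n) : K := if (a < i)%N then ((q * x i - x a) / (x i - x a)) / q
  else if a == i then q ^+ i * \prod_(j < n | (i < j)%N) ((q * x i - x j) / (x i - x j)) *
    ((q - 1) / (q * x i - 1)) else 1.
have row (a : 'I_n) : rowh (addbox lam i) a = rowh lam a * rho a.
  rewrite /rho; case: (ltngtP a i) => [ai|ia|ai].
  - have ne : a != i by rewrite -val_eqE /= ltn_eqF.
    rewrite /rowh sh // lamne // [in LHS](bigD1 i) //= [in RHS](bigD1 i) //= shi.
    have -> : \prod_(j < n | (a < j)%N && (j != i)) qn (shifted lam a - shifted (addbox lam i) j) =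
              \prod_(j < n | (a < j)%N && (j != i)) qn (shifted lam a - shifted lam j).
      by apply: eq_bigr => j /andP[_ ji]; rewrite sh.
    have lt := shifted_lt p ai (ltn_ord i).
    rewrite !qnB ?(ltnW lt) // exprS -!xE.
    have := d _ ne => dd.
    have dd' : x a - x i != 0 by rewrite -oppr_eq0 opprB.
    move: (\prod_(j < n | _) _) (qf_neq0 (shifted lam a)) => A B; field.
    by rewrite ?dd ?dd' ?q1 ?q0 ?x0 ?B.
  - have ne : a != i by rewrite -val_eqE /= gtn_eqF.
    rewrite (negPf ne) mulr1 /rowh sh // lamne //; congr (_ * _ / _).
    by apply: eq_bigr => j aj; rewrite sh // -val_eqE /= gtn_eqF // (ltn_trans ia).
  - have -> : a = i by exact: val_inj.
    rewrite eqxx /rowh shi qfS /addbox eqxx addn1 mulnS exprD.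
    have -> : \prod_(j < n | (i < j)%N) qn ((shifted lam i).+1 - shifted (addbox lam i) j) =
       (\prod_(j < n | (i < j)%N) qn (shifted lam i - shifted lam j)) *
       \prod_(j < n | (i < j)%N) ((q * x i - x j) / (x i - x j)).
      rewrite -big_split; apply: eq_bigr => j ij.
      have ne : j != i by rewrite -val_eqE /= gtn_eqF.
      have lt := shifted_lt p ij (ltn_ord j).
      rewrite sh // !qnB ?(ltnW lt) //; last by rewrite ltnW // ltnS ltnW.
      rewrite exprS -!xE; have := d _ ne => dd /=; field.
      by rewrite ?dd ?q1 ?x0.
    have -> : qn (shifted lam i).+1 = (q * x i - 1) / (q - 1) by rewrite /qn exprS -xE.
    have qx1 : q * x i - 1 != 0 by rewrite xE -exprS subr_eq0 qr.
    move: (\prod_(j < n | _) _) (\prod_(j < n | _) _) (qf_neq0 (shifted lam i)) => A C B.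
    field.
    by rewrite ?qx1 ?q1 ?B.
rewrite /kap (eq_bigr _ (fun a _ => row a)) big_split /=; congr (_ * _).
have lt_split (F : 'I_n -> K) :
    \prod_(j < n | j != i) F j = \prod_(j < n | (j < i)%N) F j * \prod_(j < n | (i < j)%N) F j.
  rewrite (bigID (fun j : 'I_n => (j < i)%N)) /=; congr (_ * _); apply: eq_bigl => j;
    by rewrite -val_eqE /=; case: ltngtP.
have e2 : \prod_(a < n | (i < a)%N) rho a = 1.
  by apply: big1 => a ia; rewrite /rho ltnNge ltnW //= gt_eqF.
have e1 : \prod_(a < n | (a < i)%N) rho a =
    \prod_(a < n | (a < i)%N) ((q * x i - x a) / (x i - x a)) / q ^+ i.
  rewrite (eq_bigr (fun a => ((q * x i - x a) / (x i - x a)) * q^-1)); last first.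
    by move=> a ai; rewrite /rho ai.
  rewrite big_split /= prodr_const -exprVn; congr (_ * _ ^+ _).
  rewrite -sum1_card -[RHS](card_ord i) -sum1_card.
  by rewrite [RHS](big_ord_widen n (fun=> 1%N) (ltnW (ltn_ord i))).
have qi0 : q ^+ i != 0 by rewrite expf_neq0.
rewrite /rowwt (bigD1 i) //= !lt_split e1 e2 /rho ltnn eqxx mulr1 -/x.
move: (\prod_(j < n | _) _) (\prod_(j < n | _) _) ((q - 1) / _) => A B C; field.
by [].
Qed.

Definition col lam (j : nat) : nat := (\sum_(i < n) (j < lam i))%N.

Lemma col_block lam (k j : nat) : is_part lam -> (k < n)%N ->
  (lam k.+1 <= j < lam k)%N -> col lam j = k.+1.
Proof.
move=> p kn /andP[h1 h2]; rewrite -[RHS](card_ord k.+1) -sum1_card.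
rewrite (big_ord_widen n (fun=> 1%N) kn) [RHS]big_mkcond; apply: eq_bigr => i _.
have [ik|ki] := ltnP i k.+1.
  by rewrite (leq_trans h2) // (part_anti p).
by rewrite ltnNge (leq_trans _ h1) // (part_anti p).
Qed.

Lemma prod_qn_range (c u v : nat) : (u <= v)%N -> (v <= c)%N ->
  (\prod_(u <= j < v) qn (c - j)) * qf (c - v) = qf (c - u).
Proof.
elim: v => [|v IH] uv vc.
  by move: uv; rewrite leqn0 => /eqP->; rewrite big_geq // mul1r.
move: uv; rewrite leq_eqVlt => /orP[/eqP->|uv].
  by rewrite big_geq // mul1r.
rewrite big_nat_recr //= -IH ?(ltnW vc) // -mulrA; congr (_ * _).
by rewrite (_ : c - v = (c - v.+1).+1)%N ?qfS 1?mulrC //; lia.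
Qed.

(* Columns are grouped by their length, so that the hook lengths of a row run
   through intervals and the product telescopes. *)
Lemma prod_hooks lam (a k : nat) : is_part lam -> (a < n)%N -> (a < k <= n)%N ->
  (\prod_(lam k <= j < lam a) qn ((lam a - j.+1) + (col lam j - a.+1)).+1) *
  \prod_(a.+1 <= b < k) qn (shifted lam a - shifted lam b) = qf (lam a - lam k + (k - a)).-1.
Proof.
move=> p an.
have block m : (a <= m < n)%N ->
   (\prod_(lam m.+1 <= j < lam m) qn ((lam a - j.+1) + (col lam j - a.+1)).+1) *
   qf (lam a - lam m + (m - a)) = qf (lam a - lam m.+1 + (m - a)).
  move=> /andP[am mn]; have h1 := part_anti p am; have h2 := part_anti p (leqnSn m).
  rewrite (_ : (lam a - lam m + (m - a) = (lam a + (m - a)) - lam m)%N); last by lia.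
  rewrite (_ : (lam a - lam m.+1 + (m - a) = (lam a + (m - a)) - lam m.+1)%N); last by lia.
  rewrite -(prod_qn_range h2); last by lia.
  congr (_ * _); apply: eq_big_nat => j hj; rewrite (col_block p mn hj); congr qn; lia.
elim: k => // k IH /andP[]; rewrite ltnS leq_eqVlt => /orP[/eqP<-|ak] kn.
  rewrite [X in _ * X]big_geq // mulr1 -[LHS]mulr1.
  have := block a; rewrite leqnn an !subnn !addn0 [qf 0]/qf big_ord0 => -> //.
  congr qf; lia.
have h1 := part_anti p (ltnW ak); have h2 := part_anti p (leqnSn k).
have {}IH := IH (introT andP (conj ak (ltnW kn))).
have {}block := block k (introT andP (conj (ltnW ak) kn)).
rewrite (big_cat_nat h2 h1) big_nat_recr //=.
set A := \prod_(lam k.+1 <= j < lam k) _ in block *.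
set B := \prod_(lam k <= j < lam a) _ in IH *; set C := \prod_(a.+1 <= b < k) _ in IH *.
rewrite -[LHS]mulrA [X in A * X]mulrA IH.
have -> : (shifted lam a - shifted lam k = (lam a - lam k + (k - a)).-1.+1)%N.
  by rewrite /shifted; lia.
rewrite -qfS prednK; last by lia.
by rewrite block; congr qf; lia.
Qed.

Lemma rowh_hooks lam (a : 'I_n) : is_part lam ->
  rowh lam a = q ^+ (a * lam a) /
    \prod_(j < lam a) qn ((lam a - j.+1) + (col lam j - a.+1)).+1.
Proof.
move=> p; have an := ltn_ord a.
have := @prod_hooks lam a n p an; rewrite an leqnn => /(_ isT).
have [_ ->] := p; rewrite subn0 big_mkord.
have -> : (lam a + (n - a)).-1 = shifted lam a by rewrite /shifted; lia.
have -> : \prod_(a.+1 <= b < n) qn (shifted lam a - shifted lam b) =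
  \prod_(j < n | (a < j)%N) qn (shifted lam a - shifted lam j).
  rewrite -(big_mkord (fun b => a < b)%N (fun b => qn (shifted lam a - shifted lam b))).
  rewrite [RHS](big_cat_nat (leq0n a.+1) an) /= [X in _ = X * _]big_nat_cond [X in _ = X * _]big1 ?mul1r => [|b].
    by rewrite [LHS]big_nat_cond [RHS]big_nat_cond; apply: eq_bigl => b; case: (ltnP a b); rewrite ?andbF ?andbT.
  by rewrite ltnS => /andP[/andP[_ ba]]; rewrite ltnNge ba.
rewrite /rowh -mulrA => <-; congr (_ * _); rewrite invfM mulrCA mulfV ?mulr1 //.
apply/prodf_neq0 => j aj; apply: qn_neq0.
by rewrite subn_gt0; exact: shifted_lt.
Qed.

Lemma kap_empty : kap (fun=> 0%N) = 1.
Proof.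
apply: big1 => a _; rewrite rowh_hooks; last by split.
by rewrite big_ord0 muln0 divr1.
Qed.

End HookWeights.

(** * The seminormal representation and the trace form *)

Section Seminormal.
Variables (K : fieldType) (q : K) (n : nat).
Hypothesis q0 : q != 0.
Hypothesis qr : forall m, (0 < m)%N -> q ^+ m != 1.
Local Notation H := (hecke q n).
Local Notation T := (@Tgn K q n).
Local Notation word := {ffun 'I_n -> 'I_n}.
Local Notation X := {y : word | lattice y}.

Lemma qz_neq0 (u : int) : q ^ u != 0.
Proof. exact: expfz_neq0. Qed.
Lemma qz_inj : injective (fun u : int => q ^ u).
Proof.
have h (u v : int) : u < v -> q ^ u <> q ^ v.
  move=> uv e; have /eqP[] := @qr `|v - u|%N (ltac:(lia)).
  rewrite -[q ^+ _]/(q ^ `|v - u|%N%:Z) gez0_abs; last by lia.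
  by apply: (mulIf (qz_neq0 u)); rewrite mul1r -expfzDr // subrK.
move=> u v /= e; case: (ltgtP u v) => // [/h|/h] //.
by move/esym: e.
Qed.
Lemma qz_sub_neq0 u v : u != v -> q ^ v - q ^ u != 0.
Proof. by rewrite subr_eq0 (inj_eq qz_inj) eq_sym. Qed.
Lemma qint_inj : injective (qint q).
Proof.
move=> u v; rewrite /qint => /(mulIf _) e; apply: qz_inj.
by apply: (addIr (- 1)); apply: e; rewrite invr_eq0 subr_eq0 (q_neq1 qr).
Qed.

(* Young's seminormal form: consecutive entries of contents u and v span a
   two-dimensional block of T_i with coefficients sa, sb. *)
Definition sa (u v : int) : K := (q - 1) * q ^ v / (q ^ v - q ^ u).
Definition sb (u v : int) : K :=
  if `|u - v|%N == 1%N then 0 else (q * q ^ v - q ^ u) / (q ^ v - q ^ u).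

(** For adjacent contents T_i acts by the scalar q (v = u + 1, same row) or -1 (u = v + 1, same
    column). The quotient in [sb] vanishes by itself only for u = v + 1; in the other case the value
    0 is imposed. *)
Lemma sa_quad u v : u != v -> sa u v * sa u v + sb u v * sb v u = (q - 1) * sa u v + q.
Proof.
move=> uv; have d := qz_sub_neq0 uv; rewrite /sa /sb distnC.
have d' : q ^ u - q ^ v != 0 by rewrite -opprB oppr_eq0.
case: eqP => [adj|_]; last by field; rewrite ?d ?d'.
rewrite mul0r addr0; have [e|e] : u = v + 1 \/ v = u + 1 by lia.
  by move: d; rewrite e expfzDr // expr1z => d; field; rewrite ?d.
by move: d; rewrite e expfzDr // expr1z => d; field; rewrite ?d.
Qed.

Lemma sb_quad u v : u != v -> sb u v * (sa u v + sa v u) = (q - 1) * sb u v.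
Proof.
move=> uv; have d := qz_sub_neq0 uv; rewrite mulrC; congr (_ * _).
have d' : q ^ u - q ^ v != 0 by rewrite -opprB oppr_eq0.
by rewrite /sa; field; rewrite ?d ?d'.
Qed.

Lemma sb_neq0 u v : sb u v != 0 -> `|u - v|%N != 1%N.
Proof. by apply: contraNneq => e; rewrite /sb e. Qed.

Definition shape_c (x : X) : {ffun 'I_n -> int} := cont (val x).
Definition semmat := @lmat K n X int shape_c sa sb.

Lemma shape_c_inj : injective shape_c.
Proof. by move=> x x' /(cont_inj (valP x) (valP x')) /val_inj. Qed.

Lemma shape_c_swap (x : X) (i : 'I_n.-1) :
  sb (shape_c x (pos0 i)) (shape_c x (pos1 i)) != 0 ->
  exists2 x' : X, val x' = swapf i (val x) & shape_c x' = swapf i (shape_c x).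
Proof.
move=> /sb_neq0 nadj; exists (exist (fun y : word => is_true (lattice y)) _ (lattice_swap (valP x) nadj)) => //.
by rewrite /shape_c /= cont_swap // (nonadj_neq (valP x) nadj).
Qed.

Lemma sem_sat : satisfies (@hecke_rels K q n) (@scalar_mx K _) semmat.
Proof.
apply: lmat_sat => [|x i|x i|x i j e|u v|u v|u v w|u v w|u v w].
- exact: shape_c_inj.
- by case/shape_c_swap => x' _; exists x'.
- exact: (cont_dist1 i (valP x)).
- exact: (cont_dist2 (valP x) e).
- exact: sa_quad.
- exact: sb_quad.
- move=> /qz_sub_neq0 d1 /qz_sub_neq0 d2 /qz_sub_neq0 d3.
  have d1' : q ^ u - q ^ v != 0 by rewrite -opprB oppr_eq0.
  by rewrite /sa; field; rewrite ?d1 ?d2 ?d3 ?d1'.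
- move=> /qz_sub_neq0 d1 /qz_sub_neq0 d2 /qz_sub_neq0 d3.
  have d2' : q ^ v - q ^ w != 0 by rewrite -opprB oppr_eq0.
  by rewrite /sa; field; rewrite ?d1 ?d2 ?d3 ?d2'.
- move=> n1 n2 n3; have e1 := sa_quad n1; have e2 := sa_quad n2.
  have -> : sb u v * sb v u = (q - 1) * sa u v + q - sa u v * sa u v by rewrite -e1 addrAC subrr add0r.
  have -> : sb v w * sb w v = (q - 1) * sa v w + q - sa v w * sa v w by rewrite -e2 addrAC subrr add0r.
  have d1 := qz_sub_neq0 n1; have d2 := qz_sub_neq0 n2; have d3 := qz_sub_neq0 n3.
  by rewrite /sa; field; rewrite ?d1 ?d2 ?d3.
Qed.

Definition sem : H -> 'M[K]_#|{: X}| := mxrep semmat.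
HB.instance Definition _ := GRing.isLinear.Build K H _ *:%R sem (mxrep_is_linear sem_sat).
Lemma semM x y : sem (x * y) = sem x *m sem y. Proof. exact: (mxrepM sem_sat). Qed.
Lemma sem1 : sem 1 = 1%:M. Proof. exact: (mxrep1 sem_sat). Qed.
Lemma semZ c x : sem (c *: x) = c *: sem x. Proof. by rewrite linearZ. Qed.
Lemma semD x y : sem (x + y) = sem x + sem y. Proof. by rewrite linearD. Qed.
Lemma semB x y : sem (x - y) = sem x - sem y. Proof. by rewrite linearB. Qed.
Lemma sem_sum I (s : seq I) P (F : I -> H) :
  sem (\sum_(i <- s | P i) F i) = \sum_(i <- s | P i) sem (F i).
Proof. exact: (linear_sum (sem : {linear H -> _})). Qed.

Local Notation lv := (@lvec K n X int shape_c).
Local Notation c := shape_c.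

Lemma sem_T i f : (exists x, c x = f) -> sem (T i) *m lv f =
  sa (f (pos0 i)) (f (pos1 i)) *: lv f + sb (f (pos0 i)) (f (pos1 i)) *: lv (swapf i f).
Proof.
move=> gf; rewrite /sem (mxrep_gen sem_sat).
exact: (lmat_lvec _ _ shape_c_inj).
Qed.

Lemma Tw_gen (i : 'I_n.-1) : Tw q (tperm (pos0 i) (pos1 i)) = T i.
Proof.
have e : word_perm [:: i] = tperm (pos0 i) (pos1 i) by rewrite /word_perm big_seq1.
rewrite -e -wT_reduced ?/wT ?big_seq1 // e -[tperm _ _]mulg1 inv_asc ?inv1 //.
by rewrite !perm1 /=.
Qed.

(** The transposition is conjugated by s_i, and each of the two factors s_i adds one inversion, so
    concatenating reduced words gives a reduced word. *)
Lemma Tw_conj (i : 'I_n.-1) (j : 'I_n) : (j < i)%N ->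
  Tw q (tperm j (pos1 i)) = T i * Tw q (tperm j (pos0 i)) * T i.
Proof.
move=> ji; set w := tperm j (pos0 i); set s := tperm (pos0 i) (pos1 i).
have n0 : j != pos0 i by rewrite -val_eqE /= ltn_eqF.
have n1 : j != pos1 i by rewrite -val_eqE /= ltn_eqF // ltnW.
have n01 := pos0_neq_pos1 i.
have sj : s j = j by rewrite tpermD // eq_sym.
have w1 : w (pos1 i) = pos1 i by rewrite tpermD // eq_sym.
have e1 : inv (w * s)%g = (inv w).+1.
  rewrite -invV invMg !tpermV inv_asc // w1 tpermR /=; lia.
have e2 : inv (s * (w * s))%g = (inv w).+2.
  by rewrite (@inv_asc _ i (w * s)%g) ?e1 // !permM w1 !tpermR sj /=.
have [r1 r2] := redwordP w; pose t := i :: redword w ++ [:: i].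
have et : word_perm t = (s * (w * s))%g.
  by rewrite word_perm_cons word_perm_cat r1 /word_perm big_seq1.
have -> : tperm j (pos1 i) = word_perm t.
  rewrite et -{1}[s]tpermV -/(conjg _ _) tpermJ tpermL.
  by rewrite -/s sj.
rewrite -wT_reduced; last by rewrite et e2 /= size_cat r2 addn1.
by rewrite wT_cons wT_cat -mulrA {2}/wT big_seq1.
Qed.

Lemma JM_next (i : 'I_n.-1) :
  JM q (pos1 i) = q^-1 *: (T i * JM q (pos0 i) * T i + T i).
Proof.
rewrite /JM (bigID (fun j : 'I_n => (j < i)%N)) /= scalerDr; congr (_ + _).
  rewrite mulr_sumr mulr_suml scaler_sumr; apply: eq_big => [j|j /andP[_ ji]].
    by rewrite ltnS; case: ltngtP => // /ltnW ->.
  rewrite Tw_conj // -scalerAr -scalerAl scalerA; congr (_ *: _).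
  by rewrite subSn ?(ltnW ji) // exprS invfM.
rewrite (big_pred1 (pos0 i)) => [|j].
  by rewrite Tw_gen /= subSnn expr1.
by rewrite /= -val_eqE /= ltnS; case: ltngtP.
Qed.

(** The multiplicative Jucys-Murphy element. Its eigenvalues are the powers q^c instead of [c]_q,
    and the inhomogeneous recursion [JM_next] becomes pure conjugation by T_i up to q^-1. *)
Definition Jmul (m : 'I_n) : H := 1 + (q - 1) *: JM q m.

Lemma Jmul_next (i : 'I_n.-1) : Jmul (pos1 i) = q^-1 *: (T i * Jmul (pos0 i) * T i).
Proof.
have -> : T i * Jmul (pos0 i) * T i = q *: 1 + (q - 1) *: (T i * JM q (pos0 i) * T i + T i).
  rewrite /Jmul mulrDr mulr1 mulrDl Tgn_quad -scalerAr -scalerAl scalerDr.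
  by rewrite -addrA addrC -addrA.
by rewrite /Jmul JM_next; move: (T i * JM q (pos0 i) * T i + T i) => Z;
  rewrite scalerDr !scalerA mulVf // scale1r mulrC.
Qed.

(** On the block of two tableaux differing by s_i, T_i diag(q^u, q^v) T_i = q diag(q^v, q^u); [h1]
    and [h2] below are the diagonal and the off-diagonal part of this identity. *)
Lemma sem_Jmul (x : X) (m : 'I_n) :
  sem (Jmul m) *m lv (c x) = q ^ c x m *: lv (c x).
Proof.
case: m => m; elim: m x => [|m IH] x hm.
  have -> : Jmul (Ordinal hm) = 1 by rewrite /Jmul /JM big1 ?scaler0 ?addr0.
  have := cont_bound (Ordinal hm) (valP x); rewrite -/(c x) /= oppr0 => b.
  by rewrite sem1 mul1mx (_ : c x _ = 0) ?expr0z ?scale1r //; lia.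
have hm' := lt_pred hm; pose i := Ordinal hm'.
have -> : Ordinal hm = pos1 i by exact: val_inj.
have IH' (y : X) : sem (Jmul (pos0 i)) *m lv (c y) = q ^ c y (pos0 i) *: lv (c y).
  by have := IH y (ltnW hm); rewrite (_ : Ordinal (ltnW hm) = pos0 i) //; exact: val_inj.
have gx : exists x', c x' = c x by exists x.
rewrite Jmul_next semZ !semM -scalemxAl -!mulmxA (sem_T _ gx).
rewrite mulmxDr -!scalemxAr IH' mulmxDr -!scalemxAr.
have d := cont_dist1 i (valP x); rewrite -/(c x) in d.
have hb : sb (c x (pos0 i)) (c x (pos1 i)) *: (sem (T i) *m (sem (Jmul (pos0 i)) *m lv (swapf i (c x)))) =
   (sb (c x (pos0 i)) (c x (pos1 i)) * q ^ c x (pos1 i)) *: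
   (sa (c x (pos1 i)) (c x (pos0 i)) *: lv (swapf i (c x)) + sb (c x (pos1 i)) (c x (pos0 i)) *: lv (c x)).
  have [->|nz] := eqVneq (sb (c x (pos0 i)) (c x (pos1 i))) 0; first by rewrite mul0r !scale0r.
  have [x' _ e] := shape_c_swap nz; rewrite -scalerA -e IH' -scalemxAr (sem_T i); last by exists x'.
  by rewrite e swapf0 swapf1 swapfK.
rewrite hb (sem_T _ gx).
have e1 := sa_quad d; have e2 := sb_quad d.
have dz := qz_sub_neq0 d.
have dz' : q ^ c x (pos0 i) - q ^ c x (pos1 i) != 0 by rewrite -opprB oppr_eq0.
set u := c x (pos0 i) in d e1 e2 dz dz' *; set v := c x (pos1 i) in d e1 e2 dz dz' *.
have h1 : sa u v * sa u v * q ^ u + sb u v * sb v u * q ^ v = q * q ^ v.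
  have -> : sb u v * sb v u = (q - 1) * sa u v + q - sa u v * sa u v by rewrite -e1 addrAC subrr add0r.
  by rewrite /sa; field; rewrite ?dz.
have h2 : sa u v * q ^ u + q ^ v * sa v u = 0.
  by rewrite /sa; field; rewrite ?dz ?dz'.
apply/matrixP => k l; rewrite !mxE.
move: (_ == c x)%:R (_ == swapf i (c x))%:R => f1 f2.
transitivity (q^-1 * ((sa u v * sa u v * q ^ u + sb u v * sb v u * q ^ v) * f1
   + sb u v * (sa u v * q ^ u + q ^ v * sa v u) * f2)); first by ring.
by rewrite h1 h2 mulr0 mul0r addr0 mulrA mulKf.
Qed.

Lemma sem_JM (x : X) (m : 'I_n) :
  sem (JM q m) *m lv (c x) = qint q (c x m) *: lv (c x).
Proof.
have q1 : q - 1 != 0 by rewrite subr_eq0 (q_neq1 qr).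
have := sem_Jmul x m; rewrite /Jmul semD sem1 semZ mulmxDl mul1mx -scalemxAl => h.
apply: (scalerI q1); rewrite /qint scalerA mulrCA mulfV // mulr1 [RHS]scalerBl scale1r -h.
by rewrite addrAC subrr add0r.
Qed.

Lemma sem_prod_diag (v : 'cV[K]_#|{: X}|) I (s : seq I) (P : pred I) (F : I -> H) (g : I -> K) :
  (forall i, P i -> sem (F i) *m v = g i *: v) ->
  sem (\prod_(i <- s | P i) F i) *m v = (\prod_(i <- s | P i) g i) *: v.
Proof.
move=> h; elim/big_rec2: _ => [|i a x Pi IH]; first by rewrite sem1 mul1mx scale1r.
by rewrite semM -mulmxA IH -scalemxAr h // scalerA mulrC.
Qed.

Definition Ec (cc : 'I_n -> int) : H :=
  \prod_(m < n) \prod_(k < (m.*2).+1 | k%:Z - m%:Z != cc m)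
    ((qint q (cc m) - qint q (k%:Z - m%:Z))^-1 *:
     (JM q m - qint q (k%:Z - m%:Z) *: 1)).

Lemma sem_Ec (x y : X) : sem (Ec (c y)) *m lv (c x) = (x == y)%:R *: lv (c x).
Proof.
pose g (m : 'I_n) : K := \prod_(k < (m.*2).+1 | k%:Z - m%:Z != c y m)
  ((qint q (c y m) - qint q (k%:Z - m%:Z))^-1 * (qint q (c x m) - qint q (k%:Z - m%:Z))).
rewrite (@sem_prod_diag _ _ _ _ _ g) => [|m _]; last first.
  apply: sem_prod_diag => k _; rewrite semZ -scalemxAl semB semZ sem1 /=.
  by rewrite mulmxBl sem_JM -scalemxAl mul1mx -scalerBl scalerA.
congr (_ *: _); have [e|xy] := eqVneq x y.
  apply: big1 => m _; rewrite /g e; apply: big1 => k kc; apply: mulVf.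
  by rewrite subr_eq0 (inj_eq qint_inj) eq_sym.
have [m ne] : exists m, c x m != c y m.
  apply/existsP; apply: contraNT xy; rewrite negb_exists => /forallP h.
  by apply/eqP/shape_c_inj/ffunP => m; apply/eqP; have := h m; rewrite negbK.
have /andP[b1 b2] := cont_bound m (valP x).
rewrite -/(c x) in b1 b2.
(* For this index k the value k - m is the content of x at m, and the corresponding factor
   annihilates the vector of x. *)
have lt : (`|(c x m + m%:Z)%R|%N < (m.*2).+1)%N by lia.
have e : (Ordinal lt)%:Z - m%:Z = c x m by rewrite /= gez0_abs; lia.
rewrite (bigD1 m) //= /g (bigD1 (Ordinal lt)) /=; last by rewrite e.
by rewrite -/(nat_of_ord (Ordinal lt)) e subrr mulr0 !mul0r.
Qed.

Lemma sem_Ec_entry (x y z : X) :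
  sem (Ec (c y)) (enum_rank z) (enum_rank x) = ((z == y) && (x == y))%:R.
Proof.
have /matrixP/(_ (enum_rank z) 0) := sem_Ec x y.
rewrite lvecE -?colE; last exact: shape_c_inj.
rewrite !mxE eqxx andbT (inj_eq enum_rank_inj) => ->.
by have [->|] := eqVneq x y; rewrite ?mul1r ?mul0r ?andbT ?andbF.
Qed.
End Seminormal.

(** * Averages for q-Plancherel growth *)

Section PathWeights.
Variables (K : fieldType) (q : K) (n : nat).
Hypothesis q0 : q != 0.
Hypothesis qr : forall m, (0 < m)%N -> q ^+ m != 1.
Hypothesis char0 : [pchar K] =i pred0.
Local Notation H := (hecke q n).
Local Notation T := (@Tgn K q n).
Local Notation word := {ffun 'I_n -> 'I_n}.
Local Notation X := {y : word | lattice y}.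

(* q-Plancherel weights: rowwt is the probability of the row of the next box, and the
   weight of a full standard tableau is the value of tau on its idempotent. *)
Definition wt (y : word) (M : nat) : K :=
  \prod_(j < n | (j < M)%N) rowwt q (rowx q (cnt y j)) (y j).

Lemma wtS y (k : 'I_n) : wt y k.+1 = wt y k * rowwt q (rowx q (cnt y k)) (y k).
Proof.
rewrite /wt (bigD1 k) //= mulrC; congr (_ * _); apply: eq_bigl => j.
by rewrite ltnS -val_eqE /=; case: ltngtP.
Qed.

Lemma wt0 y : wt y 0 = 1. Proof. exact: big_pred0. Qed.

Lemma cnt_addbox (y : word) (k : 'I_n) : cnt y k.+1 = addbox (cnt y k) (y k).
Proof. by apply: funext => r; rewrite cntS. Qed.

Lemma cnt_part (y : word) m : (forall r, cnt y m r.+1 <= cnt y m r)%N -> is_part n (cnt y m).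
Proof. by move=> h; split=> //; exact: cnt_row_ge. Qed.

Lemma rowwt_bad (lam : nat -> nat) (i : 'I_n) r : i = r.+1 :> nat -> lam i = lam r ->
  rowwt q (rowx q lam) i = 0.
Proof.
move=> ir e; have rn : (r < n)%N by have := ltn_ord i; lia.
rewrite /rowwt (bigD1 (Ordinal rn)) /=; last by rewrite -val_eqE /= ir; lia.
have -> : q * rowx q lam i = rowx q lam (Ordinal rn).
  by rewrite /rowx -exprS /shifted /= e; congr (_ ^+ _); have := ltn_ord i; lia.
by rewrite subrr !mul0r.
Qed.

Lemma wt_part y M : (M <= n)%N -> wt y M != 0 ->
  forall m, (m <= M)%N -> is_part n (cnt y m).
Proof.
elim: M => [|M IH] Mn nz m.
  by rewrite leqn0 => /eqP->; apply: cnt_part => r; rewrite !cnt0.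
have hk : (M < n)%N by []; pose k := Ordinal hk.
have := nz; rewrite -[M.+1]/k.+1 wtS mulf_eq0 negb_or => /andP[nz1 nz2].
rewrite leq_eqVlt => /orP[/eqP->|]; last by move/IH; apply=> //; exact: ltnW.
apply: cnt_part => r; rewrite -[M.+1]/k.+1 !cntS.
have [h _] : is_part n (cnt y k) by apply: IH => //; exact: ltnW.
have := h r; case: (y k =P r.+1 :> nat) => [e|_] /=; last by lia.
rewrite leq_eqVlt => /orP[/eqP e'|]; last by lia.
by case/eqP: nz2; apply: (rowwt_bad e); rewrite e.
Qed.

Lemma wt_lattice y : wt y n != 0 -> lattice y.
Proof.
move=> nz; apply/latticeP => m r; have [mn|mn] := leqP m n.
  by have [h _] := wt_part (leqnn n) nz mn.
rewrite !(@cnt_ge _ _ m) ?(ltnW mn) //.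
by have [h _] := wt_part (leqnn n) nz (leqnn n).
Qed.

Lemma wt_kap y m : lattice y -> (m <= n)%N -> wt y m = kap q n (cnt y m).
Proof.
move=> lat; have pt k : is_part n (cnt y k) by apply: cnt_part; exact/latticeP.
elim: m => [|m IH] mn.
  have -> : cnt y 0 = (fun=> 0%N) by apply: funext => r; rewrite cnt0.
  by rewrite wt0 kap_empty.
pose k := Ordinal mn; have pt1 := pt k.+1; have ptk := pt k.
rewrite cnt_addbox in pt1; rewrite -[m.+1]/k.+1 wtS (IH (ltnW mn)) cnt_addbox.
by rewrite (kap_addbox q0 qr ptk pt1).
Qed.

Lemma rowwt_sum1 (y : word) (k : 'I_n) : is_part n (cnt y k) ->
  \sum_(i < n) rowwt q (rowx q (cnt y k)) i = 1.
Proof.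
move=> pt; have [h _] := pt; move: y k pt h; case: (n) => [|n'] y k pt h; first by have := ltn_ord k; rewrite ltn0.
apply: sum_rowwt; first by rewrite (q_neq1 qr).
- exact: rowx_inj.
- by move=> i; rewrite expf_neq0.
- rewrite /rowx /shifted /= subnn addn0 (_ : cnt y k n' = 0%N) //.
  apply/eqP; rewrite -leqn0 leqNgt; apply/negP => /(cnt_pos_row h (ltnW (ltn_ord k))).
  by have := ltn_ord k; lia.
- by move=> i; rewrite /rowx -exprS qr.
Qed.

Lemma rowwt_alpha (y : word) (k a : 'I_n) : is_part n (cnt y k) -> (a < n.-1)%N ->
  let x := rowx q (cnt y k) in (forall r : 'I_n, q * x r != x a) ->
  \sum_r rowwt q x r * (q * x r / (q * x r - x a)) = 0.
Proof.
move=> pt; have [h _] := pt; move: y k a pt h; case: (n) => [|n'] y k a pt h; first by have := ltn_ord k; rewrite ltn0.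
move=> amax x qx; apply: sum_rowwt_alpha => //; first by rewrite (q_neq1 qr).
- exact: rowx_inj.
- rewrite /x /rowx /shifted /= subnn addn0 (_ : cnt y k n' = 0%N) //.
  apply/eqP; rewrite -leqn0 leqNgt; apply/negP => /(cnt_pos_row h (ltnW (ltn_ord k))).
  by have := ltn_ord k; lia.
- by move=> i; rewrite /x /rowx -exprS qr.
- by rewrite -val_eqE /= ltn_eqF.
Qed.

Definition upd (y : word) (M i : 'I_n) : word := [ffun k => if k == M then i else y k].

Lemma upd_lt y (M i : 'I_n) (k : 'I_n) : (k < M)%N -> upd y M i k = y k.
Proof. by rewrite ffunE -val_eqE /=; case: ltngtP. Qed.
Lemma upd_at y (M i : 'I_n) : upd y M i M = i. Proof. by rewrite ffunE eqxx. Qed.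

Lemma cnt_agree (y z : word) m r : (forall k : 'I_n, (k < m)%N -> y k = z k) ->
  cnt y m r = cnt z m r.
Proof. by move=> h; apply: eq_bigr => k _; case: ltnP => // /h ->. Qed.

Lemma wt_agree (y z : word) m : (forall k : 'I_n, (k < m)%N -> y k = z k) ->
  wt y m = wt z m.
Proof.
move=> h; apply: eq_bigr => j jm; rewrite h //; congr (rowwt q (rowx q _) _).
apply: funext => r; apply: cnt_agree => k kj; apply: h; exact: ltn_trans jm.
Qed.

(* Averaging over the value at one position replaces a sum over the extensions
   of a prefix. *)
Lemma sum_upd (F : word -> K) (M : 'I_n) :
  n%:R * \sum_y F y = \sum_y \sum_i F (upd y M i).
Proof.
rewrite pair_bigA /= (reindex_inj (h := fun p : word * 'I_n => (upd p.1 M p.2, p.1 M))) /=.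
  transitivity (\sum_(p : word * 'I_n) F p.1).
    rewrite -(pair_bigA _ (fun y _ => F y)) mulr_sumr /=; apply: eq_bigr => y _.
    by rewrite sumr_const card_ord mulr_natl.
  apply: eq_bigr => -[y i] _ /=; congr F; apply/ffunP => k; rewrite !ffunE.
  by case: eqP => [->|].
move=> [y i] [z j] /= [/ffunP e e']; congr pair.
  apply/ffunP => k; have := e k; rewrite !ffunE; case: (k =P M) => [->|//] _.
  exact: e'.
by have := e M; rewrite !ffunE eqxx.
Qed.

(** Summing out the last weighted letter gives 1 by [rowwt_sum1]. Both sums range over words of full
    length, so each letter without weight counts n times, whence the power of n. *)
Lemma sum_wt (F : word -> K) (M0 : nat) :
  (forall y z : word, (forall k : 'I_n, (k < M0)%N -> y k = z k) -> F y = F z) ->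
  forall d M, (M0 <= M)%N -> (M + d = n)%N ->
  n%:R ^+ d * \sum_y wt y n * F y = \sum_y wt y M * F y.
Proof.
move=> FE; elim=> [|d IH] M M0M e; first by rewrite expr0 mul1r (_ : M = n) //; rewrite -e addn0.
have hM : (M < n)%N by rewrite -e -addSnnS leq_addr.
rewrite exprS -mulrA (IH M.+1) ?(leqW M0M) //; last by rewrite addSnnS.
pose k := Ordinal hM; rewrite (sum_upd _ k); apply: eq_bigr => y _.
have agree i : forall j : 'I_n, (j < M)%N -> upd y k i j = y j.
  by move=> j jM; rewrite upd_lt.
rewrite -[RHS]mulr1; have [z|nz] := eqVneq (wt y M) 0.
  rewrite z !mul0r; apply: big1 => i _; rewrite -[M.+1]/k.+1 wtS.
  by rewrite (wt_agree (agree i)) z !mul0r.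
rewrite -(@rowwt_sum1 y k); last exact: (wt_part (ltnW hM) nz).
rewrite mulr_sumr; apply: eq_bigr => i _; rewrite -[M.+1]/k.+1 wtS upd_at.
rewrite (wt_agree (agree i)) (FE _ y); last first.
  by move=> j jM; apply: agree; exact: leq_trans M0M.
have -> : cnt (upd y k i) k = cnt y k by apply: funext => r; apply: cnt_agree; exact: agree.
by rewrite mulrAC.
Qed.

Lemma natr_neq0 m : (0 < m)%N -> (m%:R : K) != 0.
Proof. by move/pcharf0P: char0 => ->; rewrite lt0n. Qed.

Lemma sum_wt1 : \sum_y wt y n = 1.
Proof.
have := @sum_wt (fun=> 1) 0 (fun _ _ _ => erefl) n 0 isT (add0n n).
have -> : \sum_y wt y n * 1 = \sum_y wt y n by apply: eq_bigr => y _; rewrite mulr1.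
have -> : \sum_y wt y 0 * 1 = (n ^ n)%:R.
  under eq_bigr => y _ do rewrite wt0 mulr1.
  by rewrite sumr_const card_ffun !card_ord.
rewrite -natrX => h.
have [n0|n0] := posnP n.
  by move: h; rewrite (_ : n ^ n = 1)%N ?mul1r // n0.
have nz : (n ^ n)%:R != 0 :> K by apply: natr_neq0; rewrite expn_gt0 n0.
by apply: (mulfI nz); rewrite mulr1.
Qed.

(** With the entries up to [pos0 i] fixed, only the row of [pos1 i] varies, and the average over it
    is [sum_rowwt_alpha] for the row a of [pos0 i]. *)
Lemma sum_wt_alpha (i : 'I_n.-1) (F : word -> K) :
  (forall y z : word, (forall k : 'I_n, (k < i.+1)%N -> y k = z k) -> F y = F z) ->
  \sum_y wt y n * (sa q (cont y (pos0 i)) (cont y (pos1 i)) * F y) = 0.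
Proof.
move=> FE; pose k := pos1 i; have kn := ltn_ord k.
have n0 : n%:R != 0 :> K by apply: natr_neq0; exact: leq_ltn_trans kn.
pose G (y : word) := sa q (cont y (pos0 i)) (cont y (pos1 i)) * F y.
have GE (y z : word) : (forall j : 'I_n, (j < k.+1)%N -> y j = z j) -> G y = G z.
  move=> h; rewrite /G (FE y z) => [|j ji]; last by apply: h; exact: ltnW.
  congr (sa q _ _ * _); rewrite !ffunE h //= ?ltnS //; congr (_%:Z - _).
    by apply: cnt_agree => j ji; apply: h; rewrite ltnW // ltnW.
  by apply: cnt_agree => j ji; apply: h; exact: ltnW.
have /eqP := sum_wt GE (d := n - k.+1) (leqnn k.+1) (subnKC kn).
suff -> : \sum_y wt y k.+1 * G y = 0.
  by rewrite mulf_eq0 expf_eq0 (negPf n0) andbF /= => /eqP.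
apply: (mulfI n0); rewrite mulr0 (sum_upd _ k); apply: big1 => y _.
have agree r : forall j : 'I_n, (j < k)%N -> upd y k r j = y j.
  by move=> j jM; rewrite upd_lt.
have [z|nz] := eqVneq (wt y k) 0.
  by apply: big1 => r _; rewrite wtS (wt_agree (agree r)) z !mul0r.
have pt := wt_part (ltnW kn) nz.
pose mu := cnt y k; pose x : 'I_n -> K := rowx q mu; pose a : 'I_n := y (pos0 i).
have ptk : is_part n mu by exact: pt.
have ptn : is_part n (cnt y i) by apply: pt; exact: leqW.
have cE r : cnt (upd y k r) k = mu by apply: funext => s; apply: cnt_agree; exact: agree.
have c0 r : cont (upd y k r) (pos0 i) = (cnt y i a)%:Z - a%:Z.
  rewrite ffunE upd_lt //= /a; congr (_%:Z - _); apply: cnt_agree => j ji.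
  by rewrite upd_lt //= ltnS ltnW.
have c1 r : cont (upd y k r) (pos1 i) = (mu r)%:Z - r%:Z.
  by rewrite ffunE upd_at -/k cE.
have muE r : mu r = (cnt y i r + (a == r :> nat))%N by exact: cnt_pos1.
have ax r : q * x r != x a.
  rewrite /x /rowx -exprS; apply/eqP => /(qexp_inj q0 qr); rewrite /shifted !muE eqxx.
  have [ra|ar] := leqP r a.
    have := part_anti ptk ra; rewrite !muE eqxx; have := ltn_ord a; lia.
  have := part_anti ptn (ltnW ar); rewrite ltn_eqF //; have := ltn_ord r; lia.
have term r : wt (upd y k r) k.+1 * G (upd y k r) =
    wt y k * F y * (q - 1) * (rowwt q x r * (q * x r / (q * x r - x a))).
  rewrite wtS (wt_agree (agree r)) upd_at cE /G c0 c1 (FE _ y); last first.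
    by move=> j ji; exact: agree.
  (* x_r is q^(n-1) times q to the content of a new box in row r. Row a has already received the box
     of [pos0 i], so x_a corresponds to the content of that box plus one. *)
  have qz m (r' : 'I_n) : q ^ (m%:Z - r'%:Z) = q ^+ (m + (n - r'.+1)) * q ^- n.-1.
    rewrite -[q ^+ n.-1]/(q ^ (n.-1)%:Z) invr_expz -[q ^+ _]/(q ^ (m + (n - r'.+1))%N%:Z).
    rewrite -expfzDr //; congr (q ^ _).
    by have := ltn_ord r'; have := ltn_ord i; lia.
  have -> : sa q ((cnt y i a)%:Z - a%:Z) ((mu r)%:Z - r%:Z) =
      (q - 1) * (q * x r / (q * x r - x a)).
    have e1 : q ^ ((mu r)%:Z - r%:Z) = x r * q ^- n.-1 by exact: qz.
    have e2 : q ^ ((cnt y i a)%:Z - a%:Z) * q = x a * q ^- n.-1.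
      by rewrite -(qz (mu a) a) muE eqxx -{2}[q]expr1z -expfzDr //; congr (q ^ _); lia.
    have qn0 : q ^+ n.-1 != 0 by rewrite expf_neq0.
    have e3 : q ^ ((cnt y i a)%:Z - a%:Z) = x a / q ^+ n.-1 / q by rewrite -e2 mulfK.
    rewrite /sa e1 e3.
    have -> : x r / q ^+ n.-1 - x a / q ^+ n.-1 / q = (q * x r - x a) / (q ^+ n.-1 * q).
      by field; rewrite q0 qn0.
    have dx : q * x r - x a != 0 by rewrite subr_eq0.
    by rewrite invf_div; field; rewrite ?q0 ?qn0 ?dx.
  by ring.
rewrite (eq_bigr _ (fun r _ => term r)) -mulr_sumr.
suff -> : \sum_r rowwt q x r * (q * x r / (q * x r - x a)) = 0 by rewrite mulr0.
have amax : (a < n.-1)%N.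
  have pos : (0 < mu a)%N by rewrite muE eqxx addn1.
  have [h _] := ptk; have := cnt_pos_row h (ltnW kn) pos; have := ltn_ord i.
  by rewrite /= => h1 h2; lia.
exact: rowwt_alpha.
Qed.
End PathWeights.

(** * The weighted seminormal trace is the trace form *)

Section TraceIdentity.
Variables (K : fieldType) (q : K) (n : nat).
Hypothesis q0 : q != 0.
Hypothesis qr : forall m, (0 < m)%N -> q ^+ m != 1.
Hypothesis char0 : [pchar K] =i pred0.
Local Notation H := (hecke q n).
Local Notation T := (@Tgn K q n).
Local Notation word := {ffun 'I_n -> 'I_n}.
Local Notation X := {y : word | lattice y}.
Local Notation wt := (@wt K q n).
Local Notation sem := (@sem K q n).
Local Notation c := (@shape_c n).
Let sMM := @semM K q n q0 qr.
Let sM1 := @sem1 K q n q0 qr.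

Lemma gT_insub (j : nat) : @gT K q n j = if insub j is Some i then T i else 1.
Proof. by rewrite /gT; case: insub. Qed.

(* Matrix entries of a word in the generators, computed along the reversed word
   without reference to the lattice condition. *)
Fixpoint rawc (u : seq nat) (y' y : word) : K :=
  if u is j :: u' then
    if insub j is Some i then
      sa q (cont y (pos0 i)) (cont y (pos1 i)) * rawc u' y' y +
      sb q (cont y (pos0 i)) (cont y (pos1 i)) * rawc u' y' (swapf i y)
    else rawc u' y' y
  else (y' == y)%:R.

Lemma sem_lvec_entry (h : H) (x' x : X) :
  (sem h *m @lvec K n X int c (c x)) (enum_rank x') 0 = sem h (enum_rank x') (enum_rank x).
Proof. by rewrite lvecE -?colE ?mxE //; exact: shape_c_inj. Qed.

Lemma sem_rawc u (x' x : X) :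
  sem (wN q n (rev u)) (enum_rank x') (enum_rank x) = rawc u (val x') (val x).
Proof.
elim: u x => [|j u IH] x.
  by rewrite /wN big_nil sM1 mxE (inj_eq enum_rank_inj) -val_eqE.
rewrite rev_cons wN_rcons gT_insub /=; case: insubP => [i _ _|_]; last by rewrite mulr1 IH.
rewrite -sem_lvec_entry sMM -mulmxA (sem_T q0 qr); last by exists x.
rewrite mulmxDr -!scalemxAr mxE mxE sem_lvec_entry IH -/(c x); congr (_ + _).
rewrite [LHS]mxE.
have [->|nz] := eqVneq (sb q (c x (pos0 i)) (c x (pos1 i))) 0; first by rewrite !mul0r.
have [x2 v2 <-] := shape_c_swap nz.
by rewrite sem_lvec_entry IH v2.
Qed.

Lemma rawc_prefix (m : nat) u (y' y z' z : word) :
  all (fun j => j.+1 < m)%N u ->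
  (forall k : 'I_n, (k < m)%N -> y k = z k /\ y' k = z' k) ->
  (forall k : 'I_n, (m <= k)%N -> y k = y' k /\ z k = z' k) ->
  rawc u y' y = rawc u z' z.
Proof.
elim: u y z => [|j u IH] y z /=.
  move=> _ h1 h2; congr (nat_of_bool _)%:R; apply/eqP/eqP => e; apply/ffunP => k;
    case: (ltnP k m) => km.
  - by have [<- <-] := h1 _ km; rewrite e.
  - by have [_ ->] := h2 _ km.
  - by have [-> ->] := h1 _ km; rewrite e.
  - by have [->] := h2 _ km.
case/andP=> jm um h1 h2; case: insubP => [i _ ij|_]; last exact: IH.
have im : (i.+1 < m)%N by rewrite -[nat_of_ord i]/(val i) ij.
have ec k : (k = pos0 i) \/ (k = pos1 i) -> cont y k = cont z k.
  move=> hk; have km : (k < m)%N by case: hk => -> //=; exact: ltnW.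
  rewrite !ffunE; have [-> _] := h1 _ km; congr (_%:Z - _).
  by apply: cnt_agree => l lk; have [] := h1 l (ltn_trans lk km).
rewrite !ec; try by [left|right].
congr (_ * _ + _ * _); first exact: IH.
have tlt (k : 'I_n) : (tperm (pos0 i) (pos1 i) k < m)%N = (k < m)%N.
  rewrite stperm_val; case: eqP => [->|_]; first by rewrite im ltnW.
  by case: eqP => [->|_] //; rewrite im ltnW.
apply: IH => // k km; rewrite !ffunE.
  by have [-> _] := h1 (tperm (pos0 i) (pos1 i) k) (etrans (tlt k) km); have [_ ->] := h1 k km.
have -> : tperm (pos0 i) (pos1 i) k = k.
  by rewrite tpermD //; apply/eqP => /(congr1 val) /= e; lia.
exact: h2.
Qed.

Lemma rawc_support (m : nat) u (y' y : word) (k : 'I_n) :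
  all (fun j => j.+1 < m)%N u -> (m <= k)%N -> y' k != y k -> rawc u y' y = 0.
Proof.
elim: u y => [|j u IH] y /=.
  by move=> _ _ ne; have /negPf-> : y' != y by apply: contraNneq ne => ->.
case/andP=> jm um mk ne; case: insubP => [i _ ij|_]; last exact: IH.
have ij' : nat_of_ord i = j by exact: ij.
rewrite !IH ?mulr0 ?addr0 //.
by rewrite swapfD //; apply/eqP => /(congr1 val) /= e; lia.
Qed.

Definition taup (h : H) : K := \sum_(x : X) wt (val x) n * sem h (enum_rank x) (enum_rank x).

Let W : 'M[K]_#|{: X}| := diag_mx (\row_k wt (val (enum_val k : X)) n).

Lemma taup_trace h : taup h = \tr (W *m sem h).
Proof.
rewrite /taup /mxtrace (reindex_onto (enum_val : _ -> X) enum_rank) /=; last first.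
  by move=> x _; rewrite enum_rankK.
apply: eq_big => [k|k _]; first by rewrite enum_valK eqxx.
by rewrite mul_diag_mx !mxE enum_valK.
Qed.

(** By [wt_kap] the weight of a tableau depends on its shape only, and T_i has nonzero entries only
    between tableaux of the same shape. *)
Lemma wt_comm h : W *m sem h = sem h *m W.
Proof.
elim/hecke_ind: h => [a|i|g h IHg IHh|g h IHg IHh].
- by rewrite (semZ q0 qr) sM1 -scalemxAl -scalemxAr mulmx1 mul1mx.
- rewrite /W mul_mx_diag mul_diag_mx; apply: enum_mxP => x' x.
  rewrite !mxE !enum_rankK; have [e|ne] := eqVneq (wt (val x') n) (wt (val x) n).
    by rewrite e mulrC.
  have -> : sem (T i) (enum_rank x') (enum_rank x) = 0; last by rewrite mulr0 mul0r.
  rewrite -sem_lvec_entry (sem_T q0 qr); last by exists x.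
  have no y : wt (val x') n != wt (val y) n -> @lvec K n X int c (c y) (enum_rank x') 0 = 0.
    move=> xy; rewrite mxE enum_rankK (inj_eq (@shape_c_inj n)).
    by have [h|//] := eqVneq x' y; rewrite h eqxx in xy.
  rewrite mxE [X in X + _]mxE no // mulr0 add0r mxE.
  have [->|nz] := eqVneq (sb q (c x (pos0 i)) (c x (pos1 i))) 0; first by rewrite mul0r.
  have [x2 v2 <-] := shape_c_swap nz; rewrite no ?mulr0 //.
  rewrite (wt_kap q0 qr (valP x2)) // v2 (_ : cnt (swapf i (val x)) n = cnt (val x) n).
    by rewrite -(wt_kap q0 qr (valP x)).
  by apply: funext => r; apply: cnt_swap; have := ltn_ord i; lia.
- by rewrite (semD q0 qr) mulmxDr mulmxDl IHg IHh.
- by rewrite sMM mulmxA IHg -mulmxA IHh mulmxA.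
Qed.

Lemma taupC g h : taup (g * h) = taup (h * g).
Proof.
by rewrite !taup_trace !sMM mulmxA wt_comm -mulmxA mxtrace_mulC -mulmxA.
Qed.

(** The off-diagonal part of T_i changes the letter at [pos1 i], which u cannot restore. What is
    left is the diagonal coefficient times a function of the earlier letters, and its average is
    0. *)
Lemma taup_gen0 (i : 'I_n.-1) u : all (fun j => j < i)%N u -> taup (wN q n u * T i) = 0.
Proof.
move=> ui; rewrite -[u]revK /taup; set v := rev u.
have vi : all (fun j => j.+1 < i.+1)%N v by rewrite all_rev.
pose F y := rawc v y y.
rewrite (eq_bigr (fun x : X => wt (val x) n * (sa q (cont (val x) (pos0 i)) (cont (val x) (pos1 i)) * F (val x)))); last first.
  move=> x _; congr (_ * _); rewrite -sem_lvec_entry sMM -mulmxA (sem_T q0 qr); last by exists x.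
  rewrite mulmxDr -!scalemxAr mxE mxE sem_lvec_entry sem_rawc -/(c x) -[RHS]addr0; congr (_ + _).
  rewrite [LHS]mxE.
  have [->|nz] := eqVneq (sb q (c x (pos0 i)) (c x (pos1 i))) 0; first by rewrite mul0r.
  have [x2 v2 <-] := shape_c_swap nz; rewrite sem_lvec_entry sem_rawc v2.
  rewrite (rawc_support (k := pos1 i) vi) ?mulr0 // swapf1.
  by have := nonadj_neq (valP x) (sb_neq0 nz); rewrite eq_sym val_eqE.
have h := @sum_wt_alpha K q n q0 qr char0 i F.
rewrite -[RHS]h; last first.
  move=> y z yz; apply: (rawc_prefix vi) => k ki; first by rewrite yz.
  by [].
rewrite [RHS](bigID (fun y => lattice y)) /= [X in _ = _ + X]big1 ?addr0; last first.
  move=> y ny; have [->|nz] := eqVneq (wt y n) 0; first by rewrite mul0r.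
  by case/negP: ny; exact: wt_lattice nz.
rewrite [RHS](reindex_omap (val : X -> word) insub) /=; last first.
  by move=> y ly; rewrite insubT.
apply: eq_bigl => x; rewrite valK eqxx andbT; exact/esym/valP.
Qed.

(** T_i sends the vector of 1 to that of s_i, and the generators in u do not touch the position
    [pos1 i]. All permutations that occur keep the value [pos0 i] there, so 1 is never among
    them. *)
Lemma tau_gen0 (i : 'I_n.-1) u : all (fun j => j < i)%N u -> tau (wN q n u * T i) = 0.
Proof.
pose P (v : 'cV[K]_#|{: 'S_n}|) :=
  forall w : 'S_n, w (pos1 i) != pos0 i -> v (enum_rank w) 0 = 0.
have P_T (j : 'I_n.-1) v : (j < i)%N -> P v -> P (reg (T j) *m v).
  move=> ji Pv w hw; rewrite mulmx_enum big1 // => w' _.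
  have [e|ne] := eqVneq (w' (pos1 i)) (pos0 i); last by rewrite Pv ?mulr0.
  have /matrixP/(_ (enum_rank w) 0) := reg_T_evec q j w'.
  rewrite /evec -colE !mxE !(inj_eq enum_rank_inj) !andbT => ->.
  rewrite [w == w']negbTE; last by apply: contraNneq hw => ->; rewrite e.
  rewrite [w == _]negbTE ?mulr0 ?addr0 ?mul0r //.
  apply: contraNneq hw => ->; rewrite permM tpermD ?e //;
    by apply/eqP => /(congr1 val) /= h; lia.
move=> ui; suff h : P (reg (wN q n u * T i) *m evec K 1).
  have := h 1%g; rewrite perm1 eq_sym pos0_neq_pos1 => /(_ isT).
  by rewrite /evec -colE mxE.
rewrite regM -mulmxA reg_T_evec !perm1 /= ltnSn scale0r add0r scale1r mulg1.
elim: u ui => [_|j u IH /= /andP[ji ui]].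
  rewrite /wN big_nil reg1 mul1mx => w hw; rewrite /evec mxE eqxx andbT (inj_eq enum_rank_inj).
  by rewrite [_ == _]negbTE //; apply: contraNneq hw => ->; rewrite tpermR.
rewrite /wN big_cons -/(wN q n u) regM -mulmxA gT_insub; case: insubP => [k _ kj|_].
  by apply: P_T; [rewrite -[nat_of_ord k]/(val k) kj|exact: IH].
by rewrite reg1 mul1mx; exact: IH.
Qed.

Lemma dw_cons m l : (l < m)%N -> dw m l.+1 = m.-1 :: dw m.-1 l.
Proof.
elim: l => [|l IH] lm; first by rewrite /= subn1.
rewrite -[LHS]/(rcons (dw m l.+1) (m - l.+2)%N) IH; last exact: ltnW.
by rewrite rcons_cons /=; congr (_ :: rcons _ _); lia.
Qed.

Lemma dw_lt m l : (l <= m)%N -> all (fun j => j < m)%N (dw m l).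
Proof.
elim: l => //= l IH lm; rewrite all_rcons IH; last exact: ltnW.
by rewrite andbT; lia.
Qed.

Lemma Nw_lt m s : s \in Nw m -> all (fun j => j.+1 < m)%N s.
Proof.
elim: m s => [|m IH] s; first by rewrite inE => /eqP->.
case/allpairsP => [[t l] [/= tN]]; rewrite -[0%N :: _]/(iota 0 m.+1) mem_iota ltnS /= => lm ->.
rewrite all_cat; apply/andP; split; last exact: dw_lt.
by apply: sub_all (IH _ tN) => j; exact: ltnW.
Qed.

Lemma taup1 : taup 1 = 1.
Proof.
rewrite /taup sM1 -[RHS](@sum_wt1 K q n q0 qr char0).
rewrite [RHS](bigID (fun y => lattice y)) /= [X in _ = _ + X]big1 ?addr0; last first.
  move=> y ny; have [//|nz] := eqVneq (wt y n) 0.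
  by case/negP: ny; exact: wt_lattice nz.
rewrite [RHS](reindex_omap (val : X -> word) insub) /=; last first.
  by move=> y ly; rewrite insubT.
apply: eq_big => [x|x _]; first by rewrite valK eqxx andbT; exact/esym/valP.
by rewrite mxE eqxx mulr1.
Qed.

Lemma tau1 : tau (1 : H) = 1.
Proof. by rewrite /tau reg1 mxE eqxx. Qed.

(** A nontrivial normal form word contains its largest letter exactly once. Both functionals are
    traces, so the word can be rotated until this letter is last, where both vanish. *)
Lemma taup_tau h : taup h = tau h.
Proof.
have [a ->] := hecke_span h; rewrite tau_sum taup_trace (sem_sum q0 qr).
rewrite mulmx_sumr (linear_sum (mxtrace : {scalar _})); apply: eq_bigr => k _.
rewrite tauZ (semZ q0 qr) -scalemxAr /= mxtraceZ -taup_trace; congr (_ * _).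
have : (map (wN q n) (Nw n))`_k \in map (wN q n) (Nw n) by exact: mem_nth.
case/mapP => s sN ->; move: sN; have := leqnn n; move: {1 3}n => m.
elim: m s => [|m IH] s mn; first by rewrite inE => /eqP->; rewrite /wN big_nil taup1 tau1.
case/allpairsP => [[t l] [/= tN]]; rewrite -[0%N :: _]/(iota 0 m.+1) mem_iota ltnS /= => lm ->.
case: l lm => [|l] lm; first by rewrite cats0; apply: IH => //; exact: ltnW.
have hm : (m.-1 < n.-1)%N by lia.
pose i := Ordinal hm.
have tl : all (fun j => j < i)%N (dw m.-1 l ++ t).
  rewrite all_cat dw_lt /=; last by lia.
  by apply: sub_all (Nw_lt tN) => j /=; lia.
rewrite wN_cat dw_cons // -cat1s wN_cat mulrA [wN q n [:: _]]big_seq1 -[m.-1]/(nat_of_ord i) gT_ord.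
by rewrite taupC (tauC q0) !mulrA -wN_cat taup_gen0 // tau_gen0.
Qed.

Lemma sem_inj h : sem h = 0 -> h = 0.
Proof.
move=> e; apply: (tau_nondeg q0) => g; rewrite -taup_tau taup_trace sMM e mul0mx mulmx0.
exact: mxtrace0.
Qed.

End TraceIdentity.

(** * Trace functions on the blocks *)

Section Tableaux.
Variable n : nat.
Local Notation word := {ffun 'I_n -> 'I_n}.
Implicit Type l : n.-tuple 'I_n.+1.

Lemma part_ge l r : (n <= r)%N -> part l r = 0%N.
Proof. by move=> nr; rewrite /part nth_default // size_tuple. Qed.
Lemma part_le l r : (part l r <= n)%N.
Proof. by rewrite -ltnS; exact: ltn_ord. Qed.
Lemma is_partitionP l : is_partition l -> is_part n (part l).
Proof.
move=> /andP[_ /forallP h]; split; last exact: part_ge.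
move=> r; have [rn|nr] := ltnP r n; first exact: (h (Ordinal rn)).
by rewrite part_ge // ltnW.
Qed.

Section OneTableau.
Variables (l : n.-tuple 'I_n.+1) (t : {ffun 'I_n -> 'I_n * 'I_n}).
Hypotheses (lp : is_partition l) (st : std l t).

Definition tword : word := [ffun k => (t k).1].

Lemma std_inj : injective t.
Proof. by case/and3P: st => /injectiveP. Qed.
Lemma std_diag k : ((t k).2 < part l (t k).1)%N.
Proof.
case/and3P: st => _ /eqP e _; have : t k \in diag l by rewrite -e imset_f.
by rewrite inE.
Qed.
Lemma std_box (r j : 'I_n) : (j < part l r)%N -> exists k, t k = (r, j).
Proof.
case/and3P: st => _ /eqP e _ lt; have : (r, j) \in diag l by rewrite inE.
by rewrite -e => /imsetP[k _ ->]; exists k.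
Qed.
Lemma std_row k k' : (t k).1 = (t k').1 -> ((t k).2 < (t k').2)%N -> (k < k')%N.
Proof.
move=> e lt; case/and3P: st => _ _ /forallP/(_ k)/forallP/(_ k')/implyP; apply.
by rewrite e eqxx lt.
Qed.
Lemma std_col k k' : (t k).2 = (t k').2 -> ((t k).1 < (t k').1)%N -> (k < k')%N.
Proof.
move=> e lt; case/and3P: st => _ _ /forallP/(_ k)/forallP/(_ k')/implyP; apply.
by rewrite e eqxx lt orbT.
Qed.

Lemma cnt_card (y : word) m r : cnt y m r = #|[set k : 'I_n | (k < m)%N & y k == r :> nat]|.
Proof. by rewrite -sum1_card big_mkcond /=; apply: eq_bigr => k _; rewrite inE; case: andP. Qed.

Lemma card_ord_lt (m : nat) : (m <= n)%N -> #|[set j : 'I_n | (j < m)%N]| = m.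
Proof.
move=> mn; rewrite -sum1_card -[RHS](card_ord m) -sum1_card.
by rewrite [RHS](big_ord_widen n (fun=> 1%N) mn); apply: eq_bigl => j; rewrite inE.
Qed.

Lemma cnt_tword (k : 'I_n) : cnt tword k (tword k) = (t k).2.
Proof.
rewrite cnt_card -[RHS](card_ord_lt (ltnW (ltn_ord _))).
set A := [set k' | _ & _]; rewrite -(card_in_imset (f := fun k' => (t k').2) (D := A)).
  apply: eq_card => j; rewrite [in RHS]inE; apply/imsetP/idP => [[k']|jk].
    rewrite inE !ffunE => /andP[k'k /eqP/val_inj e] ->.
    case: ltngtP => // [lt|e2]; first by have := std_row (esym e) lt; rewrite ltnNge ltnW.
    have : k' = k by apply: std_inj; rewrite [t k']surjective_pairing [t k]surjective_pairing e (val_inj e2).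
    by move=> ek; rewrite ek ltnn in k'k.
  have [k' e] := std_box (ltn_trans jk (std_diag k)).
  exists k'; last by rewrite e.
  by rewrite inE !ffunE e eqxx andbT std_row // e.
move=> k1 k2; rewrite !inE !ffunE => /andP[_ /eqP/val_inj e1] /andP[_ /eqP/val_inj e2] e.
by apply: std_inj; rewrite [t k1]surjective_pairing [t k2]surjective_pairing e1 e2 e.
Qed.

Lemma cont_tword k : cont tword k = content (t k).
Proof. by rewrite ffunE cnt_tword ffunE. Qed.

(** The box above a box of row r + 1 holds a smaller entry, which injects the entries of row r + 1
    below any bound into those of row r. *)
Lemma lattice_tword : lattice tword.
Proof.
have [anti _] := is_partitionP lp.
apply/latticeP => m r; have [rn|nr] := ltnP r n; last first.
  by rewrite cnt_row_ge // ltnW.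
rewrite !cnt_card.
have ex (k : 'I_n) : exists k' : 'I_n, (tword k == r.+1 :> nat) ==>
   [&& (k' < k)%N, tword k' == r :> nat & (t k').2 == (t k).2].
  case: (_ =P _) => [|_]; last by exists k.
  rewrite ffunE => e; have lt : ((t k).2 < part l (Ordinal rn))%N.
    by apply: leq_trans (anti _); rewrite -e std_diag.
  have [k' e'] := std_box lt; exists k'; rewrite /= !ffunE e' !eqxx !andbT.
  by apply: std_col; rewrite e' //= e.
have [f hf] := choice ex.
set A := [set k : 'I_n | _ & _]; rewrite -(card_in_imset (f := f) (D := A)).
  apply/subset_leq_card/subsetP => _ /imsetP[k + ->]; rewrite !inE => /andP[km ek].
  by have := hf k; rewrite ek => /and3P[lt -> _]; rewrite andbT (ltn_trans lt).
move=> k1 k2; rewrite !inE => /andP[_ e1] /andP[_ e2] e12.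
have := hf k1; have := hf k2; rewrite e1 e2 e12 => /and3P[_ _ /eqP h2] /and3P[_ _ /eqP h1].
apply: std_inj; rewrite [t k1]surjective_pairing [t k2]surjective_pairing -h1 -h2.
by congr pair; apply: val_inj; rewrite /=; move: e1 e2; rewrite !ffunE => /eqP-> /eqP->.
Qed.

Lemma cnt_tword_end : cnt tword n = part l.
Proof.
apply: funext => r; have [rn|nr] := ltnP r n; last by rewrite cnt_row_ge // part_ge.
rewrite cnt_card -[RHS](card_ord_lt (part_le l r)).
set A := [set k' | _ & _]; rewrite -(card_in_imset (f := fun k' => (t k').2) (D := A)).
  apply: eq_card => j; rewrite [in RHS]inE; apply/imsetP/idP => [[k']|jk].
    by rewrite inE !ffunE => /andP[_ /eqP <-] ->; exact: std_diag.
  have [k' e] := @std_box (Ordinal rn) j jk.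
  by exists k'; rewrite ?inE ?ffunE e //= ltn_ord eqxx.
move=> k1 k2; rewrite !inE !ffunE => /andP[_ /eqP e1] /andP[_ /eqP e2] e.
apply: std_inj; rewrite [t k1]surjective_pairing [t k2]surjective_pairing e.
by congr pair; apply: val_inj; rewrite /= e1 e2.
Qed.
End OneTableau.

Lemma klam_kap (K : fieldType) (q : K) l : q != 0 -> (forall m, (0 < m)%N -> q ^+ m != 1) ->
  is_partition l -> klam q l = kap q n (part l).
Proof.
move=> q0 qr lp; have pt := is_partitionP lp.
rewrite /kap (eq_bigr _ (fun a _ => rowh_hooks q0 qr a pt)) big_split /=.
rewrite /klam; congr (_ * _).
  rewrite /nlam; elim/big_rec2: _ => [|a x y _ IH]; first by rewrite expr0.
  by rewrite exprD IH.
transitivity (\prod_(a < n) \prod_(j < n | (j < part l a)%N) (qint q (hook l (a, j)))^-1).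
  rewrite pair_big_dep /=; apply: eq_big => [[a j]|[a j] _] //=.
  by rewrite inE.
apply: eq_bigr => a _; rewrite prodfV; congr _^-1.
rewrite (big_ord_widen n (fun j => qn q ((part l a - j.+1) + (col n (part l) j - a.+1)).+1) (part_le l a)).
apply: eq_bigr => j _; rewrite /qn /qint /hook /=; congr ((_ - 1) / _).
congr (q ^+ (_ + (_ - _)).+1); rewrite /colen /col -sum1_card big_mkcond /=.
by apply: eq_bigr => i _; rewrite inE; case: ltnP.
Qed.

End Tableaux.

(** * Primitive idempotents and the sum over a block *)

Section HeckeBlocks.
Variables (K : fieldType) (q : K) (n : nat).
Hypothesis q0 : q != 0.
Hypothesis qr : forall m, (0 < m)%N -> q ^+ m != 1.
Hypothesis char0 : [pchar K] =i pred0.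
Local Notation H := (hecke q n).
Local Notation T := (@Tgn K q n).
Local Notation word := {ffun 'I_n -> 'I_n}.
Local Notation X := {y : word | lattice y}.
Local Notation sem := (@sem K q n).
Local Notation c := (@shape_c n).
Let sMM := @semM K q n q0 qr.

Definition Eidem (x : X) : H := Ec q (c x).

Lemma sem_ext (g h : H) : sem g = sem h -> g = h.
Proof.
move=> e; apply/eqP; rewrite -subr_eq0; apply/eqP/(sem_inj q0 qr char0).
by rewrite (semB q0 qr) e subrr.
Qed.

Lemma sem_E_l x h y z : sem (Eidem x * h) (enum_rank y) (enum_rank z) =
  (y == x)%:R * sem h (enum_rank x) (enum_rank z).
Proof.
rewrite sMM mulmx_enum (bigD1 x) //= (sem_Ec_entry q0 qr) eqxx andbT big1 ?addr0 // => w wx.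
by rewrite (sem_Ec_entry q0 qr) (negPf wx) andbF mul0r.
Qed.
Lemma sem_E_r x h y z : sem (h * Eidem x) (enum_rank y) (enum_rank z) =
  sem h (enum_rank y) (enum_rank x) * (z == x)%:R.
Proof.
rewrite sMM mulmx_enum (bigD1 x) //= (sem_Ec_entry q0 qr) eqxx /= big1 ?addr0 // => w wx.
by rewrite (sem_Ec_entry q0 qr) (negPf wx) mulr0.
Qed.

Lemma E_idem x : Eidem x * Eidem x = Eidem x.
Proof.
apply: sem_ext; apply: enum_mxP => y z.
rewrite sem_E_l !(sem_Ec_entry q0 qr) eqxx /=.
by case: (y == x); rewrite ?mul1r ?mul0r.
Qed.

Lemma E_mul_E x h : Eidem x * h * Eidem x = sem h (enum_rank x) (enum_rank x) *: Eidem x.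
Proof.
apply: sem_ext; apply: enum_mxP => y z; rewrite sem_E_r sem_E_l (semZ q0 qr) mxE (sem_Ec_entry q0 qr).
by case: (y == x); rewrite ?mul1r ?mulr0 ?mul0r ?mulr1 /=.
Qed.

Lemma tau_E x : tau (Eidem x) = wt q (val x) n.
Proof.
rewrite -(taup_tau q0 qr char0) /taup (bigD1 x) //= (sem_Ec_entry q0 qr) eqxx mulr1.
by rewrite big1 ?addr0 // => y yx; rewrite (sem_Ec_entry q0 qr) (negPf yx) mulr0.
Qed.

Section Traces.
Variables (A : algType K) (phi psi : {linear H -> A}).
Hypotheses (phiC : forall x y, phi (x * y) = phi (y * x))
           (psiC : forall x y, psi (x * y) = psi (y * x)).

(** The sum of q^(-l(w)) T_w (x) T_(w^-1) is the Casimir element of tau: expanding x T_w on the left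
    or T_(v^-1) x on the right leads to the same double sum [B]. *)
Lemma casimir (x y : H) :
  \sum_w q ^- inv w *: (phi (x * Tw q w) * psi (y * Tw q w^-1%g)) =
  \sum_w q ^- inv w *: (phi (Tw q w) * psi (y * Tw q w^-1%g * x)).
Proof.
pose B v w := (q ^- inv w * (q ^- inv v * tau (x * Tw q w * Tw q v^-1%g))) *:
     (phi (Tw q v) * psi (y * Tw q w^-1%g)).
transitivity (\sum_w \sum_v B v w).
  apply: eq_bigr => w _; rewrite {1}[x * _](tau_dual q0) linear_sum mulr_suml scaler_sumr.
  by apply: eq_bigr => v _; rewrite linearZ /= -scalerAl scalerA.
rewrite exchange_big; apply: eq_bigr => v _ /=.
rewrite -[y * _ * x]mulrA {1}[Tw q v^-1%g * x](tau_dual q0) mulr_sumr linear_sum mulr_sumr scaler_sumr.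
rewrite [RHS](reindex_inj invg_inj); apply: eq_bigr => w _ /=.
rewrite invV invgK -scalerAr linearZ /= -scalerAr scalerA /B; congr (_ *: _).
by rewrite mulrCA; congr (_ * (_ * _)); rewrite (tauC q0) mulrA.
Qed.

(** Since psi is a trace, a second E can be inserted in its argument; [casimir] carries it over to
    phi, and then every T_w sits inside E T_w E, a multiple of E. *)
Lemma casimir_E x :
  \sum_w q ^- inv w *: (phi (Tw q w) * psi (Eidem x * Tw q w^-1%g)) =
  (wt q (val x) n)^-1 *: (phi (Eidem x) * psi (Eidem x)).
Proof.
set E := Eidem x; pose a w := sem (Tw q w) (enum_rank x) (enum_rank x).
have tE : tau E = wt q (val x) n by exact: tau_E.
have EE : E * E = E by exact: E_idem.
have EhE h : E * h * E = sem h (enum_rank x) (enum_rank x) *: E by exact: E_mul_E.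
have tETw w : tau (E * Tw q w) = a w * tau E.
  by rewrite -{1}EE -mulrA (tauC q0) EhE tauZ.
(* The sum of the scalars left at the end is evaluated by expanding E itself in the dual bases and
   reading the diagonal entry at x, which is 1. *)
have sum_a : (\sum_w q ^- inv w * (a w * a w^-1%g)) * tau E = 1.
  have : sem E (enum_rank x) (enum_rank x) = 1 by rewrite (sem_Ec_entry q0 qr) eqxx.
  rewrite {1}[E](tau_dual q0) (sem_sum q0 qr) summxE => <-; rewrite mulr_suml.
  apply: eq_bigr => w _; rewrite (semZ q0 qr) mxE tETw -/(a w); ring.
have s_neq0 : tau E != 0 by apply: contra_eq_neq sum_a => ->; rewrite mulr0 eq_sym oner_eq0.
have -> : (wt q (val x) n)^-1 = \sum_w q ^- inv w * (a w * a w^-1%g).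
  by rewrite -tE; apply: (mulIf s_neq0); rewrite mulVf.
transitivity (\sum_w q ^- inv w *: (phi (Tw q w) * psi (E * Tw q w^-1%g * E))).
  apply: eq_bigr => w _; congr (_ *: (_ * _)).
  by rewrite -{1}EE -mulrA psiC.
rewrite -casimir scaler_suml; apply: eq_bigr => w _.
have pE (f : {linear H -> A}) v : (forall x y, f (x * y) = f (y * x)) -> f (E * Tw q v) = a v *: f E.
  by move=> fC; rewrite -{1}EE -mulrA fC EhE linearZ.
rewrite !pE // -scalerAl -scalerAr !scalerA; congr (_ *: _); ring.
Qed.

End Traces.

Section OneTrace.
Variables (A : algType K) (phi : {linear H -> A}).
Hypothesis phiC : forall x y, phi (x * y) = phi (y * x).

Lemma sb_gap (u v : int) : u - v < -1 -> sb q u v != 0 /\ sb q v u != 0.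
Proof.
have h (s t : int) : s - t <> 1 -> t - s <> 1 -> s != t -> sb q s t != 0.
  move=> st ts ne; rewrite /sb; case: (_ =P 1%N) => [e|_]; first by exfalso; lia.
  apply: mulf_neq0; last by rewrite invr_eq0; exact: (qz_sub_neq0 q0 qr).
  rewrite -{1}[q]expr1z -expfzDr // subr_eq0 (inj_eq (qz_inj q0 qr)); apply/eqP; lia.
by move=> lt; split; apply: h; try (apply/eqP); lia.
Qed.

(** The products of E_x T_i E_x' and E_x' T_i E_x in the two orders are the same nonzero multiple of
    E_x and of E_x', and a trace function does not see the order. *)
Lemma phi_E_swap (x x' : X) (i : 'I_n.-1) : val x' = swapf i (val x) ->
  sb q (c x (pos0 i)) (c x (pos1 i)) != 0 -> c x (pos0 i) - c x (pos1 i) < -1 ->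
  phi (Eidem x) = phi (Eidem x').
Proof.
move=> ex nz adj; have cx' : c x' = swapf i (c x).
  have [x2 v2 <-] := shape_c_swap nz; congr (c _); apply: val_inj; by rewrite ex v2.
have nz' : sb q (c x' (pos0 i)) (c x' (pos1 i)) != 0.
  by rewrite cx' swapf0 swapf1; exact: (sb_gap adj).2.
have sT (y y' : X) : c y' = swapf i (c y) ->
    sem (T i) (enum_rank y') (enum_rank y) = sb q (c y (pos0 i)) (c y (pos1 i)).
  move=> cy; rewrite -sem_lvec_entry (sem_T q0 qr); last by exists y.
  rewrite -cy !mxE !enum_rankK eqxx mulr1 [_ == _]negbTE ?mulr0 ?add0r //.
  rewrite cy; apply/eqP => /ffunP/(_ (pos0 i)); rewrite swapf0 => /eqP.
  by rewrite eq_sym (negPf (cont_dist1 i (valP y))).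
have s1 := sT x x' cx'.
have s2 : sem (T i) (enum_rank x) (enum_rank x') = sb q (c x' (pos0 i)) (c x' (pos1 i)).
  by rewrite sT // cx' swapfK.
set s := sb q (c x _) _ in nz s1; set s' := sb q (c x' _) _ in nz' s2.
have e (y z : X) u v : sem (T i) (enum_rank y) (enum_rank z) = u ->
    sem (T i) (enum_rank z) (enum_rank y) = v ->
    (Eidem y * T i * Eidem z) * (Eidem z * T i * Eidem y) = (u * v) *: Eidem y.
  move=> hu hv; transitivity (Eidem y * (T i * Eidem z * T i) * Eidem y).
    by rewrite -[in RHS](E_idem z) !mulrA.
  rewrite E_mul_E; congr (_ *: _).
  rewrite -mulrA sMM mulmx_enum (bigD1 z) //= big1 ?addr0 => [|w wz].
    by rewrite sem_E_l eqxx mul1r hu hv.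
  by rewrite sem_E_l (negPf wz) mul0r mulr0.
have ss : s' * s != 0 by exact: mulf_neq0.
by apply: (scalerI ss); rewrite -!linearZ -(e _ _ _ _ s2 s1) phiC (e _ _ _ _ s1 s2) mulrC.
Qed.

Lemma phi_E_swap_desc (x : X) (i : 'I_n.-1) : (val x (pos1 i) < val x (pos0 i))%N ->
  exists2 x' : X, val x' = swapf i (val x) & phi (Eidem x) = phi (Eidem x').
Proof.
move=> desc; have adj := desc_nonadj (valP x) desc; rewrite -/(c x) in adj.
have nz : sb q (c x (pos0 i)) (c x (pos1 i)) != 0.
  exact: (sb_gap adj).1.
by have [x' ex _] := shape_c_swap nz; exists x' => //; exact: phi_E_swap ex nz adj.
Qed.

(** A bounded quantity that grows with every removed descent, so that bubble sort by adjacent swaps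
    terminates. *)
Definition desc_measure (y : word) : nat := (\sum_(k < n) k * y k)%N.

Lemma desc_measure_le y : (desc_measure y <= n * (n * n))%N.
Proof.
rewrite -[n in leqRHS]card_ord -sum_nat_const card_ord; apply: leq_sum => k _.
by apply: leq_mul; exact: ltnW.
Qed.

Lemma desc_measure_swap (y : word) (i : 'I_n.-1) : (y (pos1 i) < y (pos0 i))%N ->
  (desc_measure y < desc_measure (swapf i y))%N.
Proof.
move=> desc; have ne := pos0_neq_pos1 i; rewrite /desc_measure.
have sp (z : word) : (\sum_(k < n) k * z k = i * z (pos0 i) + (i.+1 * z (pos1 i) +
    \sum_(k < n | (k != pos0 i) && (k != pos1 i)) k * z k))%N.
  by rewrite (bigD1 (pos0 i)) // (bigD1 (pos1 i)) // eq_sym.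
rewrite !sp swapf0 swapf1 [X in (_ < _ + (_ + X))%N](eq_bigr (fun k : 'I_n => (k * y k)%N)).
  move: desc; rewrite !mulSn; move: (y (pos0 i)) (y (pos1 i)) => a b; move: (\sum_(k < n | _) _)%N => S.
  lia.
by move=> k /andP[k0 k1]; rewrite swapfD.
Qed.

Lemma sorted_word (y : word) : (forall i : 'I_n.-1, y (pos0 i) <= y (pos1 i))%N ->
  sorted leq [seq val (y k) | k <- enum 'I_n].
Proof.
move=> h; apply/(sortedP 0%N) => m; rewrite size_map size_enum_ord => lt.
have hm := lt_pred lt; pose i := Ordinal hm; have := h i.
have e0 : nth (pos0 i) (enum 'I_n) m = pos0 i.
  by apply: val_inj; rewrite /= nth_enum_ord //; exact: ltnW.
have e1 : nth (pos0 i) (enum 'I_n) m.+1 = pos1 i.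
  by apply: val_inj; rewrite /= nth_enum_ord.
by rewrite !(nth_map (pos0 i)) -?enumT ?size_enum_ord ?(ltnW lt) // e0 e1.
Qed.

Lemma word_sorted_inj (y y' : word) : cnt y n = cnt y' n ->
  (forall i : 'I_n.-1, y (pos0 i) <= y (pos1 i))%N ->
  (forall i : 'I_n.-1, y' (pos0 i) <= y' (pos1 i))%N -> y = y'.
Proof.
move=> e /sorted_word s /sorted_word s'.
have cm (z : word) r : count_mem r [seq val (z k) | k <- enum 'I_n] = cnt z n r.
  rewrite count_map -sum1_count -?enumT big_enum_cond big_mkcond /=.
  by apply: eq_bigr => k _; rewrite ltn_ord; case: eqP.
have pe : perm_eq [seq val (y k) | k <- enum 'I_n] [seq val (y' k) | k <- enum 'I_n].
  by apply/allP => r _ /=; rewrite !cm e.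
have := sorted_eq leq_trans anti_leq s s' pe.
move/eq_in_map => h; apply/ffunP => k; apply: val_inj; apply: h.
exact: mem_enum.
Qed.

(** Removing a descent changes neither the shape nor the value of phi. A word without descents fills
    the diagram row by row and is determined by the shape, which gives [phi_E_shape]. *)
Lemma phi_E_sorted (x : X) : exists x' : X,
  [/\ phi (Eidem x) = phi (Eidem x'), cnt (val x) n = cnt (val x') n &
      forall i : 'I_n.-1, (val x' (pos0 i) <= val x' (pos1 i))%N].
Proof.
have [m] := ubnP (n * (n * n) - desc_measure (val x))%N.
elim: m x => // m IH x lt.
have [/existsP[i desc]|] := boolP [exists i : 'I_n.-1, (val x (pos1 i) < val x (pos0 i))%N]; last first.
  by rewrite negb_exists => /forallP h; exists x; split=> // i; have := h i; rewrite -leqNgt.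
have [x' ex ephi] := phi_E_swap_desc desc.
have dm := desc_measure_swap desc; have := desc_measure_le (val x'); rewrite -ex in dm => dle.
have [|x'' [h1 h2 h3]] := IH x'; first by move: lt; lia.
exists x''; split=> //; first by rewrite ephi.
by rewrite -h2 ex; apply: funext => r; rewrite cnt_swap //; have := ltn_ord i; lia.
Qed.

Lemma phi_E_shape (x x' : X) : cnt (val x) n = cnt (val x') n ->
  phi (Eidem x) = phi (Eidem x').
Proof.
move=> e; have [y [-> c1 s1]] := phi_E_sorted x; have [y' [-> c2 s2]] := phi_E_sorted x'.
by congr (phi (Eidem _)); apply: val_inj; apply: word_sorted_inj; rewrite // -c1 -c2.
Qed.

(** Nondegeneracy of tau provides y with E y e E = a E and a nonzero. Then f = a^-1 e E y e is a
    nonzero idempotent below e, equal to e by primitivity, and cyclicity turns phi(f) into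
    phi(E). *)
Lemma phi_primitive (e : H) (x : X) : primitive_idempotent e -> e * Eidem x != 0 ->
  phi e = phi (Eidem x).
Proof.
move=> [_ ee prim] nz; pose E := Eidem x.
have [y ny] : exists y, E * y * e * E != 0.
  apply: contrapT => h; case/eqP: nz; apply: (tau_nondeg q0) => y.
  rewrite -/E; have -> : e * E * y = (e * E) * (E * y).
    by rewrite !mulrA -[e * E * E]mulrA (E_idem x : E * E = E).
  rewrite (tauC q0) !mulrA.
  have [->|ne] := eqVneq (E * y * e * E) 0; first by rewrite /tau linear0 mxE.
  by case: h; exists y.
have [a ea] : exists a, E * y * e * E = a *: E.
  by exists (sem (y * e) (enum_rank x) (enum_rank x)); rewrite -E_mul_E -/E !mulrA.
have a0 : a != 0 by apply: contraNneq ny => z; rewrite ea z scale0r.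
pose f := a^-1 *: (e * E * y * e).
have ef : e * f = f by rewrite /f -scalerAr !mulrA ee.
have fe : f * e = f by rewrite /f -scalerAl -!mulrA ee.
have ff : f * f = f.
  rewrite /f -scalerAl -scalerAr; congr (_ *: _).
  have -> : e * E * y * e * (e * E * y * e) = e * (E * y * (e * e) * E) * y * e by rewrite !mulrA.
  by rewrite ee ea -scalerAr -!scalerAl scalerA mulVf // scale1r.
have f0 : f != 0.
  apply: contraNneq ny => z.
  have : E * y * f * E = 0 by rewrite z mulr0 mul0r.
  rewrite /f -scalerAr -scalerAl => /eqP; rewrite scaler_eq0 invr_eq0 (negPf a0) /=.
  have -> : E * y * (e * E * y * e) * E = (E * y * e * E) * y * e * E by rewrite !mulrA.
  rewrite ea -!scalerAl scaler_eq0 (negPf a0) /= => h.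
  by rewrite -ea.
have ff' : f * (e - f) = 0 by rewrite mulrBr fe ff subrr.
have f'f : (e - f) * f = 0 by rewrite mulrBl ef ff subrr.
have f'f' : (e - f) * (e - f) = e - f by rewrite mulrBl ff' subr0 mulrBr ee ef.
have := prim f (e - f) ff f'f' ff' f'f; rewrite addrC subrK => /(_ erefl)[/eqP|/eqP].
  by rewrite (negPf f0).
rewrite subr_eq0 => /eqP efe; apply: (scalerI a0).
rewrite -[RHS]linearZ -/E -ea [in LHS]efe /f linearZ scalerA mulfV // scale1r.
transitivity (phi (e * (E * y))); first by rewrite phiC !mulrA ee.
by rewrite phiC [RHS]phiC !mulrA (E_idem x : E * E = E).
Qed.
End OneTrace.

Lemma Et_tword (l : n.-tuple 'I_n.+1) t : is_partition l -> std l t ->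
  exists2 x : X, Et q t = Eidem x & cnt (val x) n = part l.
Proof.
move=> lp st; exists (exist (fun y : word => is_true (lattice y)) _ (lattice_tword lp st)) => /=.
  rewrite /Eidem /c /= -[Et q t]/(Ec q (fun m => content (t m))); congr (Ec q).
  by apply: funext => m; rewrite (cont_tword st).
exact: cnt_tword_end st.
Qed.

Theorem sum_trace_block (A : algType K) (phi psi : {linear H -> A})
    (l : n.-tuple 'I_n.+1) (e : H) :
  (forall x y, phi (x * y) = phi (y * x)) -> (forall x y, psi (x * y) = psi (y * x)) ->
  is_partition l -> primitive_idempotent e -> in_block l e ->
  \sum_w q ^- plength w *: (phi (Tw q w) * psi (Flam q l * Tw q w^-1%g)) =
  ((dlam l)%:R / klam q l) *: (phi e * psi e).
Proof.
move=> phiC psiC lp pe be.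
(* e = e F_l and F_l is a sum of the E_t, so e cannot annihilate all of them. *)
have [t0 st0 nz] : exists2 t, std l t & e * Et q t != 0.
  apply: contrapT => h; case: pe => /eqP[]; rewrite -be /Flam mulr_sumr.
  apply: big1 => t st; have [//|ne] := eqVneq (e * Et q t) 0.
  by case: h; exists t.
have [x0 ex0 cx0] := Et_tword lp st0; rewrite ex0 in nz.
have term t : std l t ->
   \sum_w q ^- inv w *: (phi (Tw q w) * psi (Et q t * Tw q w^-1%g)) =
   (klam q l)^-1 *: (phi e * psi e).
  move=> st; have [x -> cx] := Et_tword lp st.
  rewrite casimir_E // (wt_kap q0 qr (valP x) (leqnn n)) cx -klam_kap //.
  rewrite (phi_primitive phiC pe nz) (phi_primitive psiC pe nz).
  have e0 : cnt (val x0) n = cnt (val x) n by rewrite cx0 cx.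
  by rewrite (phi_E_shape phiC e0) (phi_E_shape psiC e0).
transitivity (\sum_(t | std l t) \sum_w q ^- inv w *: (phi (Tw q w) * psi (Et q t * Tw q w^-1%g))).
  rewrite exchange_big; apply: eq_bigr => w _; rewrite plength_inv /Flam mulr_suml.
  by rewrite linear_sum mulr_sumr scaler_sumr.
rewrite (eq_bigr _ term) sumr_const -scaler_nat scalerA; congr ((_%:R / _) *: _).
by rewrite /dlam; apply: eq_card => t; rewrite inE.
Qed.

End HeckeBlocks.

(** * Operators on tensor powers *)

(* mathcomp's rat.Rat shadows the local operators of Defs. *)
Local Notation Rat := Defs.Rat.

Section TripleSums.
Variables (V : nmodType) (d : nat).
Lemma sum3_pair (F : 'I_d -> 'I_d -> 'I_d -> V) :
  \sum_a \sum_b \sum_c F a b c = \sum_(t : 'I_d * 'I_d * 'I_d) F t.1.1 t.1.2 t.2.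
Proof. by rewrite pair_bigA pair_bigA. Qed.
Lemma exchange33 (F : 'I_d -> 'I_d -> 'I_d -> 'I_d -> 'I_d -> 'I_d -> V) :
  \sum_a \sum_b \sum_c \sum_e \sum_f \sum_g F a b c e f g =
  \sum_e \sum_f \sum_g \sum_a \sum_b \sum_c F a b c e f g.
Proof.
rewrite !sum3_pair; under eq_bigr => t _ do rewrite sum3_pair.
by rewrite exchange_big; apply: eq_bigr => t _; rewrite sum3_pair.
Qed.
End TripleSums.

Section LocalOperators.
Variables (K : fieldType) (d n : nat).
Local Notation tup := (n.-tuple 'I_d).
Implicit Types (I J L : tup) (i : 'I_n.-1).
Local Notation tensor4 := ('I_d -> 'I_d -> 'I_d -> 'I_d -> K).

Definition upd2 I i (a b : 'I_d) : tup :=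
  [tuple if k == pos0 i then a else if k == pos1 i then b else tnth I k | k < n].

Lemma upd2_0 I i a b : tnth (upd2 I i a b) (pos0 i) = a.
Proof. by rewrite tnth_mktuple eqxx. Qed.
Lemma upd2_1 I i a b : tnth (upd2 I i a b) (pos1 i) = b.
Proof. by rewrite tnth_mktuple eq_sym (negPf (pos0_neq_pos1 i)) eqxx. Qed.
Lemma upd2_D I i a b k : k != pos0 i -> k != pos1 i -> tnth (upd2 I i a b) k = tnth I k.
Proof. by rewrite tnth_mktuple => /negPf-> /negPf->. Qed.

Definition agree i I J : bool :=
  [forall k, (k != pos0 i) && (k != pos1 i) ==> (tnth I k == tnth J k)].
Lemma agree_upd2 i I a b : agree i I (upd2 I i a b).
Proof. by apply/forallP => k; apply/implyP => /andP[h0 h1]; rewrite upd2_D. Qed.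
Lemma agreeC i I J : agree i I J = agree i J I.
Proof. by apply: eq_forallb => k; rewrite [_ == tnth J k]eq_sym. Qed.
Lemma upd2_agree i I J : agree i I J -> upd2 I i (tnth J (pos0 i)) (tnth J (pos1 i)) = J.
Proof.
move=> /forallP h; apply: eq_from_tnth => k; rewrite tnth_mktuple.
have [->//|n0] := eqVneq k (pos0 i); have [->//|n1] := eqVneq k (pos1 i).
by have := h k; rewrite n0 n1 => /eqP.
Qed.

Lemma RatE (R : tensor4) i I J : Rat R i (enum_rank I) (enum_rank J) =
  (agree i I J)%:R * R (tnth I (pos0 i)) (tnth I (pos1 i)) (tnth J (pos0 i)) (tnth J (pos1 i)).
Proof. by rewrite mxE !enum_rankK. Qed.

Lemma sum_agree (V : nmodType) i I (F : tup -> V) :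
  \sum_(J | agree i I J) F J = \sum_a \sum_b F (upd2 I i a b).
Proof.
rewrite pair_bigA (reindex_onto (fun p : 'I_d * 'I_d => upd2 I i p.1 p.2)
   (fun J => (tnth J (pos0 i), tnth J (pos1 i)))) /= => [|J]; last exact: upd2_agree.
by apply: eq_bigl => -[a b]; rewrite agree_upd2 upd2_0 upd2_1 eqxx.
Qed.

Lemma sum_Rat_row (V : lmodType K) (R : tensor4) i I (F : tup -> V) :
  \sum_J Rat R i (enum_rank I) (enum_rank J) *: F J =
  \sum_a \sum_b R (tnth I (pos0 i)) (tnth I (pos1 i)) a b *: F (upd2 I i a b).
Proof.
rewrite (bigID (agree i I)) /= [X in _ + X]big1 ?addr0 => [|J nJ]; last first.
  by rewrite RatE (negPf nJ) mul0r scale0r.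
rewrite sum_agree; apply: eq_bigr => a _; apply: eq_bigr => b _.
by rewrite RatE agree_upd2 mul1r upd2_0 upd2_1.
Qed.

Lemma sum_Rat_col (V : lmodType K) (R : tensor4) i L (F : tup -> V) :
  \sum_J Rat R i (enum_rank J) (enum_rank L) *: F J =
  \sum_a \sum_b R a b (tnth L (pos0 i)) (tnth L (pos1 i)) *: F (upd2 L i a b).
Proof.
rewrite (bigID (agree i L)) /= [X in _ + X]big1 ?addr0 => [|J nJ]; last first.
  by rewrite RatE agreeC (negPf nJ) mul0r scale0r.
rewrite sum_agree; apply: eq_bigr => a _; apply: eq_bigr => b _.
by rewrite RatE agreeC agree_upd2 mul1r upd2_0 upd2_1.
Qed.

Lemma Rat_mul_row (R : tensor4) i (B : tmat K d n) I k :
  (Rat R i *m B) (enum_rank I) k = \sum_a \sum_b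
    R (tnth I (pos0 i)) (tnth I (pos1 i)) a b * B (enum_rank (upd2 I i a b)) k.
Proof. by rewrite mulmx_enum (sum_Rat_row (V := K^o) R i I (fun J => B (enum_rank J) k)). Qed.
Lemma Rat_mul_col (R : tensor4) i (B : tmat K d n) k L :
  (B *m Rat R i) k (enum_rank L) = \sum_a \sum_b
    B k (enum_rank (upd2 L i a b)) * R a b (tnth L (pos0 i)) (tnth L (pos1 i)).
Proof.
rewrite mulmx_enum; have := sum_Rat_col (V := K^o) R i L (fun J => B k (enum_rank J)).
rewrite /GRing.scale /=; under eq_bigr => J _ do rewrite mulrC.
move=> ->; apply: eq_bigr => a _; apply: eq_bigr => b _; exact: mulrC.
Qed.

Definition delta4 : tensor4 := fun k l (i j : 'I_d) => (k == i)%:R * (l == j)%:R.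

Lemma upd2_id i I : upd2 I i (tnth I (pos0 i)) (tnth I (pos1 i)) = I.
Proof. by apply: upd2_agree; apply/forallP => k; apply/implyP. Qed.

Lemma sum_delta (F : 'I_d -> K) (j : 'I_d) : \sum_(a < d) (j == a)%:R * F a = F j.
Proof.
rewrite (bigD1 j) //= eqxx mul1r big1 ?addr0 // => i ij.
by rewrite eq_sym (negPf ij) mul0r.
Qed.
Lemma sum_delta_r (F : 'I_d -> K) (j : 'I_d) : \sum_(a < d) F a * (a == j)%:R = F j.
Proof. by rewrite -[RHS]sum_delta; apply: eq_bigr => i _; rewrite mulrC eq_sym. Qed.

Lemma Rat_delta i : Rat delta4 i = 1%:M.
Proof.
apply: enum_mxP => I L; rewrite -[LHS]mulr1 -[Rat _ _]mulmx1 Rat_mul_row.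
rewrite mulr1 /delta4; under eq_bigr => a _ do under eq_bigr => b _ do rewrite -mulrA.
under eq_bigr => a _ do rewrite -mulr_sumr sum_delta.
by rewrite sum_delta upd2_id.
Qed.

Lemma Rat_linear (a : K) (R R' : tensor4) i :
  Rat (fun k l m p => a * R k l m p + R' k l m p) i = a *: Rat R i + Rat R' i.
Proof. by apply: enum_mxP => I L; rewrite [RHS]mxE [X in _ = X + _]mxE !RatE mulrDr mulrCA. Qed.

Definition comp4 (R R' : tensor4) : tensor4 :=
  fun k l (i j : 'I_d) => \sum_a \sum_b R k l a b * R' a b i j.

Lemma Rat_comp (R R' : tensor4) i : Rat R i *m Rat R' i = Rat (comp4 R R') i.
Proof.
apply: enum_mxP => I L; rewrite Rat_mul_row RatE /comp4 !mulr_sumr; apply: eq_bigr => a _.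
rewrite mulr_sumr; apply: eq_bigr => b _; rewrite RatE upd2_0 upd2_1 mulrCA.
suff -> : agree i (upd2 I i a b) L = agree i I L by [].
apply: eq_forallb => k; case: (altP (k =P pos0 i)) => //= n0.
by case: (altP (k =P pos1 i)) => //= n1; rewrite upd2_D.
Qed.

Lemma Rat_comm (R R' : tensor4) (i j : 'I_n.-1) : (i.+1 < j)%N ->
  Rat R i *m Rat R' j = Rat R' j *m Rat R i.
Proof.
move=> ij.
have h00 : pos0 i != pos0 j by apply/eqP => /(congr1 val) /= h; lia.
have h01 : pos0 i != pos1 j by apply/eqP => /(congr1 val) /= h; lia.
have h10 : pos1 i != pos0 j by apply/eqP => /(congr1 val) /= h; lia.
have h11 : pos1 i != pos1 j by apply/eqP => /(congr1 val) /= h; lia.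
have uC I a b a' b' : upd2 (upd2 I i a b) j a' b' = upd2 (upd2 I j a' b') i a b.
  apply: eq_from_tnth => k; rewrite !tnth_mktuple.
  case: (altP (k =P pos0 i)) => [->|_]; first by rewrite (negPf h00) (negPf h01).
  by case: (altP (k =P pos1 i)) => [->|_] //; rewrite (negPf h10) (negPf h11).
apply: enum_mxP => I L; rewrite -[_ *m Rat R' j]mulmx1 -[Rat R' j *m _]mulmx1 -!mulmxA.
rewrite !Rat_mul_row.
under eq_bigr => a _ do under eq_bigr => b _ do rewrite Rat_mul_row mulr_sumr.
under eq_bigr => a _ do rewrite exchange_big.
rewrite exchange_big; apply: eq_bigr => a' _ /=.
under [RHS]eq_bigr => b' _ do rewrite Rat_mul_row mulr_sumr.
under eq_bigr => a _ do under eq_bigr => b _ do rewrite mulr_sumr.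
under eq_bigr => a _ do rewrite exchange_big.
rewrite exchange_big; apply: eq_bigr => b' _ /=; apply: eq_bigr => a _.
rewrite mulr_sumr; apply: eq_bigr => b _.
rewrite uC !(upd2_D _ _ _ (k := pos0 j)) ?(upd2_D _ _ _ (k := pos1 j)) 1?eq_sym //.
rewrite !(upd2_D _ _ _ (k := pos0 i)) ?(upd2_D _ _ _ (k := pos1 i)) //.
by rewrite mulrCA.
Qed.

Section Three.
Variables (i j : 'I_n.-1).
Hypothesis ij : j = i.+1 :> nat.

Definition upd3 I (e f g : 'I_d) : tup :=
  [tuple if k == pos0 i then e else if k == pos1 i then f else
         if k == pos1 j then g else tnth I k | k < n].

(** Components of A_12 B_23 C_12, while [braidr] gives those of A_23 B_12 C_23. The braid axiom
    concerns three tensor factors; [braid_of_Rat] reads it as an identity of components, and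
    [Rat_braid_of] carries this to neighbouring positions among n factors. *)
Definition braidl (A B C : tensor4) (x y z e f g : 'I_d) : K :=
  \sum_a \sum_b \sum_c A x y a b * B b z c g * C a c e f.
Definition braidr (A B C : tensor4) (x y z e f g : 'I_d) : K :=
  \sum_a \sum_b \sum_c A y z a b * B x a e c * C c b f g.

Let e01 := pos_next ij.
Let n01 := pos0_neq_pos1 i.
Let n02 : pos0 i != pos1 j.
Proof. by apply/eqP => /(congr1 val) /= h; lia. Qed.
Let n12 : pos1 i != pos1 j.
Proof. by rewrite -e01 pos0_neq_pos1. Qed.

Lemma Rat3l (A B C : tensor4) I k :
  (Rat A i *m (Rat B j *m Rat C i)) (enum_rank I) k =
  \sum_e \sum_f \sum_g braidl A B C (tnth I (pos0 i)) (tnth I (pos1 i)) (tnth I (pos1 j)) e f g *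
      (1%:M : tmat K d n) (enum_rank (upd3 I e f g)) k.
Proof.
rewrite -[Rat C i]mulmx1 Rat_mul_row.
set x := tnth I _; set y := tnth I _; set z := tnth I _.
pose D e f g : K := (1%:M : tmat K d n) (enum_rank (upd3 I e f g)) k.
transitivity (\sum_a \sum_b \sum_c \sum_e \sum_f \sum_g
    A x y a b * B b z c g * C a c e f * D e f g).
  apply: eq_bigr => a _; apply: eq_bigr => b _; rewrite Rat_mul_row e01 upd2_1.
  rewrite upd2_D; [|by rewrite eq_sym|by rewrite eq_sym]; rewrite mulr_sumr.
  apply: eq_bigr => c _; rewrite -exch3 mulr_sumr; apply: eq_bigr => g _.
  rewrite Rat_mul_row -e01 upd2_0 upd2_D ?e01 // upd2_0 mulrA mulr_sumr.
  apply: eq_bigr => e _; rewrite mulr_sumr; apply: eq_bigr => f _; rewrite !mulrA.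
  congr (_ * 1%:M (enum_rank _) _); apply: eq_from_tnth => l; rewrite !tnth_mktuple e01.
  by case: (altP (l =P pos0 i)) => // l0; case: (altP (l =P pos1 i)).
rewrite exchange33; apply: eq_bigr => e _; apply: eq_bigr => f _; apply: eq_bigr => g _.
rewrite mulr_suml; apply: eq_bigr => a _; rewrite mulr_suml; apply: eq_bigr => b _.
by rewrite mulr_suml.
Qed.

Lemma Rat3r (A B C : tensor4) I k :
  (Rat A j *m (Rat B i *m Rat C j)) (enum_rank I) k =
  \sum_e \sum_f \sum_g braidr A B C (tnth I (pos0 i)) (tnth I (pos1 i)) (tnth I (pos1 j)) e f g *
      (1%:M : tmat K d n) (enum_rank (upd3 I e f g)) k.
Proof.
rewrite -[Rat C j]mulmx1 Rat_mul_row e01.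
set x := tnth I (pos0 i); set y := tnth I _; set z := tnth I _.
pose D e f g : K := (1%:M : tmat K d n) (enum_rank (upd3 I e f g)) k.
transitivity (\sum_a \sum_b \sum_c \sum_e \sum_f \sum_g
    A y z a b * B x a e c * C c b f g * D e f g).
  apply: eq_bigr => a _; apply: eq_bigr => b _; rewrite Rat_mul_row.
  rewrite upd2_D ?e01 // -e01 upd2_0 mulr_sumr; under eq_bigr => e _ do rewrite mulr_sumr.
  rewrite exchange_big; apply: eq_bigr => c _; apply: eq_bigr => e _.
  rewrite Rat_mul_row e01 upd2_1 upd2_D; [|by rewrite eq_sym|by rewrite eq_sym].
  rewrite upd2_1 mulrA mulr_sumr; apply: eq_bigr => f _; rewrite mulr_sumr.
  apply: eq_bigr => g _; rewrite !mulrA; congr (_ * 1%:M (enum_rank _) _).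
  apply: eq_from_tnth => l; rewrite !tnth_mktuple e01.
  case: (altP (l =P pos1 i)) => [->|l1]; first by rewrite eq_sym (negPf n01).
  case: (altP (l =P pos1 j)) => [->|l2]; first by rewrite eq_sym (negPf n02).
  by [].
rewrite exchange33; apply: eq_bigr => e _; apply: eq_bigr => f _; apply: eq_bigr => g _.
rewrite mulr_suml; apply: eq_bigr => a _; rewrite mulr_suml; apply: eq_bigr => b _.
by rewrite mulr_suml.
Qed.

Lemma Rat_braid_of (A B C A' B' C' : tensor4) :
  (forall x y z e f g, braidl A B C x y z e f g = braidr A' B' C' x y z e f g) ->
  Rat A i *m (Rat B j *m Rat C i) = Rat A' j *m (Rat B' i *m Rat C' j).
Proof.
move=> h; apply: enum_mxP => I L; rewrite Rat3l Rat3r.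
by apply: eq_bigr => e _; apply: eq_bigr => f _; apply: eq_bigr => g _; rewrite h.
Qed.
End Three.
End LocalOperators.

Section ThreeExtract.
Variables (K : fieldType) (d : nat).
Local Notation tensor4 := ('I_d -> 'I_d -> 'I_d -> 'I_d -> K).

Lemma braid_of_Rat (A B C A' B' C' : tensor4) :
  Rat A (n := 3) ord0 *m (Rat B (n := 3) ord_max *m Rat C (n := 3) ord0) =
  Rat A' (n := 3) ord_max *m (Rat B' (n := 3) ord0 *m Rat C' (n := 3) ord_max) ->
  forall x y z e f g, braidl A B C x y z e f g = braidr A' B' C' x y z e f g.
Proof.
have ij : (ord_max : 'I_3.-1) = (ord0 : 'I_3.-1).+1 :> nat by [].
move=> h x y z e f g.
pose I : 3.-tuple 'I_d := [tuple x; y; z]; pose L : 3.-tuple 'I_d := [tuple e; f; g].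
have := congr1 (fun M : tmat K d 3 => M (enum_rank I) (enum_rank L)) h.
rewrite /= (@Rat3l K d 3 _ _ ij) (@Rat3r K d 3 _ _ ij) !(tnth_nth x) /=.
have uL e' f' g' : (1%:M : tmat K d 3) (enum_rank (upd3 (ord0 : 'I_3.-1) (ord_max : 'I_3.-1) I e' f' g')) (enum_rank L) =
    (e == e')%:R * (f == f')%:R * (g == g')%:R.
  have L0 : tnth L (pos0 (ord0 : 'I_3.-1)) = e by rewrite (tnth_nth e).
  have L1 : tnth L (pos1 (ord0 : 'I_3.-1)) = f by rewrite (tnth_nth e).
  have L2 : tnth L (pos1 (ord_max : 'I_3.-1)) = g by rewrite (tnth_nth e).
  rewrite mxE (inj_eq enum_rank_inj) -!natrM !mulnb -andbA; set p := eq_op _ _; set p' := andb _ _.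
  suff -> : p = p' by [].
  rewrite {}/p {}/p' -L0 -L1 -L2; clearbody L => {L0 L1 L2}.
  have u0 : tnth (upd3 (ord0 : 'I_3.-1) (ord_max : 'I_3.-1) I e' f' g') (pos0 (ord0 : 'I_3.-1)) = e'.
    by rewrite tnth_mktuple.
  have u1 : tnth (upd3 (ord0 : 'I_3.-1) (ord_max : 'I_3.-1) I e' f' g') (pos1 (ord0 : 'I_3.-1)) = f'.
    by rewrite tnth_mktuple.
  have u2 : tnth (upd3 (ord0 : 'I_3.-1) (ord_max : 'I_3.-1) I e' f' g') (pos1 (ord_max : 'I_3.-1)) = g'.
    by rewrite tnth_mktuple.
  apply/eqP/and3P => [<-|[/eqP h0 /eqP h1 /eqP h2]]; first by rewrite u0 u1 u2.
  apply: eq_from_tnth => -[[|[|[|//]]] km].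
  - by rewrite (_ : Ordinal km = pos0 (ord0 : 'I_3.-1)) ?u0 //; exact: val_inj.
  - by rewrite (_ : Ordinal km = pos1 (ord0 : 'I_3.-1)) ?u1 //; exact: val_inj.
  - by rewrite (_ : Ordinal km = pos1 (ord_max : 'I_3.-1)) ?u2 //; exact: val_inj.
have collapse (G : 'I_d -> 'I_d -> 'I_d -> K) :
   \sum_e' \sum_f' \sum_g' G e' f' g' *
     (1%:M : tmat K d 3) (enum_rank (upd3 (ord0 : 'I_3.-1) (ord_max : 'I_3.-1) I e' f' g')) (enum_rank L) = G e f g.
  rewrite -(sum_delta (fun e' => G e' f g)); apply: eq_bigr => e' _.
  rewrite -(sum_delta (fun f' => G e' f' g)) mulr_sumr; apply: eq_bigr => f' _.
  rewrite -(sum_delta (fun g' => G e' f' g')) !mulr_sumr; apply: eq_bigr => g' _.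
  by rewrite uL; ring.
by rewrite !collapse.
Qed.

Lemma comp_of_Rat (A B C : tensor4) :
  Rat A (n := 2) ord0 *m Rat B (n := 2) ord0 = Rat C (n := 2) ord0 ->
  forall k l i j, comp4 A B k l i j = C k l i j.
Proof.
move=> h k l i j; move: h; rewrite Rat_comp.
pose I : 2.-tuple 'I_d := [tuple k; l]; pose L : 2.-tuple 'I_d := [tuple i; j].
move/(congr1 (fun M : tmat K d 2 => M (enum_rank I) (enum_rank L))).
rewrite /= !RatE !(tnth_nth k) /= (_ : agree _ _ _) ?mul1r //.
by apply/forallP => -[[|[]] // m]; rewrite -!val_eqE.
Qed.
End ThreeExtract.

Section Comp4.
Variables (K : fieldType) (d : nat).
Local Notation tensor4 := ('I_d -> 'I_d -> 'I_d -> 'I_d -> K).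
Implicit Types A B C : tensor4.

Lemma comp4_linl a b A B C k l i j :
  comp4 (fun k l i j => a * A k l i j + b * B k l i j) C k l i j =
  a * comp4 A C k l i j + b * comp4 B C k l i j.
Proof.
rewrite /comp4 !mulr_sumr -big_split; apply: eq_bigr => x _ /=.
rewrite !mulr_sumr -big_split; apply: eq_bigr => y _ /=.
by rewrite mulrDl !mulrA.
Qed.
Lemma comp4_linr a b A B C k l i j :
  comp4 C (fun k l i j => a * A k l i j + b * B k l i j) k l i j =
  a * comp4 C A k l i j + b * comp4 C B k l i j.
Proof.
rewrite /comp4 !mulr_sumr -big_split; apply: eq_bigr => x _ /=.
rewrite !mulr_sumr -big_split; apply: eq_bigr => y _ /=.
by rewrite mulrDr !(mulrCA (C _ _ _ _)).
Qed.
Lemma comp4_1l A k l i j : comp4 (@delta4 K d) A k l i j = A k l i j.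
Proof.
rewrite /comp4 /delta4; under eq_bigr => a _ do under eq_bigr => b _ do rewrite -mulrA.
by under eq_bigr => a _ do rewrite -mulr_sumr sum_delta; rewrite sum_delta.
Qed.
Lemma comp4_1r A k l i j : comp4 A (@delta4 K d) k l i j = A k l i j.
Proof.
rewrite /comp4 /delta4; under eq_bigr => a _ do under eq_bigr => b _ do rewrite mulrA mulrAC.
by under eq_bigr => a _ do rewrite -mulr_suml sum_delta_r; rewrite sum_delta_r.
Qed.
End Comp4.

(** * The action on tensor powers and mixed braid relations *)

Section HeckeAction.
Variables (K : fieldType) (q : K) (d : nat) (par : 'I_d -> bool).
Variable R : heckeSym q par.
Local Notation H n := (hecke q n).

Definition Rinv (k l i j : 'I_d) : K := q^-1 * R k l i j + (q^-1 * (1 - q)) * delta4 K k l i j.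

Lemma R_comp k l i j : comp4 R R k l i j = (q - 1) * R k l i j + q * delta4 K k l i j.
Proof.
apply: (comp_of_Rat (A := R) (B := R) (C := fun k l i j => (q - 1) * R k l i j + q * delta4 K k l i j)).
rewrite (Rat_linear (q - 1) R (fun k l i j => q * delta4 K k l i j)).
have -> : Rat (fun k l i j => q * delta4 K k l i j) (n := 2) ord0 = q%:M :> tmat K d 2.
  rewrite -scalemx1 -(@Rat_delta K d 2 ord0); apply: enum_mxP => I L; rewrite [RHS]mxE !RatE.
  by rewrite mulrCA.
have := hs_hecke R; rewrite /= mulmxBl !mulmxDr !mulmx1 mul_scalar_mx => /subr0_eq h.
by rewrite -[LHS](addrK (Rat R (n := 2) ord0)) h scalerBl scale1r addrAC.
Qed.

Lemma Rat_quad n (i : 'I_n.-1) : Rat R i *m Rat R i = (q - 1) *: Rat R i + q%:M.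
Proof.
rewrite Rat_comp -scalemx1 -(@Rat_delta K d n i).
apply: enum_mxP => I L; rewrite [RHS]mxE [X in _ = X + _]mxE [X in _ = _ + X]mxE !RatE R_comp.
by rewrite mulrDr; congr (_ + _); exact: mulrCA.
Qed.

Lemma R_braid x y z e f g : braidl R R R x y z e f g = braidr R R R x y z e f g.
Proof.
apply: (braid_of_Rat (A := R) (B := R) (C := R) (A' := R) (B' := R) (C' := R)).
by rewrite !mulmxA; exact: (hs_braid R).
Qed.

Lemma Rat_sat n : satisfies (@hecke_rels K q n) (@scalar_mx K #|{: n.-tuple 'I_d}|) (Rat R (n := n)).
Proof.
move=> _ _ [i j ij|i j ij|i] /=.
- by rewrite -!mulmxE -!mulmxA; apply: (Rat_braid_of ij); exact: R_braid.
- by rewrite -!mulmxE; exact: Rat_comm.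
- by rewrite -!mulmxE mul_scalar_mx Rat_quad.
Qed.

Lemma rhoM n (x y : H n) : rho R (x * y) = rho R x *m rho R y.
Proof. exact: (mxrepM (@Rat_sat n)). Qed.
Lemma rho1 n : rho R (1 : H n) = 1%:M.
Proof. exact: (mxrep1 (@Rat_sat n)). Qed.
Lemma rho_gen n i : rho R (Tgn q i : H n) = Rat R i.
Proof. exact: (mxrep_gen (@Rat_sat n)). Qed.
Lemma rho_linear n : linear (@rho K q d par R n).
Proof. exact: (mxrep_is_linear (@Rat_sat n)). Qed.
HB.instance Definition _ n := GRing.isLinear.Build K (H n) _ *:%R (@rho K q d par R n) (@rho_linear n).

Lemma Rinv_comp k l i j : comp4 Rinv R k l i j = delta4 K k l i j.
Proof.
have q0 := hs_q0 R; rewrite /Rinv comp4_linl comp4_1l R_comp.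
by field.
Qed.
Lemma comp_Rinv k l i j : comp4 R Rinv k l i j = delta4 K k l i j.
Proof.
have q0 := hs_q0 R; rewrite /Rinv comp4_linr comp4_1r R_comp.
by field.
Qed.

Lemma RatK n (i : 'I_n.-1) : Rat Rinv i *m Rat R i = 1%:M.
Proof.
rewrite Rat_comp -(@Rat_delta K d n i); apply: enum_mxP => I L; rewrite !RatE; congr (_ * _).
exact: Rinv_comp.
Qed.
Lemma RatVK n (i : 'I_n.-1) : Rat R i *m Rat Rinv i = 1%:M.
Proof.
rewrite Rat_comp -(@Rat_delta K d n i); apply: enum_mxP => I L; rewrite !RatE; congr (_ * _).
exact: comp_Rinv.
Qed.

(** The mixed form is needed for the contraction in [ptr_contract], where the outer factors of one
    side have to cancel each other. *)
Lemma Rinv_braid_l x y z e f g : braidl R R Rinv x y z e f g = braidr Rinv R R x y z e f g.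
Proof.
apply: braid_of_Rat.
rewrite -[LHS]mul1mx -(RatK (n := 3) ord_max) -[RHS]mulmx1 -(RatVK (n := 3) ord0).
have h := hs_braid R; rewrite /= in h.
rewrite !mulmxA in h *; congr (_ *m _).
by rewrite -!mulmxA; congr (_ *m _); rewrite !mulmxA h.
Qed.
Lemma Rinv_braid_r x y z e f g : braidl Rinv R R x y z e f g = braidr R R Rinv x y z e f g.
Proof.
apply: braid_of_Rat.
rewrite -[LHS]mulmx1 -(RatVK (n := 3) ord_max) -[RHS]mul1mx -(RatK (n := 3) ord0).
have h := hs_braid R; rewrite /= in h.
rewrite !mulmxA in h *; congr (_ *m _).
by rewrite -!mulmxA; congr (_ *m _); rewrite !mulmxA h.
Qed.

End HeckeAction.

(** * Partial traces of the closing tensor *)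

Section ClosedTensor.
Variables (K : fieldType) (d : nat).
Local Notation tensor4 := ('I_d -> 'I_d -> 'I_d -> 'I_d -> K).
Variables (R P Q : tensor4).
Hypothesis PR : forall i j k l, \sum_m \sum_n P i m j n * R n k m l = ((i == l) && (k == j))%:R.
Hypothesis RP : forall n m n' m', \sum_k \sum_l R n k m l * P l m' k n' = ((m == m') && (n == n'))%:R.
Hypothesis QR : forall k l i j, comp4 Q R k l i j = delta4 K k l i j.
Hypothesis RQ : forall k l i j, comp4 R Q k l i j = delta4 K k l i j.
Hypothesis braid_l : forall x y z e f g, braidl R R Q x y z e f g = braidr Q R R x y z e f g.
Hypothesis braid_r : forall x y z e f g, braidl Q R R x y z e f g = braidr R R Q x y z e f g.

(** This is C. The tensors R, P and Q are kept abstract because the argument is applied again to the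
    flipped ones, which give D. *)
Definition ptr (i j : 'I_d) : K := \sum_l P i l j l.

Lemma R_ptr b c : \sum_z \sum_g R b z c g * ptr g z = (b == c)%:R.
Proof.
rewrite /ptr; under eq_bigr => z _ do under eq_bigr => g _ do rewrite mulr_sumr.
rewrite -exch3; under eq_bigr => m _ do rewrite RP.
rewrite (bigD1 c) //= eqxx big1 ?addr0 // => i ic.
by rewrite eq_sym (negPf ic).
Qed.

Lemma ptr_braidl A B x y e f :
  \sum_z \sum_g ptr g z * braidl A R B x y z e f g = comp4 A B x y e f.
Proof.
rewrite /braidl /comp4.
under eq_bigr => z _ do under eq_bigr => g _ do
  (rewrite mulr_sumr; under eq_bigr => a _ do (rewrite mulr_sumr;
    under eq_bigr => b _ do rewrite mulr_sumr)).
rewrite exch4; apply: eq_bigr => a _; apply: eq_bigr => b _.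
rewrite -exch3.
transitivity (\sum_c (A x y a b * B a c e f) * \sum_z \sum_g R b z c g * ptr g z).
  apply: eq_bigr => c _; rewrite mulr_sumr; apply: eq_bigr => z _; rewrite mulr_sumr.
  by apply: eq_bigr => g _; ring.
under eq_bigr => c _ do rewrite R_ptr mulrC.
exact: sum_delta.
Qed.

Lemma P_braidr A B y z f g s t :
  \sum_e \sum_x P s e t x * braidr A R B x y z e f g = \sum_b A y z t b * B s b f g.
Proof.
rewrite /braidr.
under eq_bigr => e _ do under eq_bigr => x _ do
  (rewrite mulr_sumr; under eq_bigr => a _ do (rewrite mulr_sumr;
    under eq_bigr => b _ do rewrite mulr_sumr)).
rewrite exch4.
transitivity (\sum_a \sum_b \sum_c (A y z a b * B c b f g) *
    \sum_e \sum_x P s e t x * R x a e c).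
  apply: eq_bigr => a _; apply: eq_bigr => b _; rewrite -exch3; apply: eq_bigr => c _.
  rewrite mulr_sumr; apply: eq_bigr => e _; rewrite mulr_sumr; apply: eq_bigr => x _; ring.
rewrite exchange_big; apply: eq_bigr => b _ /=.
under eq_bigr => a _ do under eq_bigr => c _ do
  rewrite PR -mulnb natrM mulrC -mulrA [a == t]eq_sym.
under eq_bigr => a _ do rewrite sum_delta.
by rewrite sum_delta.
Qed.

(* Contract the braid relation with P over the first upper and lower indices and
   with C over the third ones. *)
Lemma ptr_contract A1 B1 A2 B2 :
  (forall x y z e f g, braidl A1 R B1 x y z e f g = braidr A2 R B2 x y z e f g) ->
  (forall k l i j, comp4 A1 B1 k l i j = delta4 K k l i j) ->
  forall y t s f, \sum_z \sum_g ptr g z * (\sum_b A2 y z t b * B2 s b f g) = (y == f)%:R * ptr s t.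
Proof.
move=> h h1 y t s f.
transitivity (\sum_z \sum_g \sum_e \sum_x
   P s e t x * (ptr g z * braidr A2 R B2 x y z e f g)).
  apply: eq_bigr => z _; apply: eq_bigr => g _; rewrite -P_braidr mulr_sumr.
  by apply: eq_bigr => e _; rewrite mulr_sumr; apply: eq_bigr => x _; rewrite mulrCA.
rewrite exch4 /ptr mulr_sumr; apply: eq_bigr => e _.
transitivity (\sum_x P s e t x * ((x == e)%:R * (y == f)%:R)).
  apply: eq_bigr => x _; rewrite -[_ * _%:R]h1 -ptr_braidl mulr_sumr; apply: eq_bigr => z _.
  by rewrite mulr_sumr; apply: eq_bigr => g _; rewrite h.
rewrite -(sum_delta (fun x => P s e t x)) mulr_sumr; apply: eq_bigr => x _.
by rewrite eq_sym; ring.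
Qed.

(** A second contraction with P removes the R that remains in [ptr_contract] and leaves only its
    inverse Q. *)
Lemma ptr_P_u s b t v : \sum_u P s b t u * ptr u v = \sum_c ptr s c * Q b c v t.
Proof.
have L := ptr_contract braid_l RQ.
transitivity (\sum_u \sum_j P s j t u * \sum_z \sum_g ptr g z * (\sum_c Q b z v c * R u c j g)).
  apply: eq_bigr => u _; under [RHS]eq_bigr => j _ do rewrite L mulrCA.
  by rewrite sum_delta.
under eq_bigr => u _ do under eq_bigr => j _ do
  (rewrite mulr_sumr; under eq_bigr => a _ do rewrite mulr_sumr).
rewrite exch4 exchange_big.
transitivity (\sum_g \sum_z ptr g z * \sum_c Q b z v c * (\sum_j \sum_u P s j t u * R u c j g)).
  apply: eq_bigr => g _; apply: eq_bigr => z _; rewrite exchange_big mulr_sumr.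
  under eq_bigr => j _ do under eq_bigr => u _ do rewrite !mulr_sumr.
  rewrite -exch3; apply: eq_bigr => c _; rewrite !mulr_sumr; apply: eq_bigr => j _.
  by rewrite !mulr_sumr; apply: eq_bigr => u _; ring.
rewrite -(sum_delta (fun g => \sum_z ptr g z * Q b z v t)); apply: eq_bigr => g _.
rewrite mulr_sumr; apply: eq_bigr => z _.
rewrite -(sum_delta (fun c => Q b z v c)) mulrCA; congr (_ * _); rewrite mulr_sumr.
by apply: eq_bigr => c _; rewrite PR -mulnb natrM [c == t]eq_sym; ring.
Qed.

Lemma ptr_P_v s i f j : \sum_v P i v j f * ptr s v = \sum_g Q s i f g * ptr g j.
Proof.
have L := ptr_contract braid_r QR.
transitivity (\sum_t \sum_y P i t j y * \sum_z \sum_g ptr g z * (\sum_b R y z t b * Q s b f g)).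
  apply: eq_bigr => t _; under [RHS]eq_bigr => y _ do rewrite L mulrCA eq_sym.
  by rewrite sum_delta.
under eq_bigr => t _ do under eq_bigr => y _ do
  (rewrite mulr_sumr; under eq_bigr => a _ do rewrite mulr_sumr).
rewrite exch4 exchange_big.
apply: eq_bigr => g _.
transitivity (\sum_z ptr g z * \sum_b Q s b f g * (\sum_t \sum_y P i t j y * R y z t b)).
  apply: eq_bigr => z _; rewrite mulr_sumr.
  under eq_bigr => t _ do under eq_bigr => y _ do rewrite !mulr_sumr.
  rewrite -exch3; apply: eq_bigr => b _; rewrite !mulr_sumr; apply: eq_bigr => t _.
  by rewrite !mulr_sumr; apply: eq_bigr => y _; ring.
rewrite -(sum_delta (fun z => Q s i f g * ptr g z)).
apply: eq_bigr => z _; rewrite -(sum_delta (fun b => Q s b f g)) mulrC [RHS]mulrA.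
congr (_ * _); rewrite mulr_sumr.
by apply: eq_bigr => b _; rewrite PR -mulnb natrM [z == j]eq_sym; ring.
Qed.

Definition tens (A B : 'I_d -> 'I_d -> K) : tensor4 := fun k l i j => A k i * B l j.

(** Both sides equal the sum over b, u of P^(lb)_(ju) C^u_i C^k_b: [ptr_P_u] evaluates the sum over
    u, [ptr_P_v] the one over b. *)
Lemma ptr_comm_inv k l i j : comp4 (tens ptr ptr) Q k l i j = comp4 Q (tens ptr ptr) k l i j.
Proof.
rewrite /comp4 /tens.
transitivity (\sum_b \sum_u P l b j u * ptr u i * ptr k b).
  apply: eq_bigr => b _ /=.
  by rewrite -mulr_suml ptr_P_u mulr_suml; apply: eq_bigr => c _; ring.
rewrite exchange_big; apply: eq_bigr => u _ /=.
under eq_bigr => b _ do rewrite mulrAC.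
by rewrite -mulr_suml ptr_P_v mulr_suml; apply: eq_bigr => c _; ring.
Qed.
End ClosedTensor.

Section CommutingTensors.
Variables (K : fieldType) (d : nat).
Local Notation tensor4 := ('I_d -> 'I_d -> 'I_d -> 'I_d -> K).

Lemma tpow_Rat_comm (R : tensor4) (C : 'M[K]_d) n (i : 'I_n.-1) :
  (forall k l i j, comp4 (tens C C) R k l i j = comp4 R (tens C C) k l i j) ->
  tpow n C *m Rat R i = Rat R i *m tpow n C.
Proof.
move=> h; apply: enum_mxP => I L; rewrite Rat_mul_row Rat_mul_col.
pose F := \prod_(k < n | (k != pos0 i) && (k != pos1 i)) C (tnth I k) (tnth L k).
have split J J' : tpow n C (enum_rank J) (enum_rank J') =
   C (tnth J (pos0 i)) (tnth J' (pos0 i)) * C (tnth J (pos1 i)) (tnth J' (pos1 i)) *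
   \prod_(k < n | (k != pos0 i) && (k != pos1 i)) C (tnth J k) (tnth J' k).
  rewrite mxE !enum_rankK (bigD1 (pos0 i)) //= (bigD1 (pos1 i)) //= ?mulrA //.
  by rewrite eq_sym pos0_neq_pos1.
transitivity (comp4 (tens C C) R (tnth I (pos0 i)) (tnth I (pos1 i)) (tnth L (pos0 i)) (tnth L (pos1 i)) * F).
  rewrite /comp4 mulr_suml; apply: eq_bigr => a _; rewrite mulr_suml; apply: eq_bigr => b _.
  rewrite split upd2_0 upd2_1 mulrAC; congr (_ * _); apply: eq_bigr => k /andP[k0 k1].
  by rewrite upd2_D.
rewrite h /comp4 mulr_suml; apply: eq_bigr => a _; rewrite mulr_suml; apply: eq_bigr => b _.
rewrite split upd2_0 upd2_1 mulrA; congr (_ * _); apply: eq_bigr => k /andP[k0 k1].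
by rewrite upd2_D.
Qed.
End CommutingTensors.

Section OperatorC.
Variables (K : fieldType) (q : K) (d : nat) (par : 'I_d -> bool).
Variable R : heckeSym q par.

(** With indices grouped into pairs, the closedness axiom says that one square matrix is a left
    inverse of another; in finite dimension it is also a right inverse. *)
Lemma R_P n m n' m' : \sum_k \sum_l R n k m l * hsP R l m' k n' = ((m == m') && (n == n'))%:R.
Proof.
pose A : 'M[K]_#|{: 'I_d * 'I_d}| :=
  \matrix_(x, y) hsP R (enum_val x).1 (enum_val y).1 (enum_val x).2 (enum_val y).2.
pose B : 'M[K]_#|{: 'I_d * 'I_d}| :=
  \matrix_(x, y) R (enum_val x).2 (enum_val y).2 (enum_val x).1 (enum_val y).1.
have AB : A *m B = 1%:M.
  apply: enum_mxP => -[i j] [l k]; rewrite mulmx_enum !mxE (inj_eq enum_rank_inj).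
  rewrite xpair_eqE [j == k]eq_sym -(hs_closed R) pair_bigA /=.
  by apply: eq_bigr => -[a b] _; rewrite !mxE !enum_rankK.
have /(congr1 (fun M : 'M[K]_#|{: 'I_d * 'I_d}| => M (enum_rank (m, n)) (enum_rank (m', n')))) := mulmx1C AB.
rewrite mulmx_enum !mxE (inj_eq enum_rank_inj) xpair_eqE => <-.
rewrite exchange_big pair_bigA /=.
by apply: eq_bigr => -[a b] _; rewrite !mxE !enum_rankK.
Qed.

Lemma Rcomm_of_inv (A : 'I_d -> 'I_d -> 'I_d -> 'I_d -> K) :
  (forall k l i j, comp4 A (Rinv R) k l i j = comp4 (Rinv R) A k l i j) ->
  forall k l i j, comp4 A R k l i j = comp4 R A k l i j.
Proof.
move=> h k l i j; have := h k l i j; rewrite /Rinv comp4_linl comp4_linr comp4_1l comp4_1r.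
by move=> /addIr /(mulfI (invr_neq0 (hs_q0 R))).
Qed.

Lemma Cmx_comm k l i j : comp4 (tens (Cmx R) (Cmx R)) R k l i j = comp4 R (tens (Cmx R) (Cmx R)) k l i j.
Proof.
have := Rcomm_of_inv (ptr_comm_inv (@hs_closed _ _ _ _ R) R_P (Rinv_comp R) (comp_Rinv R)
  (Rinv_braid_l R) (Rinv_braid_r R)) k l i j.
rewrite /comp4 /tens /ptr /Cmx => h.
under [RHS]eq_bigr => a _ do under eq_bigr => b _ do rewrite !mxE.
by under [LHS]eq_bigr => a _ do under eq_bigr => b _ do rewrite !mxE.
Qed.

Lemma tpow_rho_comm (B : 'M[K]_d) n (x : hecke q n) :
  (forall k l i j, comp4 (tens B B) R k l i j = comp4 R (tens B B) k l i j) ->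
  tpow n B *m rho R x = rho R x *m tpow n B.
Proof.
move=> BR; elim/hecke_ind: x => [c|i|x y IHx IHy|x y IHx IHy].
- by rewrite linearZ /= rho1 -scalemxAl -scalemxAr mulmx1 mul1mx.
- by rewrite rho_gen; exact: tpow_Rat_comm.
- by rewrite linearD mulmxDl mulmxDr IHx IHy.
- by rewrite rhoM mulmxA IHx -mulmxA IHy mulmxA.
Qed.

Lemma tpowC_rho n (x : hecke q n) : tpow n (Cmx R) *m rho R x = rho R x *m tpow n (Cmx R).
Proof. exact/tpow_rho_comm/Cmx_comm. Qed.
End OperatorC.

(** * The operator D *)

Section Coquasi.
Variables (K : fieldType) (q : K) (d : nat) (par : 'I_d -> bool).
Variable R : heckeSym q par.
Local Notation H := (HRs R).
Local Notation z := (zH R).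
Local Notation t := (tH R).
Variables (S : {linear H -> H}) (rf : H -> H -> K).
Hypotheses (hS : is_antipode S) (hrf : coquasitriangular rf).

Lemma cq_linr a : linear (rf a : H -> K^o).
Proof. by case: (cq_bilinear hrf). Qed.
Lemma cq_linl b : linear (rf^~ b : H -> K^o).
Proof. by case: (cq_bilinear hrf). Qed.
Lemma rf0 a : rf a 0 = 0.
Proof. by have := cq_linr a (-1) 0 0; rewrite scaler0 addr0 scaleN1r addNr. Qed.
Lemma rfD a x y : rf a (x + y) = rf a x + rf a y.
Proof. by have := cq_linr a 1 x y; rewrite !scale1r. Qed.
Lemma rfZ a c x : rf a (c *: x) = c * rf a x.
Proof. by have := cq_linr a c x 0; rewrite rf0 !addr0. Qed.
Lemma rf_sum a (I : finType) (F : I -> H) : rf a (\sum_i F i) = \sum_i rf a (F i).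
Proof. exact: (big_morph (rf a) (rfD a) (rf0 a)). Qed.

Lemma antipode_zz i k : \sum_l S (z i l) * z l k = (i == k)%:R *: (1 : H).
Proof.
have bS : bilinear_map (fun a1 a2 : H => S a1 * a2).
  by split=> [v c x y|u c x y]; rewrite ?linearP ?mulrDl ?mulrDr -?scalerAl -?scalerAr.
have := hS.1 (z i k); rewrite Delta_z tlift_sum // => ->.
by rewrite /counit (plift_gen (@central_id K) (@counit_sat _ _ _ _ R)).
Qed.

Lemma rf_mulr_z m j b c : rf (z m j) (b * c) = \sum_k rf (z m k) c * rf (z k j) b.
Proof.
have bil : bilinear_map (fun a1 a2 => rf a1 c * rf a2 b : K^o).
  split=> [v k x y|u k x y] /=.
    by have -> := cq_linl c k x y; rewrite /GRing.scale /=; ring.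
  by have -> := cq_linl b k x y; rewrite /GRing.scale /=; ring.
by rewrite (cq_mulr hrf) Delta_z tlift_sum.
Qed.

(** The matrix of these values is idempotent because 1 = 1 1, and invertible because r has a
    convolution inverse; hence it is the identity. *)
Lemma rf_z1 m j : rf (z m j) 1 = (m == j)%:R.
Proof.
have [r' [bil' inv _]] := cq_inv hrf.
pose G : 'M[K]_d := \matrix_(m, j) rf (z m j) 1.
pose G' : 'M[K]_d := \matrix_(m, j) r' (z m j) 1.
have GG : G *m G = G.
  apply/matrixP => i k; rewrite !mxE -[in RHS](mulr1 (1 : H)) rf_mulr_z.
  by apply: eq_bigr => l _; rewrite !mxE.
have GG' : G *m G' = 1%:M.
  apply/matrixP => i k; rewrite !mxE; have := inv (z i k) 1.
  rewrite /counit (plift_gen (@central_id K) (@counit_sat _ _ _ _ R)).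
  rewrite (plift1 (@central_id K) (@counit_sat _ _ _ _ R)) mulr1 /= => <-.
  have b1 (a1 b2 : H) : bilinear_map (fun a2 b1 : H => rf a1 b1 * r' a2 b2 : K^o).
    split=> [v c x y|u c x y] /=.
      by have -> := bil'.1 b2 c x y; rewrite /GRing.scale /=; ring.
    by have -> := cq_linr a1 c x y; rewrite /GRing.scale /=; ring.
  have b2 (a1 a2 : H) : bilinear_map (fun b1 b2 : H =>
      koszul (fun a2 b1 : H => rf a1 b1 * r' a2 b2 : K^o) a2 b1).
    split=> [v c x y|u c x y]; first exact: (koszul_bil (b1 a1 v)).2.
    rewrite /koszul scaler_sumr -big_split; apply: eq_bigr => p _ /=.
    rewrite scaler_sumr -big_split; apply: eq_bigr => p' _ /=.
    by have -> := bil'.2 (hc p a2) c x y; rewrite /GRing.scale /=; ring.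
  have b3 : bilinear_map (fun a1 a2 : H => tlift (fun b1 b2 : H =>
      koszul (fun a2 b1 : H => rf a1 b1 * r' a2 b2 : K^o) a2 b1) (Delta (1 : H))).
    rewrite Delta1; have e (a1 a2 : H) : tlift (fun b1 b2 : H =>
      koszul (fun a2 b1 : H => rf a1 b1 * r' a2 b2 : K^o) a2 b1) (1 : stensor H H) =
       koszul (fun a2 b1 : H => rf a1 b1 * r' a2 1 : K^o) a2 1.
      exact: (tlift_pure _ _ (b2 a1 a2)).
    split=> [v c x y|u c x y]; rewrite !e; last exact: (koszul_bil (b1 u 1)).1.
    rewrite /koszul scaler_sumr -big_split; apply: eq_bigr => p _ /=.
    rewrite scaler_sumr -big_split; apply: eq_bigr => p' _ /=.
    by have -> := cq_linl (hc p' 1) c x y; rewrite /GRing.scale /=; ring.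
  rewrite /convol Delta_z (tlift_sum _ _ _ b3); apply: eq_bigr => l _; rewrite !mxE.
  rewrite Delta1 [RHS](tlift_pure _ _ (b2 _ _)).
  by rewrite (koszul_homog (b1 _ _) (hc_z R l k) (hc_one H)) andbF expr0 scale1r.
have e : G = 1%:M by rewrite -[G]mulmx1 -GG' mulmxA GG.
by move/matrixP/(_ m j): e; rewrite !mxE.
Qed.
(** Evaluating r(z, -) on the relation S(z) z = 1 gives a matrix equation in which r(z, z) is R up
    to sign. So r(z, S(z)) is the partial inverse of R, and this is P. *)
Lemma rf_z_antipode i k j n :
  rf (z k j) (S (z i n)) = (-1) ^+ (par n && par k) * hsP R i k j n.
Proof.
pose U i k j n := (-1) ^+ (par n && par k) * rf (z k j) (S (z i n)).
have sgnK (b : bool) (x : K) : (-1) ^+ b * ((-1) ^+ b * x) = x.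
  by rewrite mulrA -signr_addb addbb mul1r.
have UR i' l m j' : \sum_k' \sum_n' U i' k' j' n' * R n' m k' l = (i' == l)%:R * (m == j')%:R.
  have <- : rf (z m j') (\sum_n' S (z i' n') * z n' l) = (i' == l)%:R * (m == j')%:R.
    by rewrite antipode_zz rfZ rf_z1.
  rewrite rf_sum exchange_big; apply: eq_bigr => n' _; rewrite rf_mulr_z; apply: eq_bigr => k' _.
  by rewrite (cq_braiding hrf) /U mulrACA -signr_addb addbb mul1r mulrC.
suff <- : U i k j n = hsP R i k j n by rewrite /U sgnK.
transitivity (\sum_k' \sum_n' U i k' j n' * \sum_a \sum_b R n' a k' b * hsP R b k a n).
  rewrite -(sum_delta (fun k' => U i k' j n)); apply: eq_bigr => k' _.
  rewrite -(sum_delta (fun n' => U i k' j n')) mulr_sumr; apply: eq_bigr => n' _.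
  by rewrite R_P -mulnb natrM [k == k']eq_sym [n == n']eq_sym; ring.
under eq_bigr => k' _ do under eq_bigr => n' _ do
  (rewrite mulr_sumr; under eq_bigr => a _ do rewrite mulr_sumr).
rewrite exch4.
transitivity (\sum_a \sum_b ((i == b)%:R * (j == a)%:R) * hsP R b k a n).
  apply: eq_bigr => a _; apply: eq_bigr => b _; rewrite [j == a]eq_sym -UR mulr_suml.
  by apply: eq_bigr => k' _; rewrite mulr_suml; apply: eq_bigr => n' _; rewrite mulrA.
under eq_bigr => a _ do under eq_bigr => b _ do rewrite -mulrA.
under eq_bigr => a _ do rewrite (sum_delta (fun b => (j == a)%:R * hsP R b k a n)).
exact: sum_delta.
Qed.

(* Up to a sign, D is the operator C of the flipped Hecke symmetry R^{lk}_{ji}. *)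
Lemma DmxE i j : Dmx S rf i j = (-1) ^+ (par j && par i) * ptr (fun i m j n => hsP R m i n j) i j.
Proof.
rewrite mxE /ptr mulr_sumr; apply: eq_bigr => l _; exact: rf_z_antipode.
Qed.

Lemma Dmx_even i j : par i != par j -> Dmx S rf i j = 0.
Proof.
move=> pij; rewrite mxE big1 // => l _.
rewrite (antipode_z hS) rfZ -(hc_z R i l) -(hc_t R l j) (cq_even hrf) ?mulr0 //.
by rewrite addbC (inj_eq (@addbI _)).
Qed.

(** Flipping the tensor factors exchanges the two mixed braid relations, so [ptr_comm_inv] applies
    to the flipped R. The sign (-1)^i between D and the resulting C does no harm, since R preserves
    the total parity. *)
Lemma Dmx_comm k l i j : comp4 (tens (Dmx S rf) (Dmx S rf)) R k l i j =
  comp4 R (tens (Dmx S rf) (Dmx S rf)) k l i j.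
Proof.
pose fl (A : 'I_d -> 'I_d -> 'I_d -> 'I_d -> K) := fun k l i j => A l k j i.
pose P' := fun i m j n => hsP R m i n j.
pose C' := ptr P'.
have cf A B k' l' i' j' : comp4 (fl A) (fl B) k' l' i' j' = comp4 A B l' k' j' i'.
  by rewrite /comp4 exchange_big.
have df k' l' i' j' : delta4 K k' l' i' j' = delta4 K l' k' j' i' :> K.
  by rewrite /delta4 mulrC.
have bf A B C x y z' e f g : braidl (fl A) (fl B) (fl C) x y z' e f g = braidr A B C z' y x g f e.
  by rewrite /braidl /braidr /fl exchange_big.
have bf' A B C x y z' e f g : braidr (fl A) (fl B) (fl C) x y z' e f g = braidl A B C z' y x g f e.
  by rewrite /braidl /braidr /fl exchange_big.
have PR' i' j' k' l' : \sum_m \sum_n P' i' m j' n * fl R n k' m l' = ((i' == l') && (k' == j'))%:R.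
  rewrite [i' == l']eq_sym -(R_P R k' l' j' i') exchange_big.
  by apply: eq_bigr => a _; apply: eq_bigr => b _; rewrite mulrC.
have RP' n m n' m' : \sum_k \sum_l fl R n k m l * P' l m' k n' = ((m == m') && (n == n'))%:R.
  rewrite [m == m']eq_sym -(hs_closed R) exchange_big.
  by apply: eq_bigr => a _; apply: eq_bigr => b _; rewrite mulrC.
have h : forall k l i j, comp4 (tens C' C') (fl (Rinv R)) k l i j = comp4 (fl (Rinv R)) (tens C' C') k l i j.
  apply: (ptr_comm_inv PR' RP') => [k' l' i' j'|k' l' i' j'|x y u e f g|x y u e f g].
  - by rewrite (cf (Rinv R) R) df Rinv_comp.
  - by rewrite (cf R (Rinv R)) df comp_Rinv.
  - by rewrite (bf R R (Rinv R)) (bf' (Rinv R) R R) Rinv_braid_r.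
  - by rewrite (bf (Rinv R) R R) (bf' R R (Rinv R)) Rinv_braid_l.
have tf k' l' i' j' : tens C' C' k' l' i' j' = fl (tens C' C') k' l' i' j'.
  by rewrite /fl /tens mulrC.
have h' : forall k l i j, comp4 (tens C' C') R k l i j = comp4 R (tens C' C') k l i j.
  apply: Rcomm_of_inv => k' l' i' j'.
  rewrite -(cf (tens C' C') (Rinv R)) -(cf (Rinv R) (tens C' C')).
  transitivity (comp4 (tens C' C') (fl (Rinv R)) l' k' j' i').
    by rewrite /comp4; apply: eq_bigr => a _; apply: eq_bigr => b _; rewrite -tf.
  by rewrite h /comp4; apply: eq_bigr => a _; apply: eq_bigr => b _; rewrite tf.
have DC i' j' : Dmx S rf i' j' = (-1) ^+ par i' * C' i' j'.
  have [e|ne] := eqVneq (par i') (par j'); first by rewrite DmxE e andbb.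
  suff -> : C' i' j' = 0 by rewrite mulr0 Dmx_even.
  have := DmxE i' j'; rewrite (Dmx_even ne) => /esym/eqP.
  by rewrite mulf_eq0 signr_eq0 => /eqP.
have sR k' l' i' j' : (-1) ^+ (par k' (+) par l') * R k' l' i' j' = (-1) ^+ (par i' (+) par j') * R k' l' i' j'.
  have [-> //|ne] := eqVneq (par k' (+) par l') (par i' (+) par j').
  by rewrite (hs_even R ne) !mulr0.
transitivity ((-1) ^+ (par k (+) par l) * comp4 (tens C' C') R k l i j).
  rewrite /comp4 mulr_sumr; apply: eq_bigr => a _; rewrite mulr_sumr; apply: eq_bigr => b _.
  by rewrite /tens !DC signr_addb; ring.
rewrite h' /comp4 mulr_sumr; apply: eq_bigr => a _; rewrite mulr_sumr; apply: eq_bigr => b _.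
by rewrite mulrA sR /tens !DC signr_addb; ring.
Qed.

Lemma tpowD_rho n (x : hecke q n) :
  tpow n (Dmx S rf) *m rho R x = rho R x *m tpow n (Dmx S rf).
Proof. exact/tpow_rho_comm/Dmx_comm. Qed.
End Coquasi.

(** * Commutation with the matrices of generators *)

Section Signs.
Variables (n : nat) (i : 'I_n.-1).
Local Notation off k := ((k != pos0 i) && (k != pos1 i)).

Definition sig (u v : 'I_n -> bool) : bool :=
  \big[addb/false]_(b < n) \big[addb/false]_(a < n | (a < b)%N) (u b && v a).

Lemma big_addb_andl (I : finType) (P : pred I) (c : bool) (F : I -> bool) :
  \big[addb/false]_(a | P a) (c && F a) = c && \big[addb/false]_(a | P a) F a.
Proof. by rewrite (big_endo _ (andb_addr c) (andbF c)). Qed.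

(* Only the pair (pos0 i, pos1 i) sees the two entries separately. *)
Lemma sig_split u v : sig u v = (u (pos1 i) && v (pos0 i)) (+)
  ((\big[addb/false]_(b < n | off b) (u b && ((\big[addb/false]_(a < n | (a < b)%N && off a) v a) (+)
      ((i < b)%N && (v (pos0 i) (+) v (pos1 i)))))) (+)
   ((u (pos0 i) (+) u (pos1 i)) && \big[addb/false]_(a < n | (a < i)%N) v a)).
Proof.
have n01 := pos0_neq_pos1 i.
have e0 (P : pred 'I_n) : P (pos0 i) -> P (pos1 i) -> \big[addb/false]_(a < n | P a) v a =
   \big[addb/false]_(a < n | P a && off a) v a (+) (v (pos0 i) (+) v (pos1 i)).
  move=> P0 P1; rewrite (bigD1 (pos0 i)) //= (bigD1 (pos1 i)) /= ?P1 1?eq_sym // addbA addbC.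
  by congr (_ (+) _); apply: eq_bigl => a; rewrite andbA.
have e1 (P : pred 'I_n) : ~~ P (pos0 i) -> ~~ P (pos1 i) -> \big[addb/false]_(a < n | P a) v a =
   \big[addb/false]_(a < n | P a && off a) v a.
  move=> P0 P1; apply: eq_bigl => a.
  case: (altP (a =P pos0 i)) => [->|_]; first by rewrite (negPf P0).
  by case: (altP (a =P pos1 i)) => [->|_]; rewrite ?(negPf P1) ?andbT.
have eu : \big[addb/false]_(a < n | (a < i.+1)%N) v a =
    v (pos0 i) (+) \big[addb/false]_(a < n | (a < i)%N) v a.
  rewrite (bigD1 (pos0 i)) //=; congr (_ (+) _); apply: eq_bigl => a.
  by rewrite -val_eqE /= ltnS; case: ltngtP.
rewrite /sig (eq_bigr _ (fun b _ => big_addb_andl _ _ _)).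
rewrite [LHS](bigD1 (pos0 i)) //= [X in _ (+) X](bigD1 (pos1 i)) 1?eq_sym //= eu.
set X := \big[addb/false]_(a < n | (a < i)%N) v a.
set Y := \big[addb/false]_(b < n | _) _; set Y' := \big[addb/false]_(b < n | _) _.
have -> : Y = Y'.
  apply: eq_bigr => b /andP[b0 b1]; congr (_ && _).
  move: b0 b1; rewrite -!val_eqE /= => b0 b1.
  case: (ltnP i b) => ib /=.
    have ib1 : (i.+1 < b)%N by rewrite ltn_neqAle ib eq_sym b1.
    by rewrite (e0 (fun a : 'I_n => (a < b)%N)).
  by rewrite e1 ?addbF //= -leqNgt // (leq_trans ib).
by move: (u _) (u _) (v _) X Y' => [] [] [] [] [].
Qed.

Lemma sig_congr u v u' v' : (forall k, off k -> u k = u' k) -> (forall k, off k -> v k = v' k) ->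
  u (pos0 i) (+) u (pos1 i) = u' (pos0 i) (+) u' (pos1 i) ->
  v (pos0 i) (+) v (pos1 i) = v' (pos0 i) (+) v' (pos1 i) ->
  sig u v (+) (u (pos1 i) && v (pos0 i)) = sig u' v' (+) (u' (pos1 i) && v' (pos0 i)).
Proof.
move=> hu hv su sv; rewrite !sig_split [LHS]addbC [RHS]addbC !addKb su.
congr (_ (+) (_ && _)).
  apply: eq_bigr => b hb; rewrite hu // sv; congr (_ && (_ (+) _)).
  by apply: eq_bigr => a /andP[_ ha]; rewrite hv.
apply: eq_bigr => a ai; apply: hv; rewrite -!val_eqE /=; lia.
Qed.
End Signs.

Section OrderedProducts.
Variables (A : pzSemiRingType) (n : nat).
Local Notation off i k := ((k != pos0 i) && (k != pos1 i)).

(* Ppi and its mirror image are the two ways of multiplying n ordered factors; in both the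
   factors at two consecutive positions are adjacent. *)
Definition adjacent (Ppi : ('I_n -> A) -> A) (op : A -> A -> A) := forall i : 'I_n.-1,
  exists X Y : ('I_n -> A) -> A,
    [/\ forall F, Ppi F = X F * op (F (pos0 i)) (F (pos1 i)) * Y F,
        forall F G, (forall k, off i k -> F k = G k) -> X F = X G &
        forall F G, (forall k, off i k -> F k = G k) -> Y F = Y G].

Lemma adjacent_prod : adjacent (fun F => \prod_(k < n) F k) *%R.
Proof.
move=> i; pose E (F : 'I_n -> A) m := oapp F 1 (insub m).
exists (fun F => \prod_(0 <= m < i) E F m), (fun F => \prod_(i.+2 <= m < n) E F m).
have eE F (k : 'I_n) : E F k = F k by rewrite /E valK.
have in_n := ltn_ord (pos1 i); rewrite /= in in_n.
split=> [F|F G h|F G h].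
- rewrite (eq_bigr (fun k : 'I_n => E F k)) => [|k _]; last by rewrite eE.
  rewrite -(big_mkord xpredT (E F)) (@big_cat_nat _ _ _ i 0 n) //=; last exact: ltnW (ltnW in_n).
  rewrite [X in _ * X]big_ltn; last exact: ltnW in_n.
  rewrite [X in _ * (_ * X)]big_ltn // -(eE F (pos0 i)) -(eE F (pos1 i)) /=.
  by rewrite !mulrA.
- apply: eq_big_nat => m mi; rewrite /E; case: insubP => //= k _ km; apply: h.
  by rewrite -!val_eqE /= km; lia.
- apply: eq_big_nat => m mi; rewrite /E; case: insubP => //= k _ km; apply: h.
  by rewrite -!val_eqE /= km; lia.
Qed.

Lemma adjacent_prod_rev : adjacent (fun F => \prod_(k < n) F (rev_ord k)) (fun a b => b * a).
Proof.
move=> i; have hi := ltn_ord (pos1 i); rewrite /= in hi.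
have hj : (n - i.+2 < n.-1)%N by lia.
have [X [Y [h hX hY]]] := adjacent_prod (Ordinal hj).
have r0 : rev_ord (pos0 (Ordinal hj)) = pos1 i by apply: val_inj => /=; lia.
have r1 : rev_ord (pos1 (Ordinal hj)) = pos0 i by apply: val_inj => /=; lia.
exists (fun F => X (fun k => F (rev_ord k))), (fun F => Y (fun k => F (rev_ord k))).
split=> [F|F G e|F G e]; first by rewrite h r0 r1.
- apply: hX => k /andP[k0 k1]; apply: e; rewrite -r0 -r1 !(inj_eq rev_ord_inj).
  by rewrite k0 k1.
- apply: hY => k /andP[k0 k1]; apply: e; rewrite -r0 -r1 !(inj_eq rev_ord_inj).
  by rewrite k0 k1.
Qed.
End OrderedProducts.

Section TensorMatrices.
Variables (K : fieldType) (q : K) (d : nat) (par : 'I_d -> bool).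
Variable R : heckeSym q par.
Variables (n : nat) (A : algType K) (w : 'I_d -> 'I_d -> A).
Variables (Ppi : ('I_n -> A) -> A) (op : A -> A -> A).
Hypothesis adj : adjacent Ppi op.
Local Notation tup := (n.-tuple 'I_d).
Variables (sg : tup -> tup -> bool) (g : 'I_d -> 'I_d -> 'I_d -> 'I_d -> bool).

Definition pairmx p s i j : A := ((-1) ^+ g p s i j : K) *: op (w p i) (w s j).

Hypothesis pair_comm : forall k l i j, \sum_p \sum_s R k l p s *: pairmx p s i j =
  \sum_u \sum_v R u v i j *: pairmx k l u v.
Hypothesis sg_row : forall (i : 'I_n.-1) (I L : tup) a b,
  par (tnth I (pos0 i)) (+) par (tnth I (pos1 i)) = par a (+) par b ->
  sg (upd2 I i a b) L (+) g a b (tnth L (pos0 i)) (tnth L (pos1 i)) =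
  sg I L (+) g (tnth I (pos0 i)) (tnth I (pos1 i)) (tnth L (pos0 i)) (tnth L (pos1 i)).
Hypothesis sg_col : forall (i : 'I_n.-1) (I L : tup) a b,
  par (tnth L (pos0 i)) (+) par (tnth L (pos1 i)) = par a (+) par b ->
  sg I (upd2 L i a b) (+) g (tnth I (pos0 i)) (tnth I (pos1 i)) a b =
  sg I L (+) g (tnth I (pos0 i)) (tnth I (pos1 i)) (tnth L (pos0 i)) (tnth L (pos1 i)).

(** Z^n and S(Z^n) differ in the order of the factors ([Ppi], [op]) and in the sign [sg]. The
    relation for two neighbouring factors, with local sign [g], extends to n factors because [sg]
    and [g] change together when an adjacent pair of indices is replaced by one of the same total
    parity; other pairs do not occur, R being even. *)
Definition tensmx : tmat A d n :=
  tmx (fun I J => ((-1) ^+ sg I J : K) *: Ppi (fun k => w (tnth I k) (tnth J k))).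

Lemma tensmx_Rat i : map_mx (in_alg A) (Rat R i) *m tensmx = tensmx *m map_mx (in_alg A) (Rat R i).
Proof.
apply: enum_mxP => I L; rewrite !mulmx_enum.
under eq_bigr => J _ do rewrite mxE mulr_algl.
under [RHS]eq_bigr => J _ do rewrite [X in _ * X]mxE mulr_algr.
rewrite sum_Rat_row sum_Rat_col.
have [X [Y [split hX hY]]] := adj i.
pose F k := w (tnth I k) (tnth L k).
pose eps : K := (-1) ^+ (sg I L (+) g (tnth I (pos0 i)) (tnth I (pos1 i)) (tnth L (pos0 i)) (tnth L (pos1 i))).
have entry J J' : sg J J' (+) g (tnth J (pos0 i)) (tnth J (pos1 i)) (tnth J' (pos0 i)) (tnth J' (pos1 i)) =
    sg I L (+) g (tnth I (pos0 i)) (tnth I (pos1 i)) (tnth L (pos0 i)) (tnth L (pos1 i)) ->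
    agree i I J -> agree i L J' ->
    tensmx (enum_rank J) (enum_rank J') = eps *:
    (X F * pairmx (tnth J (pos0 i)) (tnth J (pos1 i)) (tnth J' (pos0 i)) (tnth J' (pos1 i)) * Y F).
  move=> e aJ aJ'; have hF k : (k != pos0 i) && (k != pos1 i) ->
      w (tnth J k) (tnth J' k) = F k.
    by move=> hk; move: (forallP aJ k) (forallP aJ' k); rewrite hk /F => /eqP-> /eqP->.
  rewrite mxE !enum_rankK split (hX _ F hF) (hY _ F hF) /pairmx -scalerAr -scalerAl scalerA.
  by rewrite /eps -e -[in RHS]signr_addb -addbA addbb addbF.
transitivity (eps *: (X F * (\sum_a \sum_b R (tnth I (pos0 i)) (tnth I (pos1 i)) a b *:
    pairmx a b (tnth L (pos0 i)) (tnth L (pos1 i))) * Y F)).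
  rewrite mulr_sumr mulr_suml scaler_sumr; apply: eq_bigr => a _.
  rewrite mulr_sumr mulr_suml scaler_sumr; apply: eq_bigr => b _.
  rewrite -scalerAr -scalerAl scalerA mulrC -scalerA.
  have [e|ne] := eqVneq (par (tnth I (pos0 i)) (+) par (tnth I (pos1 i))) (par a (+) par b); last first.
    by rewrite (hs_even R ne) !scale0r.
  congr (_ *: _); rewrite entry ?upd2_0 ?upd2_1 ?agree_upd2 //; last by apply/forallP => k; apply/implyP.
  exact: sg_row.
rewrite pair_comm.
rewrite mulr_sumr mulr_suml scaler_sumr; apply: eq_bigr => a _.
rewrite mulr_sumr mulr_suml scaler_sumr; apply: eq_bigr => b _.
rewrite -scalerAr -scalerAl scalerA mulrC -scalerA.
have [e|ne] := eqVneq (par a (+) par b) (par (tnth L (pos0 i)) (+) par (tnth L (pos1 i))); last first.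
  by rewrite (hs_even R ne) !scale0r.
congr (_ *: _); rewrite entry ?upd2_0 ?upd2_1 ?agree_upd2 //; last by apply/forallP => k; apply/implyP.
by apply: sg_col; rewrite e.
Qed.

Lemma tensmx_rho (x : hecke q n) :
  map_mx (in_alg A) (rho R x) *m tensmx = tensmx *m map_mx (in_alg A) (rho R x).
Proof.
elim/hecke_ind: x => [c|i|x y IHx IHy|x y IHx IHy].
- rewrite linearZ /= rho1 scalemx1 map_scalar_mx mul_scalar_mx.
  apply/matrixP => I L; rewrite [RHS]mxE (bigD1 L) //= big1 => [|J JL].
    by rewrite addr0 !mxE eqxx mulr1n mulr_algl mulr_algr.
  by rewrite [X in _ * X]mxE (negPf JL) mulr0n mulr0.
- by rewrite rho_gen tensmx_Rat.
- by rewrite linearD map_mxD mulmxDl mulmxDr IHx IHy.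
- by rewrite rhoM map_mxM -mulmxA IHy mulmxA IHx mulmxA.
Qed.
End TensorMatrices.

(** * The relations between the generators t *)

Section LocalRelationT.
Variables (K : fieldType) (q : K) (d : nat) (par : 'I_d -> bool).
Variable R : heckeSym q par.
Local Notation z := (zH R).
Local Notation t := (tH R).
Local Notation H := (HR R).

(** The value of the antipode at z^i_j; with it the signed relations of H_R become those of an
    ordinary inverse matrix. *)
Definition tsgn (i j : 'I_d) : H := ((-1) ^+ (par j && (par i (+) par j)) : K) *: t i j.

Lemma z_tsgn i k : \sum_j z i j * tsgn j k = (i == k)%:R *: (1 : H).
Proof.
have [_ <- _] := HR_relations R; apply: eq_bigr => j _.
by rewrite /tsgn -scalerAr.
Qed.
Lemma tsgn_z i k : \sum_j tsgn i j * z j k = (i == k)%:R *: (1 : H).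
Proof.
have [_ _ <-] := HR_relations R; apply: eq_bigr => j _.
by rewrite /tsgn -scalerAl addbC.
Qed.

Definition gz (p s i j : 'I_d) : bool := par s && (par p (+) par i).
(** The first two terms are the signs of the antipode on the two factors. The third one is [gz]
    together with the sign of exchanging the factors. *)
Definition gt (p s i j : 'I_d) : bool :=
  (par i && (par p (+) par i)) (+) (par j && (par s (+) par j)) (+) (par j && (par p (+) par i)).

Lemma RZZ_pair_comm (A : algType K) (zz : 'I_d -> 'I_d -> A) : RZZ_in R (in_alg A) zz ->
  forall k l i j, \sum_p \sum_s R k l p s *: pairmx (K := K) zz *%R gz p s i j =
  \sum_u \sum_v R u v i j *: pairmx (K := K) zz *%R gz k l u v.
Proof.
move=> /RZZ_algE h k l i j.
transitivity (\sum_p \sum_s ((-1) ^+ (par s && (par i (+) par p)) * R k l p s) *: (zz p i * zz s j)).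
  by apply: eq_bigr => p _; apply: eq_bigr => s _; rewrite /pairmx scalerA mulrC /gz [par p (+) _]addbC.
rewrite h; apply: eq_bigr => u _; apply: eq_bigr => v _.
by rewrite /pairmx scalerA mulrC /gz addbC.
Qed.

Local Notation w2 := (pairmx (K := K) t (fun a b => b * a) gt).
Local Notation z2 := (pairmx (K := K) z *%R gz).

Lemma pairmx_tsgn p s i j : w2 p s i j = ((-1) ^+ (par j && (par p (+) par i)) : K) *: (tsgn s j * tsgn p i).
Proof.
rewrite /pairmx /tsgn -scalerAl -scalerAr !scalerA -!signr_addb; congr (_ ^+ _ *: _).
by rewrite /gt addbC; congr (nat_of_bool _); case: (par p) (par s) (par i) (par j) => [] [] [] [].
Qed.

Lemma z2_t2 p s u v : \sum_i \sum_j z2 p s i j * w2 i j u v = ((p == u) && (s == v))%:R *: (1 : H).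
Proof.
transitivity (\sum_i ((-1) ^+ (par s && (par p (+) par i) (+) par v && (par i (+) par u)) : K) *:
   (z p i * (\sum_j z s j * tsgn j v) * tsgn i u)).
  apply: eq_bigr => i _; rewrite mulr_sumr mulr_suml scaler_sumr; apply: eq_bigr => j _.
  rewrite pairmx_tsgn {1}/pairmx /gz -scalerAl -scalerAr scalerA -signr_addb; congr (_ *: _).
  by rewrite !mulrA.
have [<-|ne] := eqVneq s v; last first.
  rewrite andbF scale0r big1 // => i _.
  by rewrite z_tsgn (negPf ne) scale0r mulr0 mul0r scaler0.
rewrite andbT; transitivity (((-1) ^+ (par s && (par p (+) par u)) : K) *: \sum_i z p i * tsgn i u).
  rewrite scaler_sumr; apply: eq_bigr => i _; rewrite z_tsgn eqxx scale1r mulr1; congr (_ ^+ _ *: _).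
  by congr (nat_of_bool _); case: (par p) (par s) (par i) (par u) => [] [] [] [].
rewrite z_tsgn scalerA; have [->|_] := eqVneq p u; last by rewrite mulr0.
by rewrite addbb andbF mul1r.
Qed.

Lemma t2_z2 p s u v : \sum_i \sum_j w2 p s i j * z2 i j u v = ((p == u) && (s == v))%:R *: (1 : H).
Proof.
transitivity (\sum_j ((-1) ^+ (par j && (par p (+) par u)) : K) *:
   (tsgn s j * (\sum_i tsgn p i * z i u) * z j v)).
  rewrite exchange_big; apply: eq_bigr => j _ /=; rewrite mulr_sumr mulr_suml scaler_sumr.
  apply: eq_bigr => i _.
  rewrite pairmx_tsgn {1}/pairmx /gz -scalerAl -scalerAr scalerA -signr_addb !mulrA; congr (_ ^+ _ *: _).
  by congr (nat_of_bool _); case: (par p) (par j) (par i) (par u) => [] [] [] [].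
have [<-|ne] := eqVneq p u; last first.
  rewrite scale0r big1 // => i _.
  by rewrite tsgn_z (negPf ne) scale0r mulr0 mul0r scaler0.
rewrite /= -tsgn_z; apply: eq_bigr => j _.
by rewrite addbb andbF expr0 scale1r tsgn_z eqxx scale1r mulr1.
Qed.

(** The matrix of signed pairs of t is the two-sided inverse of the one of pairs of z, and the
    latter commutes with R. *)
Lemma t_pair_comm k l i j : \sum_p \sum_s R k l p s *: w2 p s i j = \sum_u \sum_v R u v i j *: w2 k l u v.
Proof.
have mxp (F G : 'I_d -> 'I_d -> 'I_d -> 'I_d -> H) x y :
   ((\matrix_(x, y) F (enum_val x).1 (enum_val x).2 (enum_val y).1 (enum_val y).2 : 'M[H]_#|{: 'I_d * 'I_d}|) *m
   (\matrix_(x, y) G (enum_val x).1 (enum_val x).2 (enum_val y).1 (enum_val y).2)) (enum_rank x) (enum_rank y) =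
   \sum_a \sum_b F x.1 x.2 a b * G a b y.1 y.2.
  by rewrite mulmx_enum pair_bigA; apply: eq_bigr => p _; rewrite !mxE !enum_rankK.
pose Mx F : 'M[H]_#|{: 'I_d * 'I_d}| :=
  \matrix_(x, y) F (enum_val x).1 (enum_val x).2 (enum_val y).1 (enum_val y).2.
pose RH k l i j : H := in_alg H (R k l i j).
have e1 : Mx z2 *m Mx w2 = 1%:M.
  apply: enum_mxP => -[p s] [u v]; rewrite mxp z2_t2 mxE (inj_eq enum_rank_inj) xpair_eqE.
  by case: (_ && _); rewrite ?scale1r ?scale0r.
have e2 : Mx w2 *m Mx z2 = 1%:M.
  apply: enum_mxP => -[p s] [u v]; rewrite mxp t2_z2 mxE (inj_eq enum_rank_inj) xpair_eqE.
  by case: (_ && _); rewrite ?scale1r ?scale0r.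
have e3 : Mx RH *m Mx z2 = Mx z2 *m Mx RH.
  apply: enum_mxP => -[p s] [u v]; rewrite !mxp /=.
  under eq_bigr => a _ do under eq_bigr => b _ do rewrite mulr_algl.
  under [RHS]eq_bigr => a _ do under eq_bigr => b _ do rewrite mulr_algr.
  by apply: RZZ_pair_comm; case: (HR_relations R).
have e4 : Mx RH *m Mx w2 = Mx w2 *m Mx RH.
  by rewrite -[LHS]mul1mx -e2 -!mulmxA (mulmxA (Mx z2)) -e3 -!mulmxA e1 mulmx1.
have := congr1 (fun M : 'M[H]_#|{: 'I_d * 'I_d}| => M (enum_rank (k, l)) (enum_rank (i, j))) e4.
rewrite !mxp /=.
under eq_bigr => a _ do under eq_bigr => b _ do rewrite mulr_algl.
move=> ->; apply: eq_bigr => u _; apply: eq_bigr => v _; exact: mulr_algr.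
Qed.

Local Notation tE := (@tERp K q d par R).
Lemma tE_pair_comm k l i j :
  \sum_p \sum_s R k l p s *: pairmx (K := K) tE (fun a b => b * a) gt p s i j =
  \sum_u \sum_v R u v i j *: pairmx (K := K) tE (fun a b => b * a) gt k l u v.
Proof.
have vD : {morph (@ERp_val K q d par R) : x y / x + y} by [].
have vs (F : 'I_d -> 'I_d -> ERp R) : ERp_val (\sum_a \sum_b F a b) = \sum_a \sum_b ERp_val (F a b).
  rewrite (big_morph _ vD (erefl _)); apply: eq_bigr => a _.
  by rewrite (big_morph _ vD (erefl _)).
by apply: val_inj; rewrite /= !vs; exact: t_pair_comm.
Qed.
End LocalRelationT.

Section SignFunctions.
Variables (d n : nat) (par : 'I_d -> bool).
Local Notation tup := (n.-tuple 'I_d).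
Implicit Types I J L : tup.

Definition pv I (k : 'I_n) : bool := par (tnth I k).
Definition dv I J (k : 'I_n) : bool := par (tnth I k) (+) par (tnth J k).
Definition dg (u v : 'I_n -> bool) : bool := \big[addb/false]_k (u k && v k).

Lemma odd_sgnZ I J : odd (sgnZ par I J) = sig (pv I) (dv I J).
Proof.
rewrite (big_morph odd oddD (erefl _)); apply: eq_bigr => b _.
rewrite (big_morph odd oddD (erefl _)); apply: eq_bigr => a _.
by rewrite oddM oddD !oddb.
Qed.

(** The sign that [mulbar] attaches to an entry and the sign inside [Tmon] together; absorbing both
    makes [mulbar] an ordinary product with [Ttil]. *)
Definition degT I J : nat := (deg par J * (deg par I + deg par J) + sgnT par I J)%N.

Lemma odd_degT I J : odd (degT I J) = dg (pv J) (dv I J) (+) sig (pv J) (dv I J).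
Proof.
have -> : degT I J = (\sum_(b < n) \sum_(a < n) par (tnth J a) * (par (tnth I b) + par (tnth J b)) +
    sgnT par I J)%N.
  congr (_ + _)%N; rewrite /deg -big_split big_distrr; apply: eq_bigr => b _.
  by rewrite big_distrl.
rewrite sum_pairs /sgnT !oddD -addbA; congr (_ (+) _).
  rewrite (big_morph odd oddD (erefl _)); apply: eq_bigr => b _.
  by rewrite oddM oddD !oddb.
rewrite -oddD -big_split /= (big_morph odd oddD (erefl _)); apply: eq_bigr => b _.
rewrite -big_split /= (big_morph odd oddD (erefl _)); apply: eq_bigr => a _.
by rewrite !(oddD, oddM, oddb) /pv /dv; case: (par _) (par _) (par _) (par _) => [] [] [] [].
Qed.

Lemma dg_split (i : 'I_n.-1) u v : dg u v =
  \big[addb/false]_(k < n | (k != pos0 i) && (k != pos1 i)) (u k && v k) (+)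
  ((u (pos0 i) && v (pos0 i)) (+) (u (pos1 i) && v (pos1 i))).
Proof.
rewrite /dg (bigD1 (pos0 i)) //= (bigD1 (pos1 i)) /=; last by rewrite eq_sym pos0_neq_pos1.
by rewrite addbA addbC.
Qed.

Lemma pv_upd2 I i a b k : (k != pos0 i) && (k != pos1 i) -> pv (upd2 I i a b) k = pv I k.
Proof. by case/andP => k0 k1; rewrite /pv upd2_D. Qed.
Lemma dv_upd2l I J i a b k : (k != pos0 i) && (k != pos1 i) -> dv (upd2 I i a b) J k = dv I J k.
Proof. by case/andP => k0 k1; rewrite /dv upd2_D. Qed.
Lemma dv_upd2r I J i a b k : (k != pos0 i) && (k != pos1 i) -> dv I (upd2 J i a b) k = dv I J k.
Proof. by case/andP => k0 k1; rewrite /dv upd2_D. Qed.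

Definition sgz I J : bool := odd (sgnZ par I J).
Definition sgt I J : bool := odd (degT I J).

Lemma sgz_row (i : 'I_n.-1) I L a b :
  par (tnth I (pos0 i)) (+) par (tnth I (pos1 i)) = par a (+) par b ->
  sgz (upd2 I i a b) L (+) gz par a b (tnth L (pos0 i)) (tnth L (pos1 i)) =
  sgz I L (+) gz par (tnth I (pos0 i)) (tnth I (pos1 i)) (tnth L (pos0 i)) (tnth L (pos1 i)).
Proof.
move=> e; rewrite /sgz !odd_sgnZ.
have := sig_congr (u := pv (upd2 I i a b)) (v := dv (upd2 I i a b) L) (u' := pv I) (v' := dv I L)
  (@pv_upd2 I i a b) (@dv_upd2l I L i a b).
rewrite /pv /dv upd2_0 upd2_1 /gz; apply; first by [].
by move: e; case: (par _) (par _) (par _) (par _) (par _) (par _) => [] [] [] [] [] [].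
Qed.
Lemma sgz_col (i : 'I_n.-1) I L a b :
  par (tnth L (pos0 i)) (+) par (tnth L (pos1 i)) = par a (+) par b ->
  sgz I (upd2 L i a b) (+) gz par (tnth I (pos0 i)) (tnth I (pos1 i)) a b =
  sgz I L (+) gz par (tnth I (pos0 i)) (tnth I (pos1 i)) (tnth L (pos0 i)) (tnth L (pos1 i)).
Proof.
move=> e; rewrite /sgz !odd_sgnZ.
have := sig_congr (u := pv I) (v := dv I (upd2 L i a b)) (u' := pv I) (v' := dv I L)
  (fun=> fun=> erefl) (@dv_upd2r I L i a b).
rewrite /pv /dv upd2_0 upd2_1 /gz; apply; first by [].
by move: e; case: (par _) (par _) (par _) (par _) (par _) (par _) => [] [] [] [] [] [].
Qed.

Lemma sgt_row (i : 'I_n.-1) I L a b :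
  par (tnth I (pos0 i)) (+) par (tnth I (pos1 i)) = par a (+) par b ->
  sgt (upd2 I i a b) L (+) gt par a b (tnth L (pos0 i)) (tnth L (pos1 i)) =
  sgt I L (+) gt par (tnth I (pos0 i)) (tnth I (pos1 i)) (tnth L (pos0 i)) (tnth L (pos1 i)).
Proof.
move=> e; rewrite /sgt !odd_degT !(dg_split i).
have := sig_congr (u := pv L) (v := dv (upd2 I i a b) L) (u' := pv L) (v' := dv I L)
  (fun=> fun=> erefl) (@dv_upd2l I L i a b).
rewrite [\big[_/_]_(_ < _ | _) (_ && dv (upd2 _ _ _ _) _ _)](eq_bigr (fun k => pv L k && dv I L k)); last first.
  by move=> k hk; rewrite dv_upd2l.
rewrite /pv /dv upd2_0 upd2_1 /gt => h.
have {h} := h erefl; move: (\big[_/_]_(_ < _ | _) _) (sig _ _) (sig _ _) e => X s1 s2.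
move: (par _) (par (tnth _ _)) (par a) (par b) (par (tnth L _)) (par (tnth L _)).
by move: X s1 s2 => [] [] [] [] [] [] [] [] [] // _ h; have := h erefl.
Qed.
Lemma sgt_col (i : 'I_n.-1) I L a b :
  par (tnth L (pos0 i)) (+) par (tnth L (pos1 i)) = par a (+) par b ->
  sgt I (upd2 L i a b) (+) gt par (tnth I (pos0 i)) (tnth I (pos1 i)) a b =
  sgt I L (+) gt par (tnth I (pos0 i)) (tnth I (pos1 i)) (tnth L (pos0 i)) (tnth L (pos1 i)).
Proof.
move=> e; rewrite /sgt !odd_degT !(dg_split i).
have := sig_congr (u := pv (upd2 L i a b)) (v := dv I (upd2 L i a b)) (u' := pv L) (v' := dv I L)
  (@pv_upd2 L i a b) (@dv_upd2r I L i a b).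
rewrite [\big[_/_]_(_ < _ | _) (_ && dv _ (upd2 _ _ _ _) _)](eq_bigr (fun k => pv L k && dv I L k)); last first.
  by move=> k hk; rewrite dv_upd2r // pv_upd2.
rewrite /pv /dv upd2_0 upd2_1 /gt => h.
have {h} := h (esym e); move: (\big[_/_]_(_ < _ | _) _) (sig _ _) (sig _ _) e => X s1 s2.
move: (par a) (par b) (par (tnth L _)) (par (tnth L _)) (par (tnth I _)) (par (tnth I _)).
by move: X s1 s2 => [] [] [] [] [] [] [] [] [] // _ h; have := h erefl.
Qed.
End SignFunctions.

Lemma sign_mulE (K : fieldType) (A : algType K) m (x : A) :
  (-1) ^+ m * x = ((-1) ^+ m : K) *: x.
Proof. by rewrite -mulr_algl -in_algE rmorphXn rmorphN1. Qed.

Section Commutation.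
Variables (K : fieldType) (q : K) (d : nat) (par : 'I_d -> bool).
Variable R : heckeSym q par.
Variable n : nat.

Lemma Zmx_rho (x : hecke q n) :
  map_mx (in_alg (ER R)) (rho R x) *m Zmx par n (zER R) = Zmx par n (zER R) *m map_mx (in_alg (ER R)) (rho R x).
Proof.
have -> : Zmx par n (zER R) = tensmx (K := K) (zER R) (fun F => \prod_(k < n) F k) (sgz par).
  by apply: enum_mxP => I L; rewrite !mxE !enum_rankK /Zmon /sgz signr_odd.
apply: tensmx_rho => [|k l i j|i I L a b|i I L a b].
- exact: adjacent_prod.
- by apply: RZZ_pair_comm; apply/ER_satP; exact: pgen_sat.
- exact: sgz_row.
- exact: sgz_col.
Qed.

Definition Ttil : tmat (ERp R) d n :=
  tensmx (K := K) (@tERp K q d par R) (fun F => \prod_(k < n) F (rev_ord k)) (sgt par).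

Lemma Ttil_rho (x : hecke q n) :
  map_mx (in_alg (ERp R)) (rho R x) *m Ttil = Ttil *m map_mx (in_alg (ERp R)) (rho R x).
Proof.
apply: tensmx_rho => [|k l i j|i I L a b|i I L a b].
- exact: adjacent_prod_rev.
- exact: tE_pair_comm.
- exact: sgt_row.
- exact: sgt_col.
Qed.

Lemma mulbar_Ttil (X : tmat (ERp R) d n) : mulbar par X (Tbar par n (@tERp K q d par R)) = X *m Ttil.
Proof.
apply: enum_mxP => I L; rewrite mulmx_enum mxE !enum_rankK; apply: eq_bigr => J _.
rewrite /tent !mxE !enum_rankK /Tmon /sgt /degT signr_odd exprD -scalerA -!scalerAr.
by rewrite sign_mulE !scalerA mulrC.
Qed.

Lemma trace_scalar_comm (A : algType K) (X : tmat A d n) (Y : tmat K d n) :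
  \tr (X *m map_mx (in_alg A) Y) = \tr (map_mx (in_alg A) Y *m X).
Proof.
rewrite /mxtrace; under eq_bigr => i _ do rewrite mxE.
under [RHS]eq_bigr => i _ do rewrite mxE.
rewrite exchange_big; apply: eq_bigr => j _; apply: eq_bigr => i _ /=.
by rewrite !mxE mulr_algl mulr_algr.
Qed.
End Commutation.

(** * The integral of the trace *)

Section EvenTensor.
Variables (K : fieldType) (KK : algType K) (B : superAlg K).
Local Notation AB := (stensor (purely_even KK) B).
Local Notation st k h := (stpure (A := purely_even KK) (B := B) k h).

Lemma st_evenM (k k' : KK) (h h' : B) : st k h * st k' h' = st (k * k') (h * h').
Proof.
have stD (a : KK) (x y : B) : st a (x + y) = st a x + st a y.
  by have := pure_r (A := purely_even KK) a 1 x y; rewrite !scale1r.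
have e p : st k (hc p h) * st k' h' = st (k * k') (hc p h * h').
  have hp : hc p (hc p h) = hc p h by rewrite hc_hc eqxx.
  have hk : hc (s := purely_even KK) false k' = k' by [].
  by rewrite (stpureM _ _ hp hk) andbF expr0 scale1r.
by rewrite -[h]hc_sum stD mulrDl !e -stD -mulrDl.
Qed.

Lemma st_scaler (c : K) (k : KK) (h : B) : st (c *: k) h = c *: st k h.
Proof. exact: stpureZl. Qed.
End EvenTensor.

Section TraceFunctions.
Variables (K : fieldType) (q : K) (d : nat) (par : 'I_d -> bool).
Variable R : heckeSym q par.
Variables (n : nat) (A : algType K) (E : tmat K d n) (W : tmat A d n).
Hypothesis E_rho : forall x : hecke q n, E *m rho R x = rho R x *m E.
Hypothesis W_rho : forall x : hecke q n,
  map_mx (in_alg A) (rho R x) *m W = W *m map_mx (in_alg A) (rho R x).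

Definition trace_fun (x : hecke q n) : A := \tr (map_mx (in_alg A) (E *m rho R x) *m W).

Lemma trace_fun_linear : linear trace_fun.
Proof.
move=> c x y; rewrite /trace_fun (@linearP _ _ _ _ (@rho K q d par R n)) mulmxDr map_mxD mulmxDl raddfD /=.
congr (_ + _); rewrite -scalemxAr /mxtrace scaler_sumr; apply: eq_bigr => i _.
rewrite !mxE scaler_sumr; apply: eq_bigr => j _.
by rewrite !mxE !mulr_algl scalerA.
Qed.
HB.instance Definition _ := GRing.isLinear.Build K (hecke q n) A *:%R trace_fun trace_fun_linear.

Lemma trace_fun_lincomb (I : finType) (P : pred I) (c : I -> K) (F : I -> hecke q n) :
  trace_fun (\sum_(i | P i) c i *: F i) = \sum_(i | P i) c i *: trace_fun (F i).
Proof. by rewrite linear_sum; apply: eq_bigr => i _; rewrite linearZ. Qed.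

Lemma trace_funC x y : trace_fun (x * y) = trace_fun (y * x).
Proof.
transitivity (\tr (map_mx (in_alg A) (E *m rho R x) *m W *m map_mx (in_alg A) (rho R y))).
  by rewrite -[in RHS]mulmxA -W_rho mulmxA -map_mxM -mulmxA -rhoM.
by rewrite trace_scalar_comm mulmxA -map_mxM mulmxA -E_rho -mulmxA -rhoM.
Qed.
End TraceFunctions.

Section IntegralOfTrace.
Variables (K : fieldType) (q : K) (d : nat) (par : 'I_d -> bool).
Variable R : heckeSym q par.
Variables (r s : nat) (int : {scalar HRs R}) (KK : algType K) (n : nat).
Hypothesis hnorm : normalized r s int.
Local Notation A := (stensor (purely_even KK) (HRs R)).
Local Notation st k h := (stpure (A := purely_even KK) (B := HRs R) k h).
Local Notation tup := (n.-tuple 'I_d).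

Lemma int_ext_bilinear : bilinear_map (fun (k : purely_even KK) (a : HRs R) => int a *: k : KK).
Proof.
split=> [v c x y|u c x y]; first by rewrite scalerDr !scalerA mulrC.
by rewrite linearP scalerDl scalerA.
Qed.
Lemma int_ext_pure k h : int_ext int (st k h) = int h *: k.
Proof. exact: (tlift_pure _ _ int_ext_bilinear). Qed.
Lemma int_ext_linear : linear (int_ext (KK := KK) int : A -> KK).
Proof. exact: (tlift_linear int_ext_bilinear). Qed.
Lemma int_extD : {morph (int_ext (KK := KK) int : A -> KK) : x y / x + y}.
Proof. by move=> x y; have := int_ext_linear 1 x y; rewrite !scale1r. Qed.
Lemma int_ext0 : int_ext (KK := KK) int (0 : A) = 0.
Proof. by have := int_ext_linear (-1) 0 0; rewrite scaler0 addr0 scaleN1r addNr. Qed.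
Lemma int_ext_sum (I : finType) (F : I -> A) : int_ext int (\sum_x F x) = \sum_x int_ext int (F x).
Proof. exact: (big_morph _ int_extD int_ext0). Qed.
Lemma int_ext_sign m (x : A) : int_ext int ((-1) ^+ m * x) = ((-1) ^+ m : K) *: int_ext int x.
Proof.
rewrite -signr_odd -[in RHS]signr_odd; case: (odd m); last by rewrite !expr0 mul1r scale1r.
rewrite !expr1 mulN1r scaleN1r; have := int_ext_linear (-1) x 0.
by rewrite scaleN1r int_ext0 !addr0 scaleN1r.
Qed.

Lemma mxtrace_enum (B : pzRingType) (X : finType) (M : 'M[B]_#|X|) :
  \tr M = \sum_x M (enum_rank x) (enum_rank x).
Proof. by rewrite /mxtrace (reindex enum_rank) //; apply: onW_bij; exact: enum_rank_bij. Qed.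

Lemma mulbar_enum (B : pzRingType) (X Y : tmat B d n) I L :
  mulbar par X Y (enum_rank I) (enum_rank L) =
  \sum_J (-1) ^+ (deg par L * (deg par J + deg par L))%N * (X (enum_rank I) (enum_rank J) * Y (enum_rank J) (enum_rank L)).
Proof. by rewrite mxE !enum_rankK. Qed.

Lemma sum4_exchange (X Y : finType) (V : nmodType) (F : X -> X -> X -> X -> Y -> V) :
  \sum_a \sum_b \sum_c \sum_e \sum_y F a b c e y = \sum_y \sum_a \sum_b \sum_c \sum_e F a b c e y.
Proof.
have fl (G : X -> X -> X -> X -> V) : \sum_a \sum_b \sum_c \sum_e G a b c e =
    \sum_(t : X * X * X * X) G t.1.1.1 t.1.1.2 t.1.2 t.2.
  by rewrite pair_bigA pair_bigA pair_bigA.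
rewrite (fl (fun a b c e => \sum_y F a b c e y)) exchange_big; apply: eq_bigr => y _.
by rewrite (fl (fun a b c e => F a b c e y)).
Qed.

Lemma signMr (B : pzRingType) m (x y : B) : (-1) ^+ m * x * y = (-1) ^+ m * (x * y).
Proof. by rewrite mulrA. Qed.

Lemma int_ext_trace (m u : tup -> tup -> KK) :
  let inH (x : HRs R) : A := st 1 x in
  let Zn : tmat A d n := map_mx inH (Zmx par n (zH R)) in
  let Tn : tmat A d n := map_mx inH (Tbar par n (tH R)) in
  int_ext int (\tr (mulbar par (mulbar par (tmx (fun I J => st (m I J) 1 : A) *m Zn)
     (tmx (fun I J => st (u I J) 1 : A))) Tn)) =
  \sum_w q ^- plength w *:
   ((\sum_L \sum_Q tent (Rw R w) Q L *: m L Q) *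
    (\sum_J \sum_P ((-1) ^+ (deg par J * (deg par P + deg par J))%N *
        tent (Pn R r s n *m tpow n (Cmx R) *m Rw R w^-1%g) J P) *: u P J)).
Proof.
move=> inH Zn Tn.
pose c w J P := (-1) ^+ (deg par J * (deg par P + deg par J))%N *
        tent (Pn R r s n *m tpow n (Cmx R) *m Rw R w^-1%g) J P.
transitivity (\sum_L \sum_J \sum_P \sum_Q \sum_w
   q ^- plength w *: ((tent (Rw R w) Q L *: m L Q) * (c w J P *: u P J))).
  rewrite mxtrace_enum int_ext_sum; apply: eq_bigr => L _.
  rewrite mulbar_enum int_ext_sum; apply: eq_bigr => J _.
  rewrite int_ext_sign mulbar_enum mulr_suml int_ext_sum scaler_sumr; apply: eq_bigr => P _.
  rewrite signMr int_ext_sign mulmx_enum !mulr_suml int_ext_sum !scaler_sumr; apply: eq_bigr => Q _.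
  rewrite !mxE !enum_rankK !st_evenM !mulr1 !mul1r int_ext_pure hnorm.
  transitivity ((\sum_w q ^- plength w * (tent (Rw R w) Q L * c w J P)) *: (m L Q * u P J)); last first.
    by rewrite scaler_suml; apply: eq_bigr => w _; rewrite -scalerAl -scalerAr !scalerA !mulrA.
  rewrite !scalerA; congr (_ *: _); rewrite !mulr_sumr; apply: eq_bigr => w _.
  (* The sign of the outer [mulbar] occurs once more in the normalization of the integral and
     cancels. That of the inner one stays with the entries of N, where it turns the barred matrix
     into the image of S(Z^n). *)
  have ss k : (-1) ^+ k * (-1) ^+ k = 1 :> K by rewrite -exprMn mulrNN mulr1 expr1n.
  rewrite /c [(deg par L + deg par J)%N]addnC; set sa := (-1) ^+ (deg par L * _)%N.
  set sb := (-1) ^+ _; set x := tent _ _ _; set y := tent _ _ _; set e := q ^- _.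
  transitivity (sa * sa * (e * (y * (sb * x)))); first by ring.
  by rewrite ss mul1r.
rewrite sum4_exchange; apply: eq_bigr => w _.
rewrite mulr_suml scaler_sumr; apply: eq_bigr => L _.
rewrite mulr_sumr scaler_sumr; apply: eq_bigr => J _.
rewrite mulr_sumr scaler_sumr; apply: eq_bigr => P _.
by rewrite mulr_suml scaler_sumr.
Qed.
End IntegralOfTrace.

Lemma h_hexp (K : fieldType) (q h : K) (hq : h ^+ 2 = q) (q0 : q != 0) r s n :
  q ^ (- (n%:Z * (r%:Z - s%:Z + 1))) * (hexp h r s n * hexp h r s n) = 1.
Proof.
have h0 : h != 0 by apply: contraNneq q0 => z; rewrite -hq z expr0n.
rewrite /hexp -hq; move: (n%:Z * _) => N.
by rewrite exprnP exprz_exp -!expfzDr // (_ : _ + _ = 0) ?expr0z //; lia.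
Qed.

(** * The trace functions in coordinates and the final formula *)

Section TraceFormulas.
Variables (K : fieldType) (q : K) (d : nat) (par : 'I_d -> bool).
Variable R : heckeSym q par.
Variables (n : nat) (KK : algType K).

Lemma trace_funE (A : algType K) (E : tmat K d n) (W : tmat A d n)
    (W_rho : forall x : hecke q n,
      map_mx (in_alg A) (rho R x) *m W = W *m map_mx (in_alg A) (rho R x)) (x : hecke q n) :
  trace_fun R E W x = \sum_L \sum_Q tent (rho R x) Q L *: (map_mx (in_alg A) E *m W) (enum_rank L) (enum_rank Q).
Proof.
rewrite /trace_fun map_mxM -mulmxA W_rho mulmxA mxtrace_enum; apply: eq_bigr => L _.
by rewrite mulmx_enum; apply: eq_bigr => Q _; rewrite [X in _ * X]mxE mulr_algr.
Qed.

Lemma trace_fun_TtilE (x : hecke q n) :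
  trace_fun R (tpow n (Cmx R)) (Ttil R n) x =
  \sum_J \sum_P ((-1) ^+ (deg par J * (deg par P + deg par J))%N *
     tent (tpow n (Cmx R) *m rho R x) J P) *: Tmon par (@tERp K q d par R) P J.
Proof.
rewrite /trace_fun -mulbar_Ttil mxtrace_enum; apply: eq_bigr => J _.
rewrite mulbar_enum; apply: eq_bigr => P _.
by rewrite sign_mulE [X in X * _]mxE mulr_algl scalerA [in X in _ = X]/tent !mxE !enum_rankK.
Qed.

Lemma Pn_C_Rw r s w : Pn R r s n *m tpow n (Cmx R) *m Rw R w =
  tpow n (Cmx R) *m rho R ((\sum_(l | Omega r s l) plam q r s l *: Flam q l) * Tw q w : hecke q n).
Proof.
rewrite rhoM mulmxA; congr (_ *m _); rewrite tpowC_rho; congr (_ *m _).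
by rewrite linear_sum; apply: eq_bigr => l _; rewrite linearZ.
Qed.
End TraceFormulas.

Theorem theorem4p2 (K : fieldType) (q h : K) (hq : h ^+ 2 = q)
  (d : nat) (par : 'I_d -> bool) (R : heckeSym q par)
  (r s : nat) (hbirank : birank R r s)
  (htr : \tr (Cmx R) = - qint q (s%:Z - r%:Z))
  (S : {linear HRs R -> HRs R}) (hS : is_antipode S)
  (rf : HRs R -> HRs R -> K) (hrf : coquasitriangular rf)
  (int : {scalar HRs R}) (hint : is_integral int)
  (hnorm : normalized r s int)
  (KK : algType K)
  (M : {lrmorphism ER R -> KK}) (N : {lrmorphism ERp R -> KK})
  (hMN : forall i j k l : 'I_d,
     M (zER R i j) * N (tERp R k l) = N (tERp R k l) * M (zER R i j))
  (n : nat) (e : n.-tuple 'I_n.+1 -> hecke q n)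
  (he : forall l, Omega r s l -> primitive_idempotent (e l) /\ in_block l (e l)) :
  let A := stensor (purely_even KK) (HRs R) in
  let inKK (x : KK) : A := stpure (A := purely_even KK) (B := HRs R) x 1 in
  let inH (x : HRs R) : A := stpure (A := purely_even KK) (B := HRs R) 1 x in
  let D := Dmx S rf in
  let Dn : tmat A d n := map_mx (st_in (purely_even KK) (HRs R)) (tpow n D) in
  let Mn : tmat A d n := map_mx (fun x => inKK (M x)) (Zmx par n (zER R)) in
  let Zn : tmat A d n := map_mx inH (Zmx par n (zH R)) in
  let Nn : tmat A d n := map_mx (fun x => inKK (N x)) (Tbar par n (tERp R)) in
  let Tn : tmat A d n := map_mx inH (Tbar par n (tH R)) in
  int_ext int (\tr (mulbar par (mulbar par (Dn *m Mn *m Zn) Nn) Tn)) =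
  q ^ (- (n%:Z * (r%:Z - s%:Z + 1))) *:
    \sum_(l : n.-tuple 'I_n.+1 | Omega r s l)
      ((dlam l)%:R * plam q r s l / klam q l) *:
        (M (Schar R h r s D (e l)) * N (Schar' R h r s (e l))).
Proof.
move=> A inKK inH D Dn Mn Zn Nn Tn.
pose phi0 := trace_fun R (tpow n D) (Zmx par n (zER R)).
pose psi0 := trace_fun R (tpow n (Cmx R)) (Ttil R n).
pose m (I J : n.-tuple 'I_d) := M ((map_mx (in_alg (ER R)) (tpow n D) *m Zmx par n (zER R)) (enum_rank I) (enum_rank J)).
pose u (I J : n.-tuple 'I_d) := N (Tmon par (@tERp K q d par R) I J).
have MZ (c : K) y : M (c *: y) = c *: M y by rewrite linearZ.
have NZ (c : K) y : N (c *: y) = c *: N y by rewrite linearZ.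
(* The scalars of D^n are absorbed into the values of M, so that every entry is a pure tensor with
   second factor 1, the form required by [int_ext_trace]. *)
have eM : Dn *m Mn = tmx (fun I J => inKK (m I J)).
  apply: enum_mxP => I J; rewrite mulmx_enum mxE !enum_rankK /inKK /m mulmx_enum raddf_sum.
  rewrite (@stpure_suml _ (purely_even KK) (HRs R)); apply: eq_bigr => L _.
  rewrite [Dn _ _]mxE [Mn _ _]mxE [map_mx _ (tpow n D) _ _]mxE st_inE mulr_algl.
  move: (tpow n D _ _) (Zmx _ _ _ _ _) => c y.
  by rewrite /inKK -st_scaler -MZ.
have eN : Nn = tmx (fun I J => inKK (u I J)).
  by apply: enum_mxP => I J; rewrite !mxE !enum_rankK.
rewrite eM eN (int_ext_trace hnorm).
have e1 w : \sum_L \sum_Q tent (Rw R w) Q L *: m L Q = M (phi0 (Tw q w)).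
  rewrite /phi0 trace_funE; last exact: Zmx_rho.
  rewrite raddf_sum; apply: eq_bigr => L _; rewrite raddf_sum; apply: eq_bigr => Q _.
  exact: (esym (MZ _ _)).
have e2 w : \sum_J \sum_P ((-1) ^+ (deg par J * (deg par P + deg par J))%N *
        tent (Pn R r s n *m tpow n (Cmx R) *m Rw R w) J P) *: u P J =
   \sum_(l | Omega r s l) plam q r s l *: N (psi0 (Flam q l * Tw q w)).
  transitivity (N (psi0 ((\sum_(l | Omega r s l) plam q r s l *: Flam q l) * Tw q w))).
    rewrite /psi0 trace_fun_TtilE raddf_sum; apply: eq_bigr => J _; rewrite raddf_sum.
    by apply: eq_bigr => P _; rewrite Pn_C_Rw; exact: (esym (NZ _ _)).
  rewrite mulr_suml; under eq_bigr => l _ do rewrite -scalerAl.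
  rewrite /psi0 trace_fun_lincomb raddf_sum; apply: eq_bigr => l _.
  exact: (NZ _ _).
under eq_bigr => w _ do rewrite e1 e2 mulr_sumr scaler_sumr.
rewrite exchange_big scaler_sumr; apply: eq_bigr => l Ol.
have [pe be] := he l Ol.
have q0 := hs_q0 R.
have pl : is_partition l by case/and3P: Ol.
have phiC x y : M (phi0 (x * y)) = M (phi0 (y * x)).
  rewrite /phi0 trace_funC //; first exact: (tpowD_rho hS hrf).
  exact: Zmx_rho.
have psiC x y : N (psi0 (x * y)) = N (psi0 (y * x)).
  rewrite /psi0 trace_funC //; first exact: tpowC_rho.
  exact: Ttil_rho.
have := sum_trace_block q0 (hs_q_root R) (hs_char0 R)
  (phi := M \o trace_fun R (tpow n D) (Zmx par n (zER R)))
  (psi := N \o trace_fun R (tpow n (Cmx R)) (Ttil R n)) phiC psiC pl pe be.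
rewrite /= -/phi0 -/psi0 => blk.
transitivity (plam q r s l *: \sum_w q ^- plength w *: (M (phi0 (Tw q w)) * N (psi0 (Flam q l * Tw q w^-1%g)))).
  rewrite scaler_sumr; apply: eq_bigr => w _.
  by rewrite -scalerAr !scalerA mulrC.
rewrite blk /Schar /Schar' -/(trace_fun R (tpow n D) _ (e l)) -/phi0.
rewrite mulbar_Ttil -/(trace_fun R (tpow n (Cmx R)) _ (e l)) -/psi0 !linearZ /=.
rewrite -scalerAl -scalerAr !scalerA; congr (_ *: _).
(* The half powers of q in the two characters multiply to q^(n(r-s+1)) and cancel the power in front
   of the sum. *)
have hh := h_hexp hq q0 r s n.
move: (q ^ _) (hexp _ _ _ _) (klam q l)^-1 (dlam l)%:R hh => x y z t hh.
by rewrite -[LHS]mul1r -hh; ring.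
Qed.
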